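(* Let $\lambda>0$. There exists a critical point $(\nabla,\Phi)$ of $\mathcal{Y}_1^{g_{\mathbb{R}^3}}$ on $\mathbb{R}^3$ such that $$0<\mathcal{Y}_1^{g_{\mathbb{R}^3}}(\nabla,\Phi)<\infty .$$
   Context: Here $\nabla$ is a smooth $SU(2)$-compatible connection on the ($SU(2)$-)bundle $E=\mathbb{R}^3\times\mathbb{C}^2$, with curvature $F_\nabla$, $\Phi$ is a smooth section of $\mathfrak{su}(E)$ (traceless skew-Hermitian endomorphisms, with metric $\langle a,b\rangle=-2\,\mathrm{tr}(ab)$), and $$\mathcal{Y}_1^{g_{\mathbb{R}^3}}(\nabla,\Phi)=\int_{\mathbb{R}^3}\Big(|F_\nabla|^2+|\nabla\Phi|^2+\frac{\lambda}{4}(1-|\Phi|^2)^2\Big)\mathrm{vol}$$ with respect to the Euclidean metric. A critical point is a pair with finite $\mathcal{Y}_1^{g_{\mathbb{R}^3}}$ solving $$d_\nabla^*F_\nabla=[\nabla\Phi,\Phi],\qquad\nabla^*\nabla\Phi=\frac{\lambda}{2}(1-|\Phi|^2)\Phi,$$ where $d_\nabla^*$ is the formal adjoint of the exterior covariant derivative and $\nabla^*\nabla$ the nonnegative rough Laplacian. *)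

(* Defs.v *)
From HB Require Import structures.
From mathcomp Require Import all_boot all_order all_algebra.
From mathcomp Require Import all_classical all_reals all_analysis.
From mathcomp Require Import complex ring.

Set Implicit Arguments.
Unset Strict Implicit.
Unset Printing Implicit Defensive.

Import Order.TTheory GRing.Theory Num.Theory.
Import numFieldNormedType.Exports.

Local Open Scope ring_scope.

Section Defs.
Variable R : realType.

(* Points of R^3 are row vectors; endomorphisms of the fibre C^2 are 2x2 complex
   matrices.  With respect to the standard frame of R^3 x C^2 and of R^3,
   a section of End(E) is a function R3 -> M2, an End(E)-valued 1-form a is the
   family of its components a i = a(d/dx_i), and a 2-form F the family
   F i j = F(d/dx_i, d/dx_j). *)
Definition R3 := 'rV[R]_3.
Definition M2 := 'M[R[i]]_2.
Definition end_section := R3 -> M2.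
Definition one_form := 'I_3 -> end_section.
Definition two_form := 'I_3 -> 'I_3 -> end_section.

Definition e_ (i : 'I_3) : R3 := delta_mx 0 i.

Fixpoint Ck (n : nat) (u : R3 -> R) : Prop :=
  continuous u /\
  if n is m.+1 then
    forall i, (forall x, derivable u x (e_ i)) /\ Ck m (fun x => 'D_(e_ i) u x)
  else True.

Definition smooth (u : R3 -> R) : Prop := forall n, Ck n u.

Definition re_entry (s : end_section) (k l : 'I_2) : R3 -> R :=
  fun x => complex.Re (s x k l).
Definition im_entry (s : end_section) (k l : 'I_2) : R3 -> R :=
  fun x => complex.Im (s x k l).

Definition smooth_section (s : end_section) : Prop :=
  forall k l, smooth (re_entry s k l) /\ smooth (im_entry s k l).

Definition pderiv (i : 'I_3) (s : end_section) : end_section := fun x =>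
  \matrix_(k, l) ('D_(e_ i) (re_entry s k l) x +i* 'D_(e_ i) (im_entry s k l) x)%C.

Definition su2 (a : M2) : Prop :=
  map_mx (@conjc R) a^T = - a /\ \tr a = 0.

Definition lie (a b : M2) : M2 := a *m b - b *m a.

(* The trace of a product of two elements of su(2) is real, so that on su(2)
   taking the real part only changes the type. *)
Definition inner (a b : M2) : R := - 2 * complex.Re (\tr (a *m b)).
Definition normsq (a : M2) : R := inner a a.

(* The SU(2)-compatible connections on R^3 x C^2 are exactly the d + A with A a
   smooth su(2)-valued 1-form; a connection is represented by its A. *)
Definition su2_connection (A : one_form) : Prop :=
  forall i, smooth_section (A i) /\ forall x, su2 (A i x).

Definition su2_section (Phi : end_section) : Prop :=
  smooth_section Phi /\ forall x, su2 (Phi x).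

Definition covd (A : one_form) (i : 'I_3) (s : end_section) : end_section :=
  fun x => pderiv i s x + lie (A i x) (s x).

Definition curvature (A : one_form) : two_form := fun i j x =>
  pderiv i (A j) x - pderiv j (A i) x + lie (A i x) (A j x).

Definition ext_covd (A : one_form) (a : one_form) : two_form := fun i j x =>
  covd A i (a j) x - covd A j (a i) x.

(* Formal adjoints of the covariant derivative [fun i => covd A i s] on sections
   and of [ext_covd A] on 1-forms; they are justified by [covd_adjoint] and
   [ext_covd_adjoint] below, where the two sides differ by a divergence, whose
   integral vanishes for compactly supported arguments. *)
Definition covd_adj (A : one_form) (a : one_form) : end_section := fun x =>
  - \sum_(i < 3) covd A i (a i) x.

Definition codiff (A : one_form) (F : two_form) : one_form := fun j x =>
  - \sum_(i < 3) covd A i (F i j) x.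

Definition rough_laplacian (A : one_form) (s : end_section) : end_section :=
  covd_adj A (fun i => covd A i s).

Definition inner1 (a b : one_form) (x : R3) : R :=
  \sum_(i < 3) inner (a i x) (b i x).
Definition inner2 (F G : two_form) (x : R3) : R :=
  \sum_(i < 3) \sum_(j < 3 | (i < j)%N) inner (F i j x) (G i j x).

Definition energy_density (lambda : R) (A : one_form) (Phi : end_section) (x : R3) : R :=
  inner2 (curvature A) (curvature A) x
  + inner1 (fun i => covd A i Phi) (fun i => covd A i Phi) x
  + lambda / 4 * (1 - normsq (Phi x)) ^+ 2.

(* Lebesgue measure of R^3 is taken as the product measure on R * R * R. *)
Definition vec3 (z : R * R * R) : R3 :=
  \row_(i < 3) nth 0 [:: z.1.1; z.1.2; z.2] i.

Definition YMH_energy (lambda : R) (A : one_form) (Phi : end_section) : \bar R :=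
  (\int[(lebesgue_measure \x lebesgue_measure) \x lebesgue_measure]_z
     (energy_density lambda A Phi (vec3 z))%:E)%E.

Definition critical_point (lambda : R) (A : one_form) (Phi : end_section) : Prop :=
  [/\ su2_connection A,
      su2_section Phi,
      (YMH_energy lambda A Phi < +oo)%E,
      forall j x, codiff A (curvature A) j x = lie (covd A j Phi x) (Phi x)
    & forall x, rough_laplacian A Phi x
                = (lambda / 2 * (1 - normsq (Phi x)))%:C%C *: Phi x].

Lemma complexReD (z w : R[i]) : complex.Re (z + w) = complex.Re z + complex.Re w.
Proof. by case: z w => [? ?] []. Qed.

Lemma complexReN (z : R[i]) : complex.Re (- z) = - complex.Re z.
Proof. by case: z. Qed.

Lemma innerE (a b : M2) : inner a b = - 2 * \sum_k \sum_l
  (complex.Re (a k l) * complex.Re (b l k) - complex.Im (a k l) * complex.Im (b l k)).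
Proof.
rewrite /inner /mxtrace; congr (_ * _).
rewrite (raddf_sum (@complex.Re R : Rcomplex R -> R)).
apply: eq_bigr => k _; rewrite mxE (raddf_sum (@complex.Re R : Rcomplex R -> R)).
by apply: eq_bigr => l _; case: (a k l) => ? ?; case: (b l k).
Qed.

Lemma smooth_derivable (u : R3 -> R) : smooth u -> forall i x, derivable u x (e_ i).
Proof. by move=> su i x; case: (su 1%N) => _ /(_ i)[]. Qed.

Lemma inner_pderiv (s t : end_section) i x : smooth_section s -> smooth_section t ->
  is_derive x (e_ i) (fun y => inner (s y) (t y))
    (inner (pderiv i s x) (t x) + inner (s x) (pderiv i t x)).
Proof.
move=> ss st.
have dRe u k l : smooth_section u ->
    is_derive x (e_ i) (re_entry u k l) ('D_(e_ i) (re_entry u k l) x).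
  by move=> su; apply: DeriveDef => //; apply: smooth_derivable; case: (su k l).
have dIm u k l : smooth_section u ->
    is_derive x (e_ i) (im_entry u k l) ('D_(e_ i) (im_entry u k l) x).
  by move=> su; apply: DeriveDef => //; apply: smooth_derivable; case: (su k l).
have -> : (fun y => inner (s y) (t y)) = (- 2 : R) \*: \sum_(k < 2) \sum_(l < 2)
    (re_entry s k l * re_entry t l k - im_entry s k l * im_entry t l k).
  apply/funext => y; rewrite innerE /= fct_sumE; congr (_ * _).
  by apply: eq_bigr => k _; rewrite fct_sumE.
have H k l : is_derive x (e_ i)
    (re_entry s k l * re_entry t l k - im_entry s k l * im_entry t l k) _ :=
  is_deriveB (is_deriveM (dRe s k l ss) (dRe t l k st))
             (is_deriveM (dIm s k l ss) (dIm t l k st)).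
have HH := is_deriveZ (- 2) (is_derive_sum (fun k => is_derive_sum (fun l => H k l))).
apply: is_derive_eq HH _.
rewrite !innerE -mulrDr -big_split /=; congr (_ * _); apply: eq_bigr => k _.
rewrite -big_split /=; apply: eq_bigr => l _.
rewrite !mxE /re_entry /im_entry /GRing.scale /=; ring.
Qed.

Lemma innerDl (a b c : M2) : inner (a + b) c = inner a c + inner b c.
Proof. by rewrite /inner mulmxDl mxtraceD complexReD mulrDr. Qed.

Lemma innerNl (a c : M2) : inner (- a) c = - inner a c.
Proof. by rewrite /inner mulNmx (raddfN (@mxtrace _ 2)) complexReN mulrN. Qed.

Lemma innerC (a b : M2) : inner a b = inner b a.
Proof. by rewrite /inner mxtrace_mulC. Qed.

Lemma inner_lie (a b c : M2) : inner (lie a b) c + inner b (lie a c) = 0.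
Proof.
rewrite /inner /lie -mulrDr -complexReD.
rewrite mulmxBl mulmxBr -mxtraceD !mulmxA addrA subrK.
by rewrite (raddfB (@mxtrace _ 2)) /= -!mulmxA (mxtrace_mulC a) mulmxA subrr mulr0.
Qed.

Lemma inner_covd (A : one_form) (s t : end_section) i (x : R3) :
  smooth_section s -> smooth_section t ->
  'D_(e_ i) (fun y => inner (s y) (t y)) x =
  inner (covd A i s x) (t x) + inner (s x) (covd A i t x).
Proof.
move=> ss st; rewrite (@derive_val _ _ _ _ _ _ _ (inner_pderiv i x ss st)).
rewrite /covd innerDl [in RHS](innerC (s x)) innerDl !(innerC _ (s x)).
by rewrite addrACA inner_lie addr0.
Qed.

Lemma inner_sumr (s : M2) (t : 'I_3 -> M2) :
  inner s (\sum_i t i) = \sum_i inner s (t i).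
Proof.
elim/big_rec2: _ => [|i u v _ IH]; first by rewrite /inner mulmx0 mxtrace0 mulr0.
by rewrite innerC innerDl -IH !(innerC _ s).
Qed.

Lemma covd_adjoint (A : one_form) (s : end_section) (a : one_form) x :
  smooth_section s -> (forall i, smooth_section (a i)) ->
  inner1 (fun i => covd A i s) a x - inner (s x) (covd_adj A a x) =
  \sum_(i < 3) 'D_(e_ i) (fun y => inner (s y) (a i y)) x.
Proof.
move=> ss sa; rewrite /covd_adj (innerC _ (- _)) innerNl opprK innerC inner_sumr.
by rewrite -big_split; apply: eq_bigr => i _ /=; rewrite (inner_covd A).
Qed.

Lemma ext_covd_adjoint (A a : one_form) (F : two_form) x :
  (forall j, smooth_section (a j)) -> (forall i j, smooth_section (F i j)) ->
  (forall i j y, F j i y = - F i j y) ->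
  inner2 (ext_covd A a) F x - inner1 a (codiff A F) x =
  \sum_(i < 3) 'D_(e_ i) (fun y => \sum_(j < 3) inner (a j y) (F i j y)) x.
Proof.
move=> sa sF Fanti.
have D i : 'D_(e_ i) (fun y => \sum_(j < 3) inner (a j y) (F i j y)) x =
    \sum_(j < 3) (inner (covd A i (a j) x) (F i j x)
                 + inner (a j x) (covd A i (F i j) x)).
  have -> : (fun y => \sum_(j < 3) inner (a j y) (F i j y)) =
      \sum_(j < 3) (fun y => inner (a j y) (F i j y)).
    by apply/funext => y; rewrite fct_sumE.
  have H := is_derive_sum (fun j => inner_pderiv i x (sa j) (sF i j)).
  rewrite (@derive_val _ _ _ _ _ _ _ H); apply: eq_bigr => j _.
  rewrite -(inner_covd A i x (sa j) (sF i j)).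
  by rewrite (@derive_val _ _ _ _ _ _ _ (inner_pderiv i x (sa j) (sF i j))).
under [RHS]eq_bigr do rewrite D big_split /=.
rewrite big_split /=; congr (_ + _); last first.
  rewrite exchange_big /= /inner1 -sumrN; apply: eq_bigr => j _.
  by rewrite /codiff (innerC _ (- _)) innerNl opprK innerC inner_sumr.
have Fd i : F i i x = 0.
  by apply/matrixP => k l; have /(congr1 (fun m : M2 => m k l)) := Fanti i i x;
    rewrite !mxE => /eqP; rewrite -addr_eq0 -mulr2n mulrn_eq0 => /eqP.
have i0 t : inner t 0 = 0 by rewrite /inner mulmx0 mxtrace0 mulr0.
pose G i j := inner (covd A i (a j) x) (F i j x).
have E i j : inner (ext_covd A a i j x) (F i j x) = G i j + G j i.
  rewrite /ext_covd innerDl innerNl /G (Fanti i j).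
  by rewrite [inner _ (- _)]innerC innerNl (innerC (F i j x)).
have Gd i : G i i = 0 by rewrite /G Fd i0.
have -> : inner2 (ext_covd A a) F x =
    \sum_(i < 3) \sum_(j < 3) if (i < j)%N then G i j + G j i else 0.
  by apply: eq_bigr => i _; rewrite -big_mkcond; apply: eq_bigr => j _.
rewrite -[RHS]/(\sum_(i < 3) \sum_(j < 3) G i j).
rewrite !big_ord_recl !big_ord0 /= !Gd; ring.
Qed.

End Defs.

(* Main.v *)
Require Import Defs.
From HB Require Import structures.
From mathcomp Require Import all_boot all_order all_algebra.
From mathcomp Require Import all_classical all_reals all_analysis.
From mathcomp Require Import measurable_realfun.
From mathcomp Require Import ring lra complex.

(* The solution is the hedgehog [Phi_a = p(r) x_a], [A_i = c(r) e_i x x].  With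
   [K = 1 - r^2 c] and [h = r p] the equations reduce to
     [K'' = K (K^2 - 1) / r^2 + K h^2],
     [h'' + 2 h' / r = 2 K^2 h / r^2 + lambda / 2 h (h^2 - 1)],
   a system which is cooperative in [(1 - K, h)].  Hence it has a solution between
   the subsolution [h = r^2 / (B + r^2)], [K = 1 - h^2] ([B] large) and the
   supersolution [K = exp (- r)], [h = 1]: after inverting the linear part by
   positive integral operators it is a fixed point of a monotone map on a complete
   lattice of nonincreasing functions.  In terms of [c] and [p] both equations read
   [f'' + 4 f' / r = G(r^2, c, p)] with [G] polynomial, so bounded solutions are
   smooth functions of [r^2].  The barriers give [K = O(r^-2)], [1 - h = O(r^-2)];
   interpolating between a function and its second derivative bounds [K'] and [h'],
   so that the energy density is [O(r^-4)].  It is positive at the origin since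
   [Phi(0) = 0]. *)

Set Implicit Arguments.
Unset Strict Implicit.
Unset Printing Implicit Defensive.

Import Order.TTheory GRing.Theory Num.Theory.
Import numFieldNormedType.Exports.

Local Open Scope classical_set_scope.
Local Open Scope ring_scope.

(** * Calculus on the line *)

Section RealTools.
Variable R : realType.
Notation mu := (@lebesgue_measure R).
Implicit Types (f g F : R -> R) (a b r t : R).

(** In the equations for [chi = (1 - K) / r^2] and [phi = h / r] the nonlinearity is not increasing
    in each unknown by itself, so a term [Q p] is subtracted on both sides. The Gaussian [psi]
    satisfies [psi'' + 4 psi' / r = Q psi] with an explicit [Q >= max (1, lambda)]; for
    [v = p / psi] the left side [p'' + 4 p' / r - Q p] becomes [(r^4 psi^2 v')' / (r^4 psi)], which
    two integrations invert, the inner one from the origin and the outer one from infinity. The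
    supersolution has to be chosen with care. The pair [K = 0], [h = 1] solves the same system, but
    its Higgs field [x / |x|] is singular, and with it as upper barrier the greatest fixed point
    would be this pair itself. The barrier [K = exp (- r)] excludes it: it forces [1 - K <= r], so
    that [chi] and [phi] are both [O(1 / r)]. From this weak bound a bootstrap at the origin reaches
    boundedness, and only then does regularity theory apply. *)

Lemma nondecreasing_itv_measurable (i : interval R) f :
  {in i &, {homo f : x y / x <= y}} -> measurable_fun [set` i] f.
Proof.
move=> nd; apply: (measurability (@RGenCInfty.G R)) => [|/= _ [_] [r] -> <-].
  exact: RGenCInfty.measurableE.
apply: is_interval_measurable => s t/= [si fs] [ti ft] u /andP[su ut].
have ui : u \in i.
  by apply: (@interval_is_interval _ i s t) => //; rewrite su ut.
split => //; move: fs; rewrite !in_itv/= !andbT => /le_trans; apply.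
exact: nd.
Qed.

Lemma nonincreasing_itv_measurable (i : interval R) f :
  {in i &, {homo f : x y /~ x <= y}} -> measurable_fun [set` i] f.
Proof.
move=> ni; rewrite -(opprK f); apply/measurable_funN.
by apply: nondecreasing_itv_measurable => x y xi yi xy; rewrite lerN2 ni.
Qed.

Lemma is_derive_continuous f (x df : R) : is_derive x 1 f df -> {for x, continuous f}.
Proof.
by case=> dfx _; apply: differentiable_continuous; rewrite -derivable1_diffP.
Qed.

Lemma is_derive1E f (x df : R) : is_derive x 1 f df -> derive1 f x = df.
Proof. by move=> H; rewrite derive1E derive_val. Qed.

Lemma integrable_continuous_oc f r t : {within `[r, t], continuous f} ->
  mu.-integrable `]r, t] (EFin \o f).
Proof.
move=> cf; apply: (@integrableS _ _ _ mu `[r, t]) => //.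
  exact: subset_itv_oc_cc.
by apply: continuous_compact_integrable => //; exact: segment_compact.
Qed.

Lemma Rintegral_FTC f F r t : r < t -> continuous f ->
  (forall x : R, is_derive x 1 F (f x)) ->
  (\int[mu]_(x in `]r, t]) f x)%R = F t - F r.
Proof.
move=> rt cf dF; rewrite Rintegral_itv_obnd_cbnd; last first.
  by apply: integrable_continuous_oc; exact: continuous_subspaceT.
rewrite /Rintegral (@continuous_FTC2 _ f F r t) //.
- exact: continuous_subspaceT.
- split=> [x _||]; first by case: (dF x).
    by apply: cvg_at_right_filter; apply: is_derive_continuous (dF r).
  by apply: cvg_at_left_filter; apply: is_derive_continuous (dF t).
- by move=> x _; apply: is_derive1E.
Qed.

Lemma integral_FTCy f F r : 0 < r -> (forall x : R, 0 < x -> 0 <= f x) ->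
  (forall x : R, 0 < x -> {for x, continuous f}) ->
  (forall x : R, 0 < x -> is_derive x 1 F (- f x)) ->
  F x @[x --> +oo] --> 0 ->
  (\int[mu]_(x in `[r, +oo[) (f x)%:E = (F r)%:E)%E.
Proof.
move=> r0 f0 cf dF F0; have gt0 (x : R) : r <= x -> 0 < x by exact: lt_le_trans.
have dNF (x : R) : 0 < x -> is_derive x 1 (- F) (f x).
  by move=> /dF dFx; apply: is_derive_eq (is_deriveN dFx) _; rewrite opprK.
rewrite (@ge0_continuous_FTC2y _ f (- F) r 0).
- by rewrite -EFinN -EFinD sub0r opprK.
- by move=> x rx; apply/f0/gt0.
- apply/continuous_within_itvcyP; split.
    by move=> x; rewrite in_itv/= andbT => rx; apply/cf/gt0/ltW.
  exact/cvg_at_right_filter/cf.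
- by rewrite -oppr0; apply: cvgN.
- by move=> x rx; case: (dNF x) => //; exact: (lt_trans r0).
- by apply: cvg_at_right_filter; exact: is_derive_continuous (dNF _ r0).
- by move=> x; rewrite in_itv/= andbT => rx; apply: is_derive1E; apply/dNF/gt0/ltW.
Qed.

Lemma is_derive_integral_oc f a t u : a < t -> t < u ->
  mu.-integrable `]a, u] (EFin \o f) -> {for t, continuous f} ->
  is_derive t 1 (fun x : R => \int[mu]_(s in `]a, x]) f s)%R (f t).
Proof.
move=> at_ tu intf cf.
have ab : (BRight a < BRight t)%O by rewrite bnd_simp.
have [d e] := @continuous_FTC1 _ f (BRight a) t u tu intf ab cf.
by apply: DeriveDef; [exact: d|rewrite -derive1E].
Qed.

(** Near [t] the primitive differs by a constant from the one based at the midpoint [c], whose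
    intervals are closed. This makes the flux continuous before its source is known to be so. *)
Lemma integral_oc_continuous f a t u : a < t -> t < u ->
  mu.-integrable `]a, u] (EFin \o f) ->
  {for t, continuous (fun x : R => \int[mu]_(s in `]a, x]) f s)%R}.
Proof.
move=> at_ tu intf; pose c := (a + t) / 2.
have ac : a < c by rewrite /c; lra.
have ct : c < t by rewrite /c; lra.
have intc : mu.-integrable `[c, u] (EFin \o f).
  by apply: integrableS intf => //; apply: subset_itvr; rewrite bnd_simp.
have cont : {for t, continuous (fun x : R => parameterized_integral mu c x f)}.
  have := parameterized_integral_continuous (ltW (lt_trans ct tu)) intc.
  move/continuous_within_itvP => /(_ (lt_trans ct tu))[+ _ _].
  by apply; rewrite in_itv/= ct.
have E : {near t, (fun x => \int[mu]_(s in `]a, c]) f s + parameterized_integral mu c x f)%R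
    =1 (fun x : R => \int[mu]_(s in `]a, x]) f s)%R}.
  near=> x; have cx : c < x by near: x; exact: lt_nbhsr.
  have xu : x < u by near: x; exact: lt_nbhsl.
  have iax : mu.-integrable `]a, x] (EFin \o f).
    by apply: integrableS intf => //; apply: subset_itvl; rewrite bnd_simp ltW.
  have := @Rintegral_itvB _ f (BRight a) (BRight x) c iax.
  rewrite !bnd_simp (ltW ac) (ltW cx) => /(_ isT isT) H.
  rewrite /parameterized_integral -Rintegral_itv_obnd_cbnd; last first.
    by apply: integrableS iax => //; apply: subset_itvr; rewrite bnd_simp ltW.
  by rewrite -H addrC subrK.
have H : (fun x => \int[mu]_(s in `]a, c]) f s + parameterized_integral mu c x f)%R x
    @[x --> t] --> (\int[mu]_(s in `]a, c]) f s + parameterized_integral mu c t f)%R.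
  by apply: cvgD; [exact: cvg_cst|exact: cont].
rewrite /prop_for/continuous_at -(nbhs_singleton E).
by apply: cvg_trans H; apply: near_eq_cvg.
Unshelve. all: by end_near. Qed.

End RealTools.

Section DerivativeRules.
Variable R : realType.
Implicit Types (f g : R -> R) (x c a b : R).

Lemma der_cst x c : is_derive x 1 (fun _ : R => c) 0.
Proof. exact: is_derive_cst. Qed.

Lemma der_id x : is_derive x 1 (fun y : R => y) 1.
Proof. exact: is_derive_id. Qed.

Lemma der_add f g x a b : is_derive x 1 f a -> is_derive x 1 g b ->
  is_derive x 1 (fun y : R => f y + g y) (a + b).
Proof. exact: is_deriveD. Qed.

Lemma der_opp f x a : is_derive x 1 f a -> is_derive x 1 (fun y : R => - f y) (- a).
Proof. exact: is_deriveN. Qed.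

Lemma der_mul f g x a b : is_derive x 1 f a -> is_derive x 1 g b ->
  is_derive x 1 (fun y : R => f y * g y) (a * g x + f x * b).
Proof.
move=> df dg; apply: is_derive_eq (is_deriveM df dg) _.
by rewrite addrC /GRing.scale/= mulrC.
Qed.

Lemma der_exp f x a n : is_derive x 1 f a ->
  is_derive x 1 (fun y : R => f y ^+ n) (n%:R * f x ^+ n.-1 * a).
Proof. by move=> df; have := is_deriveX n df; rewrite exprfctE. Qed.

Lemma der_inv f x a : f x != 0 -> is_derive x 1 f a ->
  is_derive x 1 (fun y : R => (f y)^-1) (- a / f x ^+ 2).
Proof.
move=> f0 [df <-]; apply: DeriveDef; first exact: derivableV.
by rewrite deriveV// /GRing.scale/= mulrC mulNr mulrN.
Qed.

Lemma der_comp g f x a b : is_derive (f x) 1 g b -> is_derive x 1 f a ->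
  is_derive x 1 (fun y : R => g (f y)) (b * a).
Proof.
move=> dg df; have [g' gE] := dg; have [f' fE] := df; apply: DeriveDef.
  apply/derivable1_diffP; have := @differentiable_comp _ _ _ _ f g x.
  by apply; apply/derivable1_diffP; [exact: f'|exact: g'].
by have := derive1_comp f' g'; rewrite !derive1E gE fE => <-.
Qed.

Lemma der_expR f x a : is_derive x 1 f a ->
  is_derive x 1 (fun y : R => expR (f y)) (expR (f x) * a).
Proof. by apply: der_comp; exact: is_derive_expR. Qed.

Lemma der_eq f x a b : is_derive x 1 f a -> a = b -> is_derive x 1 f b.
Proof. by move=> + <-. Qed.

End DerivativeRules.

Section ContinuityRules.
Variables (R : realType) (T : topologicalType) (x : T).
Implicit Types (f g : T -> R).

Lemma cont_cst (c : R) : {for x, continuous (fun _ : T => c)}.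
Proof. exact: cvg_cst. Qed.

Lemma cont_add f g : {for x, continuous f} -> {for x, continuous g} ->
  {for x, continuous (fun y => f y + g y)}.
Proof. exact: continuousD. Qed.

Lemma cont_opp f : {for x, continuous f} -> {for x, continuous (fun y => - f y)}.
Proof. exact: continuousN. Qed.

Lemma cont_mul f g : {for x, continuous f} -> {for x, continuous g} ->
  {for x, continuous (fun y => f y * g y)}.
Proof. exact: continuousM. Qed.

Lemma cont_exp f n : {for x, continuous f} -> {for x, continuous (fun y => f y ^+ n)}.
Proof.
move=> cf; apply: (@continuous_comp _ _ _ f (fun z => z ^+ n)) => //.
exact: exprn_continuous.
Qed.

End ContinuityRules.

Ltac nonneg := lazymatch goal with
  | |- is_true (0 <= @GRing.add _ _ _) => apply: addr_ge0; nonneg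
  | |- is_true (0 <= @GRing.mul _ _ _) => apply: mulr_ge0; nonneg
  | |- is_true (0 <= @GRing.inv _ _) => rewrite invr_ge0; nonneg
  | |- is_true (0 <= @GRing.exp _ _ 2) => exact: sqr_ge0
  | |- is_true (0 <= @GRing.exp _ _ _) => apply: exprn_ge0; nonneg
  | |- _ => first [assumption | exact: ler01 | exact: ler0n | apply: ltW; assumption]
  end.

Ltac cont_step := lazymatch goal with |- prop_for _ ?F => idtac | |- _ => fail end;
  match goal with |- context [continuous_at _ ?F] =>
  lazymatch F with
  | fun y => @GRing.add _ (@?f y) (@?g y) => refine (@cont_add _ _ _ f g _ _)
  | fun y => @GRing.opp _ (@?f y) => refine (@cont_opp _ _ _ f _)
  | fun y => @GRing.mul _ (@?f y) (@?g y) => refine (@cont_mul _ _ _ f g _ _)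
  | fun y => @GRing.exp _ (@?f y) _ => refine (@cont_exp _ _ _ f _ _)
  | _ => first [eassumption | refine (@cont_cst _ _ _ _)]
  end end.

(* Type class resolution for [is_derive] is avoided: it is slow on lambda terms. *)
Ltac derive_step := lazymatch goal with |- is_derive _ _ ?F _ =>
  lazymatch F with
  | fun y => y => notypeclasses refine (@der_id _ _)
  | fun y => @GRing.add _ (@?f y) (@?g y) =>
      notypeclasses refine (@der_add _ f g _ _ _ _ _)
  | fun y => @GRing.opp _ (@?f y) =>
      notypeclasses refine (@der_opp _ f _ _ _)
  | fun y => @GRing.mul _ (@?f y) (@?g y) =>
      notypeclasses refine (@der_mul _ f g _ _ _ _ _)
  | fun y => @GRing.exp _ (@?f y) _ =>
      notypeclasses refine (@der_exp _ f _ _ _ _)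
  | fun y => @GRing.inv _ (@?f y) =>
      notypeclasses refine (@der_inv _ f _ _ _ _)
  | fun y => expR (@?f y) =>
      notypeclasses refine (@der_expR _ f _ _ _)
  | _ => first [notypeclasses refine (@der_cst _ _ _) | eassumption]
  end end.
Ltac derive_tac :=
  notypeclasses refine (der_eq _ _); [repeat derive_step|].

(** * Monotone fixed points for second-order systems *)

Section FixedPoint.
Variable R : realType.
Notation mu := (@lebesgue_measure R).
Notation pos := (`]0%R, +oo[%classic : set R).
(** Abstract form of the system: [(v' / g)' = - N (v)] on the positive half-line, with [v] vanishing
    at infinity and [v' / g] at the origin. [PU] and [PL] stand for [U' / g] and [L' / g], so that
    [leU] and [geL] make [U] a supersolution and [L] a subsolution. *)
Variables (N : bool -> R -> R -> R -> R) (g : R -> R).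
Variables (U PU dPU L PL dPL : bool -> R -> R).

Hypothesis measN : forall b (x y : R -> R), measurable_fun pos x ->
  measurable_fun pos y -> measurable_fun pos (fun t => N b t (x t) (y t)).
Hypothesis contN : forall b (x y : R -> R) (t : R), {for t, continuous x} ->
  {for t, continuous y} -> {for t, continuous (fun t => N b t (x t) (y t))}.
Hypothesis monoN : forall b (t x x' y y' : R), 0 < t -> 0 <= x -> x <= x' ->
  x' <= U true t -> 0 <= y -> y <= y' -> y' <= U false t ->
  N b t x y <= N b t x' y'.
Hypothesis N0 : forall b (t : R), 0 < t -> N b t 0 0 = 0.

Hypothesis g_gt0 : forall t : R, 0 < t -> 0 < g t.
Hypothesis contg : forall t : R, 0 < t -> {for t, continuous g}.

Hypothesis dU : forall b (t : R), 0 < t -> is_derive t 1 (U b) (g t * PU b t).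
Hypothesis U_y : forall b, U b t @[t --> +oo] --> 0.
Hypothesis PU_0 : forall b, PU b 0 = 0.
Hypothesis derPU : forall b (t : R), is_derive t 1 (PU b) (dPU b t).
Hypothesis contdPU : forall b, continuous (dPU b).
Hypothesis leU : forall b (t : R), 0 < t -> N b t (U true t) (U false t) <= - dPU b t.

Hypothesis L_ge0 : forall b (t : R), 0 < t -> 0 <= L b t <= U b t.
Hypothesis dL : forall b (t : R), 0 < t -> is_derive t 1 (L b) (g t * PL b t).
Hypothesis L_y : forall b, L b t @[t --> +oo] --> 0.
Hypothesis PL_0 : forall b, PL b 0 = 0.
Hypothesis derPL : forall b (t : R), is_derive t 1 (PL b) (dPL b t).
Hypothesis contdPL : forall b, continuous (dPL b).
Hypothesis geL : forall b (t : R), 0 < t -> - dPL b t <= N b t (L true t) (L false t).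

Implicit Types (v : bool -> R -> R) (b : bool).

Definition admissible v := (forall b, measurable_fun pos (v b)) /\
  forall b (t : R), 0 < t -> 0 <= v b t <= U b t.

Definition source v b (t : R) := N b t (v true t) (v false t).
Definition flux v b (t : R) : R := \int[mu]_(x in `]0, t]) source v b x.
Definition slope v b (t : R) := g t * flux v b t.
(** The inverse of [v -> - (v' / g)'] under these boundary conditions, applied to the source:
    [green v = v] is the integrated system. *)
Definition green v b (r : R) : R := \int[mu]_(t in `[r, +oo[) slope v b t.

Lemma source_bounds v b (t : R) : admissible v -> 0 < t ->
  0 <= source v b t <= - dPU b t.
Proof.
move=> [_ av] t0; have /andP[v1 v1'] := av true t t0.
have /andP[v2 v2'] := av false t t0.
apply/andP; split; first by rewrite -(N0 b t0); apply: monoN.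
by apply: le_trans (leU b t0); apply: monoN.
Qed.

Lemma source_integrable v b (t : R) : admissible v ->
  mu.-integrable `]0, t] (EFin \o source v b).
Proof.
move=> av; have [mv _] := av.
apply: (@le_integrable _ _ _ mu _ _ _ (EFin \o (fun x => - dPU b x))) => //.
- apply/measurable_EFinP; apply: (@measurable_funS _ _ _ _ pos) => //.
    by move=> x /=; rewrite !in_itv/= => /andP[->].
  exact: measN.
- move=> x /=; rewrite in_itv/= => /andP[x0 _].
  have /andP[s0 s1] := source_bounds b av x0.
  by rewrite lee_fin !ger0_norm// (le_trans s0).
- apply: integrable_continuous_oc; apply: continuous_subspaceT => x.
  by apply: continuousN; exact: contdPU.
Qed.

Lemma flux_bounds v b (t : R) : admissible v -> 0 < t ->
  0 <= flux v b t <= - PU b t.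
Proof.
move=> av t0; apply/andP; split.
  apply: Rintegral_ge0 => x; rewrite /= in_itv/= => /andP[x0 _].
  by case/andP: (source_bounds b av x0).
have cN : continuous (fun x => - dPU b x).
  by move=> x; apply: continuousN; exact: contdPU.
have <- : (\int[mu]_(x in `]0%R, t]) (- dPU b x))%R = - PU b t.
  rewrite (@Rintegral_FTC _ _ (fun x => - PU b x) 0 t) ?PU_0 ?oppr0 ?addr0//.
apply: le_Rintegral => //; first exact: source_integrable.
  by apply: integrable_continuous_oc; exact: continuous_subspaceT.
move=> x; rewrite /= in_itv/= => /andP[x0 _].
by case/andP: (source_bounds b av x0).
Qed.

Lemma flux_nd v b : admissible v ->
  {in `]0, +oo[ &, {homo flux v b : x y / x <= y}}.
Proof.
move=> av x y; rewrite !in_itv/= !andbT => x0 y0 xy.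
rewrite -subr_ge0 Rintegral_itvB ?bnd_simp// ?(ltW x0)//; last exact: source_integrable.
apply: Rintegral_ge0 => z; rewrite /= in_itv/= => /andP[xz _].
by case/andP: (source_bounds b av (lt_trans x0 xz)).
Qed.

Lemma flux_mono v v' b (t : R) : admissible v -> admissible v' ->
  (forall c (s : R), 0 < s -> v c s <= v' c s) -> flux v b t <= flux v' b t.
Proof.
move=> av av' vv'; apply: le_Rintegral => //; try exact: source_integrable.
move=> x; rewrite /= in_itv/= => /andP[x0 _].
have /andP[v1 v1'] := av.2 true x x0; have /andP[v2 v2'] := av.2 false x x0.
have /andP[_ w1'] := av'.2 true x x0; have /andP[_ w2'] := av'.2 false x x0.
by apply: monoN => //; apply: vv'.
Qed.

Lemma measurable_weight : measurable_fun pos g.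
Proof.
apply: open_continuous_measurable_fun => //.
by move=> x; rewrite inE/= in_itv/= andbT => /contg.
Qed.

Lemma slope_measurable v b : admissible v -> measurable_fun pos (slope v b).
Proof.
move=> av; apply: measurable_funM; first exact: measurable_weight.
by apply: nondecreasing_itv_measurable; exact: flux_nd.
Qed.

Lemma slope_bounds v b (t : R) : admissible v -> 0 < t ->
  0 <= slope v b t <= - (g t * PU b t).
Proof.
move=> av t0; have /andP[f0 f1] := flux_bounds b av t0.
rewrite /slope mulr_ge0 ?(ltW (g_gt0 t0))//=.
by rewrite -mulrN ler_pM2l// g_gt0.
Qed.

Lemma contU' b (t : R) : 0 < t -> {for t, continuous (fun x => - (g x * PU b x))}.
Proof.
move=> t0; apply: continuousN; apply: continuousM; first exact: contg.
exact: is_derive_continuous (derPU b t).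
Qed.

(** The flux of the admissible pair 0 is caught between 0 and [- PU b t]. *)
Lemma PU_le0 b (t : R) : 0 < t -> PU b t <= 0.
Proof.
move=> t0; have av : admissible (fun _ _ => 0).
  split=> [//|c s s0]; rewrite lexx/=.
  by have /andP[/le_trans] := L_ge0 c s0; apply.
by have /andP[/le_trans/[apply]] := flux_bounds b av t0; rewrite oppr_ge0.
Qed.

Lemma integralU b (r : R) : 0 < r ->
  (\int[mu]_(x in `[r, +oo[) (- (g x * PU b x))%:E = (U b r)%:E)%E.
Proof.
move=> r0; apply: (@integral_FTCy _ _ (U b)) => //.
- by move=> x x0; rewrite -mulrN mulr_ge0 ?oppr_ge0 ?PU_le0// ltW// g_gt0.
- exact: contU'.
- by move=> x x0; rewrite opprK; exact: dU.
Qed.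

Lemma subset_pos (r : R) : 0 < r -> `[r, +oo[ `<=` pos.
Proof. by move=> r0 x /=; rewrite !in_itv/= !andbT; exact: lt_le_trans. Qed.

Lemma integrable_ge0 (f : R -> R) (r l : R) : 0 < r -> measurable_fun pos f ->
  (forall x : R, 0 < x -> 0 <= f x) ->
  (\int[mu]_(x in `[r, +oo[) (f x)%:E = l%:E)%E ->
  mu.-integrable `[r, +oo[ (EFin \o f).
Proof.
move=> r0 mf f0 If; apply/integrableP; split.
  by apply/measurable_EFinP; apply: measurable_funS mf => //; exact: subset_pos.
under eq_integral => x.
  rewrite inE/= in_itv/= andbT => rx.
  rewrite ger0_norm; last by apply: f0; exact: lt_le_trans rx.
  over.
by rewrite If ltry.
Qed.

Lemma integrableU b (r : R) : 0 < r ->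
  mu.-integrable `[r, +oo[ (EFin \o (fun x => - (g x * PU b x))).
Proof.
move=> r0; apply: (@integrable_ge0 _ _ (U b r)) => //.
- apply: open_continuous_measurable_fun => //.
  by move=> x; rewrite inE/= in_itv/= andbT; exact: contU'.
- by move=> x x0; rewrite -mulrN mulr_ge0 ?oppr_ge0 ?PU_le0// ltW// g_gt0.
- exact: integralU.
Qed.

Lemma slope_integrable v b (r : R) : admissible v -> 0 < r ->
  mu.-integrable `[r, +oo[ (EFin \o slope v b).
Proof.
move=> av r0.
apply: (@le_integrable _ _ _ mu _ _ _ (EFin \o (fun x => - (g x * PU b x)))) => //.
- apply/measurable_EFinP; apply: measurable_funS (slope_measurable b av) => //.
  exact: subset_pos.
- move=> x /= /(subset_pos r0); rewrite /= in_itv/= andbT => x0.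
  have /andP[s0 s1] := slope_bounds b av x0.
  by rewrite lee_fin !ger0_norm// (le_trans s0).
- exact: integrableU.
Qed.

Lemma green_bounds v b (r : R) : admissible v -> 0 < r ->
  0 <= green v b r <= U b r.
Proof.
move=> av r0; apply/andP; split.
  apply: Rintegral_ge0 => x /(subset_pos r0); rewrite /= in_itv/= andbT => x0.
  by case/andP: (slope_bounds b av x0).
have -> : U b r = (\int[mu]_(x in `[r, +oo[) (- (g x * PU b x)))%R.
  by rewrite /Rintegral integralU.
apply: le_Rintegral => //; [exact: slope_integrable|exact: integrableU|].
move=> x /(subset_pos r0); rewrite /= in_itv/= andbT => x0.
by case/andP: (slope_bounds b av x0).
Qed.

Lemma green_sub v b (r s : R) : admissible v -> 0 < r -> r <= s ->
  green v b r - green v b s = (\int[mu]_(x in `[r, s]) slope v b x)%R.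
Proof.
move=> av r0 rs; have s0 := lt_le_trans r0 rs.
have iw := slope_integrable b av r0.
have := @Rintegral_itvB _ (slope v b) (BLeft r) +oo%O s iw.
rewrite bnd_simp => /(_ rs isT); rewrite [X in _ - _ = X]Rintegral_itv_obnd_cbnd.
  by move=> H; rewrite /green -H opprB addrC subrK.
by apply: integrableS iw => //; apply: subset_itvr; rewrite bnd_simp.
Qed.

Lemma green_ni v b : admissible v ->
  {in `]0, +oo[ &, {homo green v b : x y /~ x <= y}}.
Proof.
move=> av x y; rewrite !in_itv/= !andbT => x0 y0 xy.
rewrite -subr_ge0 green_sub//.
apply: Rintegral_ge0 => z; rewrite /= in_itv/= => /andP[yz _].
by case/andP: (slope_bounds b av (lt_le_trans y0 yz)).
Qed.

Lemma green_admissible v : admissible v -> admissible (green v).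
Proof.
move=> av; split=> [b|b t t0]; last exact: green_bounds.
by apply: nonincreasing_itv_measurable; exact: green_ni.
Qed.

Lemma green_mono v v' b (t : R) : admissible v -> admissible v' ->
  (forall c (s : R), 0 < s -> v c s <= v' c s) -> 0 < t ->
  green v b t <= green v' b t.
Proof.
move=> av av' vv' t0; apply: le_Rintegral => //; try exact: slope_integrable.
move=> x /(subset_pos t0); rewrite /= in_itv/= andbT => x0.
by rewrite ler_pM2l ?g_gt0//; exact: flux_mono.
Qed.

Lemma admissibleL : admissible L.
Proof.
split=> [b|b t t0]; last exact: L_ge0.
apply: open_continuous_measurable_fun => //.
by move=> x; rewrite inE/= in_itv/= andbT => /(dL b)/is_derive_continuous.
Qed.

Lemma fluxL b (t : R) : 0 < t -> - PL b t <= flux L b t.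
Proof.
move=> t0; have cN : continuous (fun x => - dPL b x).
  by move=> x; apply: continuousN; exact: contdPL.
have <- : (\int[mu]_(x in `]0%R, t]) (- dPL b x))%R = - PL b t.
  rewrite (@Rintegral_FTC _ _ (fun x => - PL b x) 0 t) ?PL_0 ?oppr0 ?addr0//.
apply: le_Rintegral => //.
- by apply: integrable_continuous_oc; exact: continuous_subspaceT.
- exact: source_integrable admissibleL.
- by move=> x; rewrite /= in_itv/= => /andP[x0 _]; exact: geL.
Qed.

(** The sign of [PL] is unknown, so [- L' = - g PL] is compared with the slope on bounded intervals
    [[t, s]] first; then [s] tends to infinity, where [L] vanishes. *)
Lemma greenL b (t : R) : 0 < t -> L b t <= green L b t.
Proof.
move=> t0; pose f := fun x => - (g x * PL b x).
have gt0 (x : R) : t <= x -> 0 < x by exact: lt_le_trans.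
have cf (x : R) : 0 < x -> {for x, continuous f}.
  move=> x0; apply: continuousN; apply: continuousM; first exact: contg.
  exact: is_derive_continuous (derPL b x).
have dNL (x : R) : 0 < x -> is_derive x 1 (- L b) (f x).
  by move=> /(dL b); exact: is_deriveN.
have le_s (s : R) : t < s -> L b t - L b s <= green L b t.
  move=> ts; have s0 := lt_trans t0 ts.
  have wf : {within `[t, s], continuous f}.
    apply: continuous_in_subspaceT => x; rewrite inE/= in_itv/= => /andP[tx _].
    exact/cf/gt0.
  have If : (\int[mu]_(x in `[t, s]) f x)%R = L b t - L b s.
    rewrite /Rintegral (@continuous_FTC2 _ f (- L b) t s) //.
    - by rewrite /= opprK addrC.
    - split=> [x||]; first by rewrite in_itv/= => /andP[/ltW/gt0/dNL[]].
        by apply: cvg_at_right_filter; exact: is_derive_continuous (dNL t t0).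
      by apply: cvg_at_left_filter; exact: is_derive_continuous (dNL s s0).
    - move=> x; rewrite in_itv/= => /andP[/ltW/gt0/dNL dx _].
      exact: is_derive1E dx.
  have gs : 0 <= green L b s by case/andP: (green_bounds b admissibleL s0).
  rewrite -If -[leRHS](subrK (green L b s)) green_sub ?(ltW ts)//; last exact: admissibleL.
  rewrite -[leLHS]addr0 lerD// le_Rintegral//.
  - by apply: continuous_compact_integrable => //; exact: segment_compact.
  - apply: (@integrableS _ _ _ mu `[t, +oo[) (slope_integrable b admissibleL t0) => //.
    by move=> y /=; rewrite !in_itv/= andbT => /andP[].
  - move=> x; rewrite /= in_itv/= => /andP[/gt0 x0 _].
    by rewrite /f -mulrN ler_pM2l ?g_gt0//; exact: fluxL.
have cvL : L b t - L b s @[s --> +oo] --> L b t.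
  by rewrite -[X in _ --> X]subr0; apply: cvgB; [exact: cvg_cst|exact: L_y].
apply: (cvgr_to_le cvL); near=> s; apply: le_s.
by near: s; apply: nbhs_pinfty_gt; rewrite num_real.
Unshelve. all: by end_near. Qed.

(** Monotonicity is included because the supremum is taken over an arbitrary family: unlike
    measurability it survives pointwise suprema, and it implies measurability. *)
Definition subfixed v := [/\ admissible v,
  forall b, {in `]0, +oo[ &, {homo v b : x y /~ x <= y}} &
  forall b (t : R), 0 < t -> v b t <= green v b t].

Lemma subfixed_green v : admissible v ->
  (forall b (t : R), 0 < t -> v b t <= green v b t) -> subfixed (green v).
Proof.
move=> av le; split; [exact: green_admissible|by move=> b; exact: green_ni|].
by move=> b t t0; apply: green_mono => //; exact: green_admissible.
Qed.

(** The Knaster-Tarski supremum. It yields a fixed point by order alone, without compactness or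
    limits under the integrals. *)
Definition top_subfixed b (t : R) := sup [set v b t | v in subfixed].

Lemma subfixed_le v b (t : R) : subfixed v -> 0 < t -> v b t <= top_subfixed b t.
Proof.
move=> sv t0; apply: ub_le_sup; last by exists v.
by exists (U b t) => _ [w [[_ aw] _ _] <-]; case/andP: (aw b t t0).
Qed.

Lemma top_subfixed_le b (t z : R) : (forall v, subfixed v -> v b t <= z) ->
  top_subfixed b t <= z.
Proof.
move=> H; apply: ge_sup => [|_ [v sv <-]]; last exact: H.
(* The family is nonempty through [green L]; [L] itself need not be nonincreasing. *)
exists (green L b t), (green L); last by [].
by apply: subfixed_green; [exact: admissibleL|exact: greenL].
Qed.

Lemma top_subfixedP : subfixed top_subfixed.
Proof.
have ni b : {in `]0, +oo[ &, {homo top_subfixed b : x y /~ x <= y}}.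
  move=> x y x0 y0 xy; apply: top_subfixed_le => v sv.
  have [_ nv _] := sv; apply: le_trans (nv b _ _ x0 y0 xy) _.
  by apply: subfixed_le; [exact: sv|move: y0; rewrite in_itv/= andbT].
have at_ : admissible top_subfixed.
  split=> [b|b t t0]; first exact: nonincreasing_itv_measurable.
  have sL : subfixed (green L).
    by apply: subfixed_green; [exact: admissibleL|exact: greenL].
  apply/andP; split.
    apply: le_trans (subfixed_le b sL t0).
    by case/andP: (green_bounds b admissibleL t0).
  by apply: top_subfixed_le => v [[_ av] _ _]; case/andP: (av b t t0).
split=> // b t t0; apply: top_subfixed_le => v sv; have [av _ lev] := sv.
apply: le_trans (lev b t t0) _; apply: green_mono => // c s s0.
exact: subfixed_le.
Qed.

Lemma green_top b (t : R) : 0 < t -> green top_subfixed b t = top_subfixed b t.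
Proof.
move=> t0; have [a_ _ le] := top_subfixedP; apply/eqP; rewrite eq_le le// andbT.
by apply: subfixed_le; [exact: subfixed_green a_ le|].
Qed.

Lemma top_geL b (t : R) : 0 < t -> L b t <= top_subfixed b t.
Proof.
move=> t0; apply: le_trans (greenL b t0) _; apply: subfixed_le; last exact: t0.
by apply: subfixed_green; [exact: admissibleL|exact: greenL].
Qed.

Let v0 := top_subfixed.
Let av0 : admissible v0. Proof. by case: top_subfixedP. Qed.

Lemma flux_continuous v b (t : R) : admissible v -> 0 < t ->
  {for t, continuous (flux v b)}.
Proof.
move=> av t0; apply: (@integral_oc_continuous _ _ 0 t (t + 1)) => //.
  by rewrite ltrDl.
exact: source_integrable.
Qed.

Lemma slope_continuous v b (t : R) : admissible v -> 0 < t ->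
  {for t, continuous (slope v b)}.
Proof.
by move=> av t0; apply: continuousM; [exact: contg|exact: flux_continuous].
Qed.

Lemma green_derive v b (t : R) : admissible v -> 0 < t ->
  is_derive t 1 (green v b) (- slope v b t).
Proof.
(* The slope is known to be integrable only away from the origin, whence a base point between 0 and
   [t]. *)
move=> av t0; pose c := t / 2.
have c0 : 0 < c by rewrite /c; lra.
have ct : c < t by rewrite /c; lra.
have int_co (u : R) : mu.-integrable `]c, u] (EFin \o slope v b).
  apply: (@integrableS _ _ _ mu `[c, +oo[) (slope_integrable b av c0) => //.
  by move=> y /=; rewrite !in_itv/= andbT => /andP[/ltW].

have H : is_derive t 1 (fun x : R => green v b c -
    \int[mu]_(s in `]c, x]) slope v b s)%R (0 - slope v b t).
  apply: is_deriveB.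
  apply: (@is_derive_integral_oc _ _ c t (t + 1)) => //; first by rewrite ltrDl.
  exact: slope_continuous.
rewrite sub0r in H; apply: near_eq_is_derive H; near=> x.
have cx : c <= x by near: x; apply: filterS (lt_nbhsr ct) => y /ltW.
rewrite Rintegral_itv_obnd_cbnd// -green_sub//.
by rewrite opprB addrC subrK.
Unshelve. all: by end_near. Qed.

Lemma flux_derive v b (t : R) : admissible v ->
  (forall c, {for t, continuous (v c)}) -> 0 < t ->
  is_derive t 1 (flux v b) (source v b t).
Proof.
move=> av cv t0; apply: (@is_derive_integral_oc _ _ 0 t (t + 1)) => //.
- by rewrite ltrDl.
- exact: source_integrable.
- exact: contN.
Qed.

Theorem fixed_point_system : exists v I : bool -> R -> R,
  forall b (t : R), 0 < t ->
  [/\ L b t <= v b t <= U b t, 0 <= I b t <= - PU b t,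
      is_derive t 1 (v b) (- (g t * I b t)) &
      is_derive t 1 (I b) (N b t (v true t) (v false t))].
Proof.
have av1 := green_admissible av0.
have E b (t : R) : 0 < t -> green v0 b t = v0 b t by exact: green_top.
have Es b (t : R) : 0 < t -> source (green v0) b t = source v0 b t.
  by move=> t0; rewrite /source !E.
have Ef b (t : R) : flux (green v0) b t = flux v0 b t.
  apply: eq_Rintegral => x; rewrite inE/= in_itv/= => /andP[x0 _].
  exact: Es.
(* For [t > 0] this equals [v0], but written as an integral it is visibly differentiable. *)
exists (green v0), (flux (green v0)) => b t t0; split.
- by rewrite E// top_geL//; case/andP: (av0.2 b t t0).
- exact: flux_bounds.
- by rewrite Ef; exact: green_derive.
- apply: flux_derive => // c; exact: is_derive_continuous (green_derive c av0 t0).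
Qed.

End FixedPoint.

(** * The radial system and its barriers *)

Section RadialSystem.
Variable R : realType.
Variable lambda : R.
Hypothesis lambdrate_gt0 : 0 < lambda.
Implicit Types (t x y k h : R).

(** Large enough for [damping] to dominate both 1 and [lambda], the two decreasing slopes that it
    compensates in [force_mono]. *)
Definition rate : R := 1 + lambda.
(** In [lower_sub], [B >= 16] serves the inequality for [K] and [lambda B >= 12] the one for [h]. *)
Definition core : R := 16 + 12 / lambda.
Local Notation a := rate.
Local Notation B := core.

Lemma rate_gt0 : 0 < a.
Proof. by have := lambdrate_gt0; rewrite /a; lra. Qed.

Lemma core_ge16 : 16 <= B.
Proof. by rewrite /B lerDl divr_ge0 ?ltW. Qed.

Lemma lambda_core : 12 <= lambda * B.
Proof.
by rewrite /B mulrDr mulrCA divff ?gt_eqF// mulr1 lerDr mulr_ge0// ltW.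
Qed.

Definition gauss t := expR (a * t ^+ 2).
Local Notation psi := gauss.

Lemma gauss_gt0 t : 0 < psi t. Proof. exact: expR_gt0. Qed.
Lemma gauss_neq0 t : psi t != 0. Proof. by rewrite gt_eqF// gauss_gt0. Qed.

Lemma gauss_ge1 t : 1 <= psi t.
Proof.
apply: le_trans (expR_ge1Dx _).
by rewrite lerDl mulr_ge0 ?sqr_ge0// ltW// rate_gt0.
Qed.

Lemma der_gauss t : is_derive t 1 psi (2 * a * t * psi t).
Proof. by rewrite /gauss; derive_tac; rewrite /=; ring. Qed.

(** This is [(psi'' + 4 psi' / t) / psi] for [psi = gauss]: the five-dimensional radial Laplacian of
    the Gaussian, divided by the Gaussian. *)
Definition damping t : R := 10 * a + 4 * a ^+ 2 * t ^+ 2.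
Local Notation Q := damping.

Lemma damping_ge t : 1 <= Q t /\ lambda <= Q t.
Proof.
have H : 0 <= 4 * a ^+ 2 * t ^+ 2 by rewrite mulr_ge0 ?sqr_ge0// mulr_ge0// sqr_ge0.
by have := lambdrate_gt0; split; rewrite /Q; move: H; rewrite /a; lra.
Qed.

(** With [k = t^2 chi] and [h = t phi] this is [t^4 (Q p - G)], where [p'' + 4 p' / t = G] is the
    equation for [p = chi] or [p = phi]. *)
Definition force (b : bool) t k h : R :=
  if b then t ^+ 2 * (Q t * k) + (3 * k ^+ 2 - k ^+ 3) + t ^+ 2 * ((1 - k) * h ^+ 2)
  else t * (t ^+ 2 * (Q t * h) + (4 * k - 2 * k ^+ 2) * h
            + lambda / 2 * t ^+ 2 * (h * (1 - h ^+ 2))).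

Lemma force0 b t : force b t 0 0 = 0.
Proof. by case: b; rewrite /force; ring. Qed.

(** The differences split into products of nonnegative factors. In the own variable, [Q >= 1 >= h^2]
    handles [k], and [Q >= lambda] with [h'^2 + h' h + h^2 <= 3] handles [h]. The cross terms
    [(1 - k') (h'^2 - h^2)] and [(k' - k) (4 - 2 (k' + k)) h'] express cooperativity; their sign
    comes from [k' <= 1]. *)
Lemma force_mono b t k k' h h' : 0 <= t -> 0 <= k -> k <= k' -> k' <= 1 ->
  0 <= h -> h <= h' -> h' <= 1 -> force b t k h <= force b t k' h'.
Proof.
move=> t0 k0 kk' k1 h0 hh' h1; have [Q1 Ql] := damping_ge t.
have h2 : 0 <= h ^+ 2 by rewrite sqr_ge0.
have t2 : 0 <= t ^+ 2 by rewrite sqr_ge0.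
have sqh : h ^+ 2 <= h' ^+ 2 by rewrite lerXn2r ?nnegrE// (le_trans h0).
have h21 : h ^+ 2 <= 1 by rewrite expr_le1// (le_trans hh').
have k'0 := le_trans k0 kk'; have h'0 := le_trans h0 hh'.
case: b; rewrite /force.
- have E1 : 0 <= (k' - k) * (Q t - h ^+ 2) by rewrite mulr_ge0; lra.
  have E2 : 0 <= (1 - k') * (h' ^+ 2 - h ^+ 2) by rewrite mulr_ge0; lra.
  have E3 : 0 <= t ^+ 2 * ((k' - k) * (Q t - h ^+ 2) + (1 - k') * (h' ^+ 2 - h ^+ 2)).
    by rewrite mulr_ge0// addr_ge0.
  have E4 : 0 <= (k' - k) * (3 * (k' + k) - (k' ^+ 2 + k' * k + k ^+ 2)).
    by rewrite mulr_ge0; nra.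
  by nra.
- rewrite ler_wpM2l//.
  have E1 : 0 <= (h' - h) * (Q t + lambda / 2 * (1 - (h' ^+ 2 + h' * h + h ^+ 2))).
    rewrite mulr_ge0 ?subr_ge0//.
    have : h' ^+ 2 + h' * h + h ^+ 2 <= 3 by nra.
    by have := lambdrate_gt0; nra.
  have E2 : 0 <= t ^+ 2 * ((h' - h) * (Q t + lambda / 2 * (1 - (h' ^+ 2 + h' * h + h ^+ 2)))).
    by rewrite mulr_ge0.
  have E3 : 0 <= (4 * k - 2 * k ^+ 2) * (h' - h) by rewrite mulr_ge0; nra.
  have E4 : 0 <= (k' - k) * (4 - 2 * (k' + k)) * h' by rewrite !mulr_ge0; lra.
  by nra.
Qed.

(* The unknowns are [v true = chi / gauss] and [v false = phi / gauss], so that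
   [k = 1 - K = t^2 chi] and [h = t phi]. *)
Definition system_force (b : bool) t x y : R :=
  psi t * force b t (t ^+ 2 * psi t * x) (t * psi t * y).
Definition system_weight t : R := (t ^+ 4 * psi t ^+ 2)^-1.

(* The supersolution [K = exp (- t), h = 1]. *)
Definition upper (b : bool) t : R :=
  if b then (1 - expR (- t)) / (t ^+ 2 * psi t) else (t * psi t)^-1.
Definition upper_flux (b : bool) t : R :=
  if b then psi t * (t ^+ 2 * expR (- t) - 2 * t * (1 - expR (- t))
                     - 2 * a * t ^+ 3 * (1 - expR (- t)))
  else - (psi t * (t ^+ 2 + 2 * a * t ^+ 4)).
Definition upper_flux' (b : bool) t : R :=
  if b then - (psi t * (Q t * t ^+ 2 * (1 - expR (- t)) + t ^+ 2 * expR (- t)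
                        + 2 * (1 - expR (- t))))
  else - (psi t * (2 * t + t ^+ 3 * Q t)).

(* The subsolution [K = 1 - h^2, h = t^2 / (B + t^2)]. *)
Definition lower (b : bool) t : R :=
  if b then t ^+ 2 / ((B + t ^+ 2) ^+ 2 * psi t) else t / ((B + t ^+ 2) * psi t).
Definition lower_flux (b : bool) t : R :=
  psi t * if b
  then 4 * B * t ^+ 5 / (B + t ^+ 2) ^+ 3
       - (2 * t ^+ 5 + 2 * a * t ^+ 7) / (B + t ^+ 2) ^+ 2
  else 2 * B * t ^+ 4 / (B + t ^+ 2) ^+ 2
       - (t ^+ 4 + 2 * a * t ^+ 6) / (B + t ^+ 2).
Definition lower_flux' (b : bool) t : R :=
  psi t * if b
  then 12 * B * t ^+ 4 * (B - t ^+ 2) / (B + t ^+ 2) ^+ 4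
       - (2 + Q t * t ^+ 2) * t ^+ 4 / (B + t ^+ 2) ^+ 2
  else t * (2 * B * t ^+ 2 * (B - 3 * t ^+ 2) / (B + t ^+ 2) ^+ 3
            + 4 * B * t ^+ 2 / (B + t ^+ 2) ^+ 2
            - (2 + Q t * t ^+ 2) * t ^+ 2 / (B + t ^+ 2)).

Lemma core_sqr_gt0 t : 0 < B + t ^+ 2.
Proof. by have := sqr_ge0 t; have := core_ge16; lra. Qed.

Lemma core_sqr_neq0 t : B + t ^+ 2 != 0.
Proof. by rewrite gt_eqF// core_sqr_gt0. Qed.

Lemma system_force_meas b (x y : R -> R) :
  measurable_fun (`]0%R, +oo[%classic : set R) x ->
  measurable_fun (`]0%R, +oo[%classic : set R) y ->
  measurable_fun (`]0%R, +oo[%classic : set R) (fun t => system_force b t (x t) (y t)).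
Proof.
move=> mx my.
have mid : measurable_fun (`]0%R, +oo[%classic : set R) (fun t : R => t) by exact: measurable_id.
have mpsi : measurable_fun (`]0%R, +oo[%classic : set R) psi.
  apply: measurable_funTS; apply: continuous_measurable_fun => t.
  exact: is_derive_continuous (der_gauss t).
have mX n (f : R -> R) : measurable_fun (`]0%R, +oo[%classic : set R) f ->
    measurable_fun (`]0%R, +oo[%classic : set R) (fun t => f t ^+ n).
  by move=> mf; exact: measurable_funX.
case: b; rewrite /system_force /force /Q;
  repeat first [assumption | apply: measurable_cst | apply: measurable_funM
    | apply: measurable_funB | apply: measurable_funD | apply: mX].
Qed.

Lemma system_force_cont b (x y : R -> R) (t : R) : {for t, continuous x} ->
  {for t, continuous y} -> {for t, continuous (fun s => system_force b s (x s) (y s))}.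
Proof.
move=> cx cy.
have cid : {for t, continuous (fun t : R => t)} by exact: cvg_id.
have cpsi : {for t, continuous psi} by exact: is_derive_continuous (der_gauss t).
by case: b; rewrite /system_force /force /Q; repeat cont_step.
Qed.

Lemma mul_gauss_gt0 t : 0 < t -> 0 < t * psi t.
Proof. by move=> t0; rewrite mulr_gt0// gauss_gt0. Qed.
Lemma sqr_gauss_gt0 t : 0 < t -> 0 < t ^+ 2 * psi t.
Proof. by move=> t0; rewrite mulr_gt0 ?exprn_gt0// gauss_gt0. Qed.

Lemma expRN_itv t : 0 < t -> 0 < expR (- t) < 1.
Proof. by move=> t0; rewrite expR_gt0/= expR_lt1 oppr_lt0. Qed.

Lemma system_upper_k t : 0 < t -> t ^+ 2 * psi t * upper true t = 1 - expR (- t).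
Proof. by move=> t0; rewrite /upper mulrC mulfVK// gt_eqF// sqr_gauss_gt0. Qed.

Lemma system_upper_h t : 0 < t -> t * psi t * upper false t = 1.
Proof. by move=> t0; rewrite /upper divff// gt_eqF// mul_gauss_gt0. Qed.

Lemma system_force_mono b (t x x' y y' : R) : 0 < t -> 0 <= x -> x <= x' ->
  x' <= upper true t -> 0 <= y -> y <= y' -> y' <= upper false t ->
  system_force b t x y <= system_force b t x' y'.
Proof.
move=> t0 x0 xx' x1 y0 yy' y1; rewrite ler_pM2l ?gauss_gt0//.
apply: force_mono; first exact: ltW.
- by rewrite mulr_ge0// ltW// sqr_gauss_gt0.
- by rewrite ler_pM2l// sqr_gauss_gt0.
- apply: (@le_trans _ _ (t ^+ 2 * psi t * upper true t)).
    by rewrite ler_pM2l// sqr_gauss_gt0.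
  by rewrite system_upper_k// gerBl expR_ge0.
- by rewrite mulr_ge0// ltW// mul_gauss_gt0.
- by rewrite ler_pM2l// mul_gauss_gt0.
- by rewrite -(system_upper_h t0) ler_pM2l// mul_gauss_gt0.
Qed.

Lemma der_upper b t : 0 < t -> is_derive t 1 (upper b) (system_weight t * upper_flux b t).
Proof.
move=> t0; have dg := der_gauss t; have g0 := gauss_neq0 t.
have tn0 : t != 0 by rewrite gt_eqF.
case: b; rewrite /upper /system_weight /upper_flux; derive_tac;
  rewrite ?mulf_neq0 ?expf_neq0//=; by field; rewrite g0 tn0.
Qed.

Lemma der_upper_flux b t : is_derive t 1 (upper_flux b) (upper_flux' b t).
Proof.
have dg := der_gauss t.
by case: b; rewrite /upper_flux /upper_flux' /Q; derive_tac; rewrite /=; ring.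
Qed.

Lemma upper_flux'_cont b : continuous (upper_flux' b).
Proof.
move=> t; have dg := der_gauss t.
case: b; rewrite /upper_flux' /Q; eapply is_derive_continuous; repeat derive_step.
Qed.

(** Up to the factor [gauss t], the defect is exactly [(1 - E) E (1 + E)] for [K] and [2 t E^2] for
    [h], where [E = exp (- t)]. *)
Lemma upper_super b t : 0 < t ->
  system_force b t (upper true t) (upper false t) <= - upper_flux' b t.
Proof.
move=> t0; rewrite /system_force system_upper_k// system_upper_h//.
have /andP[] := expRN_itv t0; rewrite /upper_flux'; set E := expR (- t) => E0 E1.
case: b; rewrite opprK ler_pM2l ?gauss_gt0// /force.
  rewrite -subr_ge0 [leRHS](_ : _ = (1 - E) * E * (1 + E)); last by ring.
  by rewrite !mulr_ge0// ?subr_ge0 ?addr_ge0// ltW.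
rewrite -subr_ge0 [leRHS](_ : _ = t * (2 * E ^+ 2)); last by ring.
by rewrite mulr_ge0 ?ltW// mulr_gt0// exprn_gt0.
Qed.

Lemma upper_le b t : 1 <= t -> 0 <= upper b t <= t^-1.
Proof.
move=> t1; have t0 : 0 < t by lra.
have /andP[E0 E1] := expRN_itv t0.
have g1 := gauss_ge1 t; have g0 := gauss_gt0 t.
have tg : t <= t * psi t by rewrite ler_peMr// ltW.
case: b; rewrite /upper.
  rewrite divr_ge0 ?subr_ge0 ?(ltW E1) ?(ltW (sqr_gauss_gt0 t0))//=.
  rewrite ler_pdivrMr ?sqr_gauss_gt0//.
  have -> : t^-1 * (t ^+ 2 * psi t) = t * psi t by field; rewrite gt_eqF.
  by lra.
by rewrite invr_ge0 ltW ?mul_gauss_gt0//= lef_pV2 ?posrE// ?mul_gauss_gt0.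
Qed.

Lemma cvg_upper b : upper b t @[t --> +oo] --> 0.
Proof.
have : (fun t : R => t^-1) t @[t --> +oo] --> (0 : R).
  apply/gtr0_cvgV0; last exact: cvg_id.
  by apply: nbhs_pinfty_gt; rewrite num_real.
apply: squeeze_cvgr; last exact: cvg_cst.
near=> t; apply: upper_le.
by near: t; apply: nbhs_pinfty_ge; rewrite num_real.
Unshelve. all: by end_near. Qed.

Lemma lower_bounds b t : 0 < t -> 0 <= lower b t <= upper b t.
Proof.
move=> t0; have /andP[E0 E1] := expRN_itv t0.
have g0 := gauss_gt0 t; have D0 := core_sqr_gt0 t; have t20 : 0 < t ^+ 2 by rewrite exprn_gt0.
case: b; rewrite /lower /upper.
  rewrite divr_ge0 ?mulr_ge0 ?exprn_ge0 ?(ltW D0) ?(ltW g0) ?(ltW t0)//=.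
  rewrite ler_pdivlMr ?sqr_gauss_gt0//.
  have -> : t ^+ 2 / ((B + t ^+ 2) ^+ 2 * psi t) * (t ^+ 2 * psi t)
      = t ^+ 4 / (B + t ^+ 2) ^+ 2 by field; rewrite gauss_neq0 core_sqr_neq0.
  rewrite lerBrDl -lerBrDr.
  (* The square of [1 + t / 2 <= expR (t / 2)]. A quadratic bound is needed: the barrier for [K]
     decays only like [2 B / t^2], so [1 + t <= expR t] fails to compare it with [exp (- t)] for
     large [t]. *)
  have e1 : 1 + t + t ^+ 2 / 4 <= expR t.
    have -> : t = t / 2 + t / 2 by lra.
    rewrite expRD; have := expR_ge1Dx (t / 2); set e := expR _ => H.
    by nra.
  have ee : expR t * expR (- t) = 1 by rewrite -expRD subrr expR0.
  have e2 : expR (- t) * (1 + t ^+ 2 / 4) <= 1 by nra.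
  have -> : 1 - t ^+ 4 / (B + t ^+ 2) ^+ 2 = B * (B + 2 * t ^+ 2) / (B + t ^+ 2) ^+ 2.
    by field; rewrite core_sqr_neq0.
  rewrite ler_pdivlMr ?exprn_gt0//.
  apply: (@le_trans _ _ (expR (- t) * ((1 + t ^+ 2 / 4) * (B * (B + 2 * t ^+ 2))))).
    rewrite ler_pM2l//; have := core_ge16; set x := t ^+ 2 in t20 *; nra.
  by rewrite mulrA ger_pMl//; have := core_ge16; nra.
rewrite divr_ge0 ?mulr_ge0 ?(ltW D0) ?(ltW g0) ?(ltW t0)//=.
rewrite ler_pdivrMr ?mulr_gt0// mulrC ler_pdivlMr ?mul_gauss_gt0//.
by rewrite mulrA -expr2 ler_pM2r//; have := core_ge16; lra.
Qed.

Lemma cvg_lower b : lower b t @[t --> +oo] --> 0.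
Proof.
apply: squeeze_cvgr (cvg_upper b); last exact: cvg_cst.
near=> t; apply: lower_bounds.
by near: t; apply: nbhs_pinfty_gt; rewrite num_real.
Unshelve. all: by end_near. Qed.

Lemma der_lower b t : 0 < t -> is_derive t 1 (lower b) (system_weight t * lower_flux b t).
Proof.
move=> t0; have dg := der_gauss t; have g0 := gauss_neq0 t.
have tn0 : t != 0 by rewrite gt_eqF.
have D0 := core_sqr_neq0 t.
case: b; rewrite /lower /system_weight /lower_flux; derive_tac;
  rewrite ?mulf_neq0 ?expf_neq0//=; by field; rewrite g0 tn0 D0.
Qed.

Lemma der_lower_flux b t : is_derive t 1 (lower_flux b) (lower_flux' b t).
Proof.
have dg := der_gauss t; have D0 := core_sqr_neq0 t.
by case: b; rewrite /lower_flux /lower_flux' /Q; derive_tac;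
  rewrite ?expf_neq0//=; field.
Qed.

Lemma lower_flux'_cont b : continuous (lower_flux' b).
Proof.
move=> t; have dg := der_gauss t; have D0 := core_sqr_neq0 t.
by case: b; rewrite /lower_flux' /Q; eapply is_derive_continuous;
  repeat derive_step; rewrite ?expf_neq0.
Qed.

Lemma lower_sub b t : 0 < t ->
  - lower_flux' b t <= system_force b t (lower true t) (lower false t).
Proof.
move=> t0; have g0 := gauss_neq0 t; have D0 := core_sqr_neq0 t.
have Dp := core_sqr_gt0 t; have t20 : 0 < t ^+ 2 by rewrite exprn_gt0.
have B16 := core_ge16; have lB := lambda_core.
have Ek : t ^+ 2 * psi t * lower true t = t ^+ 4 / (B + t ^+ 2) ^+ 2.
  by rewrite /lower; field; rewrite g0 D0.
have Eh : t * psi t * lower false t = t ^+ 2 / (B + t ^+ 2).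
  by rewrite /lower; field; rewrite g0 D0.
rewrite /system_force Ek Eh.
case: b; rewrite /lower_flux' -mulrN ler_pM2l ?gauss_gt0// /force -subr_ge0.
  (* The first two terms of the last factor add up to [10 B + (B - 16) t^2 + 2 t^4]. *)
  rewrite [leRHS](_ : _ = B * t ^+ 4 / (B + t ^+ 2) ^+ 4 *
    (12 * (B - t ^+ 2) - (B + 2 * t ^+ 2) * (2 - t ^+ 2)
     + (B + 2 * t ^+ 2) * (t ^+ 4 / (B + t ^+ 2) ^+ 2))); last first.
    by field.
  rewrite !mulr_ge0 ?invr_ge0 ?exprn_ge0 ?(ltW t0) ?(ltW Dp)//; first by lra.
  rewrite addr_ge0//; first by nra.
  by rewrite mulr_ge0 ?divr_ge0 ?exprn_ge0 ?(ltW t0) ?(ltW Dp)//; lra.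
rewrite [leRHS](_ : _ = t * (t ^+ 2 / (B + t ^+ 2) ^+ 3) *
   (4 * B ^+ 2 - 6 * B * t ^+ 2 - 2 * t ^+ 4 + lambda * B / 2 * t ^+ 2 * (B + 2 * t ^+ 2)
    + 2 * t ^+ 4 * (1 + B * (B + 2 * t ^+ 2) / (B + t ^+ 2) ^+ 2))); last first.
  by field.
(* Since [lambda B / 2 >= 6], the potential term absorbs [- 6 B t^2 - 2 t^4]. *)
have H : 0 <= (lambda * B / 2 - 6) * (t ^+ 2 * (B + 2 * t ^+ 2)).
  by rewrite mulr_ge0; nra.
have H1 : 0 <= 1 + B * (B + 2 * t ^+ 2) / (B + t ^+ 2) ^+ 2.
  by rewrite addr_ge0// divr_ge0 ?exprn_ge0 ?(ltW Dp)//; nra.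
apply: mulr_ge0; first by rewrite mulr_ge0 ?divr_ge0 ?exprn_ge0 ?(ltW t0) ?(ltW Dp).
apply: addr_ge0; last by rewrite mulr_ge0// mulr_ge0// exprn_ge0 ?ltW.
by nra.
Qed.

Lemma system_weight_gt0 t : 0 < t -> 0 < system_weight t.
Proof. by move=> t0; rewrite invr_gt0 mulr_gt0 ?exprn_gt0// gauss_gt0. Qed.

Lemma system_weight_cont t : 0 < t -> {for t, continuous system_weight}.
Proof.
move=> t0; have dg := der_gauss t; have g0 := gauss_neq0 t.
have tn0 : t != 0 by rewrite gt_eqF.
rewrite /system_weight; eapply is_derive_continuous; repeat derive_step.
by rewrite mulf_neq0 ?expf_neq0.
Qed.

Lemma radial_solution : exists v I : bool -> R -> R, forall b t, 0 < t ->
  [/\ lower b t <= v b t <= upper b t, 0 <= I b t <= - upper_flux b t,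
      is_derive t 1 (v b) (- (system_weight t * I b t)) &
      is_derive t 1 (I b) (system_force b t (v true t) (v false t))].
Proof.
apply: (@fixed_point_system _ system_force system_weight upper upper_flux upper_flux'
  lower lower_flux lower_flux').
- exact: system_force_meas.
- exact: system_force_cont.
- exact: system_force_mono.
- by move=> b t t0; rewrite /system_force !mulr0 force0 mulr0.
- exact: system_weight_gt0.
- exact: system_weight_cont.
- exact: der_upper.
- exact: cvg_upper.
- by case; rewrite /upper_flux; ring.
- exact: der_upper_flux.
- exact: upper_flux'_cont.
- exact: upper_super.
- exact: lower_bounds.
- exact: der_lower.
- exact: cvg_lower.
- by case; rewrite /lower_flux !expr0n/= !mulr0 !mul0r ?addr0 ?mul0r ?subrr ?mulr0.
- exact: der_lower_flux.
- exact: lower_flux'_cont.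
- exact: lower_sub.
Qed.

End RadialSystem.

(** * Smooth functions of the squared radius *)

Section SmoothRadial.
Variable R : realType.
Notation mu := (@lebesgue_measure R).
Implicit Types (f g p q : R -> R) (t s : R).

(** Continuity on [[0, +oo[], encoded through the even extension so that no one-sided topology is
    needed at 0. *)
Definition cont_abs f := continuous (fun t : R => f `|t|).

Lemma at_right0 (P : R -> Prop) : (\forall t \near 0^'+, P t) ->
  exists2 d : R, 0 < d & forall t, 0 < t -> t < d -> P t.
Proof.
move=> [d /= d0 H]; exists d => // t t0 td; apply: H => //=.
by rewrite sub0r normrN gtr0_norm.
Qed.

Lemma cont_abs_right f : cont_abs f -> f t @[t --> 0^'+] --> f 0.
Proof.
move=> cf; have : (fun t : R => f `|t|) t @[t --> 0^'+] --> f 0.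
  by have := cvg_at_right_filter (cf 0); rewrite normr0.
apply: cvg_trans; apply: near_eq_cvg; near=> t.
by rewrite gtr0_norm//; near: t; exact: nbhs_right_gt.
Unshelve. all: by end_near. Qed.

Lemma cont_absP f : (forall t, 0 < t -> {for t, continuous f}) ->
  f t @[t --> 0^'+] --> f 0 -> cont_abs f.
Proof.
move=> cf f0 t; have [->|tn0] := eqVneq t 0.
  apply/cvgrPdist_lt => /= e e0; rewrite normr0.
  have /cvgrPdist_lt/(_ _ e0)/at_right0[d d0 H] := f0.
  exists d => //= s; rewrite /= sub0r normrN => sd.
  have [->|sn0] := eqVneq s 0; first by rewrite normr0 subrr normr0.
  by apply: H => //; rewrite normr_gt0.
apply: (@continuous_comp _ _ _ (fun s : R => `|s|) f).
  exact: norm_continuous.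
by apply: cf; rewrite normr_gt0.
Qed.

Lemma cont_abs_pos f t : cont_abs f -> 0 < t -> {for t, continuous f}.
Proof.
move=> cf t0; have := cf t; rewrite /prop_for/continuous_at gtr0_norm//.
apply: cvg_trans; apply: near_eq_cvg; near=> s.
rewrite gtr0_norm//; near: s; exact: lt_nbhsr.
Unshelve. all: by end_near. Qed.

Lemma cont_abs_eq f g : cont_abs f -> cont_abs g ->
  (forall t, 0 < t -> f t = g t) -> forall t, 0 <= t -> f t = g t.
Proof.
move=> cf cg fg t; rewrite le_eqVlt => /predU1P[<-|]; last exact: fg.
have f0 := cont_abs_right cf; have g0 := cont_abs_right cg.
apply: (cvg_unique _ f0) => //; apply: cvg_trans g0; apply: near_eq_cvg.
by near=> s; apply/esym/fg; near: s; exact: nbhs_right_gt.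
Unshelve. all: by end_near. Qed.

Lemma cont_abs_ext f g : (forall t, 0 <= t -> f t = g t) -> cont_abs f -> cont_abs g.
Proof.
move=> fg; rewrite /cont_abs (_ : (fun t => f _) = (fun t => g `|t|))//.
by apply/funext => t; apply: fg.
Qed.

Lemma derive_ge0_nd f (df : R -> R) (s t : R) : 0 < s -> s <= t ->
  (forall x, 0 < x -> x <= t -> is_derive x 1 f (df x)) ->
  (forall x, 0 < x -> x <= t -> 0 <= df x) -> f s <= f t.
Proof.
move=> s0; rewrite le_eqVlt => /predU1P[->//|st] dF df0.
have [||c] := @MVT R f df s t st.
- move=> x; rewrite in_itv/= => /andP[sx xt].
  by apply: dF; [exact: lt_trans sx|exact: ltW].
- apply: continuous_in_subspaceT => x; rewrite inE/= in_itv/= => /andP[sx xt].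
  by apply: is_derive_continuous (dF x _ _) => //; exact: lt_le_trans sx.
rewrite in_itv/= => /andP[sc ct] E.
rewrite -subr_ge0 E mulr_ge0// ?subr_ge0 ?(ltW st)// df0//.
  exact: lt_trans sc.
exact: ltW.
Qed.

(** Takes the place of integration from 0 in the comparisons below, where functions have only a
    limit at 0 from the right. *)
Lemma derive_ge0_right f (df : R -> R) (T : R) : 0 < T ->
  (forall t, 0 < t -> t <= T -> is_derive t 1 f (df t)) ->
  (forall t, 0 < t -> t <= T -> 0 <= df t) -> f t @[t --> 0^'+] --> 0 -> 0 <= f T.
Proof.
move=> T0 dF df0 f0; apply: (cvgr_to_le f0); near=> t.
have t0 : 0 < t by near: t; exact: nbhs_right_gt.
have tT : t < T by near: t; exact: nbhs_right_lt.
by apply: derive_ge0_nd (ltW tT) dF df0.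
Unshelve. all: by end_near. Qed.

Lemma derive_eq_right f g (df : R -> R) (l : R) :
  (forall t, 0 < t -> is_derive t 1 f (df t)) ->
  (forall t, 0 < t -> is_derive t 1 g (df t)) ->
  f t @[t --> 0^'+] --> l -> g t @[t --> 0^'+] --> l ->
  forall t, 0 < t -> f t = g t.
Proof.
move=> dF dG f0 g0 T T0; apply/eqP; rewrite eq_le -subr_ge0 -[X in _ && X]subr_ge0.
apply/andP; split.
- apply: (@derive_ge0_right (fun t => g t - f t) (fun t => df t - df t)) => //.
  + by move=> t t0 _; exact: (der_add (dG t t0) (der_opp (dF t t0))).
  + by move=> t _ _; rewrite subrr.
  + by rewrite -[X in _ --> X](subrr l); exact: (cvgB g0 f0).
- apply: (@derive_ge0_right (fun t => f t - g t) (fun t => df t - df t)) => //.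
  + by move=> t t0 _; exact: (der_add (dF t t0) (der_opp (dG t t0))).
  + by move=> t _ _; rewrite subrr.
  + by rewrite -[X in _ --> X](subrr l); exact: (cvgB f0 g0).
Qed.

Lemma primitive_right f : continuous f -> exists F : R -> R,
  F t @[t --> 0^'+] --> 0 /\ forall t, 0 < t -> is_derive t 1 F (f t).
Proof.
(* Integrating from -1 makes 0 an interior point, so that [M] is continuous there. *)
move=> cf; pose M t := (\int[mu]_(s in `](-1)%R, t]) f s)%R.
have dM t : 0 <= t -> is_derive t 1 M (f t).
  move=> t0; apply: (@is_derive_integral_oc _ f (-1) t (t + 1)).
  - by lra.
  - by rewrite ltrDl.
  - by apply: integrable_continuous_oc; exact: continuous_subspaceT.
  - exact: cf.
exists (fun t => M t - M 0); split.
  rewrite -[X in _ --> X](subrr (M 0)); apply: cvgB; last exact: cvg_cst.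
  by apply: cvg_at_right_filter; exact: is_derive_continuous (dM 0 _).
by move=> t t0; have := dM t (ltW t0) => dMt; derive_tac; rewrite subr0.
Qed.

(** [q] is the weighted mean [t^-(n+1)] times the integral of [s^n g(s)] over [[0, t]], completed at
    0 by its limit [g 0 / (n + 1)]. For [n = 4] it recovers [p' / t] from the five-dimensional
    radial Laplacian of [p]. *)
Lemma average_exists n g : cont_abs g -> exists2 q, cont_abs q &
  forall t, 0 < t -> is_derive t 1 (fun s => s ^+ n.+1 * q s) (t ^+ n * g t).
Proof.
move=> cg; have cg' : continuous (fun t : R => t ^+ n * g `|t|).
  move=> t; apply: (@cont_mul _ _ t (fun t => t ^+ n) (fun t => g `|t|)); last exact: cg.
  exact: exprn_continuous.
have [F [F0 dF]] := primitive_right cg'.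
have {}dF t : 0 < t -> is_derive t 1 F (t ^+ n * g t).
  by move=> t0; have := dF t t0; rewrite gtr0_norm.
have n0 : (n.+1%:R : R) != 0 by rewrite pnatr_eq0.
have n1 : 0 < (n.+1%:R : R) by rewrite ltr0n.
pose q t := if t == 0 then g 0 / n.+1%:R else F t / t ^+ n.+1.
have qE t : 0 < t -> q t = F t / t ^+ n.+1 by move=> t0; rewrite /q gt_eqF.
exists q; last first.
  move=> t t0; apply: near_eq_is_derive (dF t t0); near=> s.
  have s0 : 0 < s by near: s; exact: lt_nbhsr.
  by rewrite qE// mulrCA divff ?mulr1// expf_neq0// gt_eqF.
apply: cont_absP => [t t0|].
  have dFt := dF t t0.
  have : {for t, continuous (fun s => F s / s ^+ n.+1)}.
    by eapply is_derive_continuous; repeat derive_step; rewrite expf_neq0// gt_eqF.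
  rewrite /prop_for/continuous_at -qE//.
  apply: cvg_trans; apply: near_eq_cvg; near=> s.
  by rewrite qE//; near: s; exact: lt_nbhsr.
rewrite {2}/q eqxx.
apply/cvgrPdist_le => /= e e0.
have /cvgrPdist_le/(_ _ e0)/at_right0[d d0 H] := cont_abs_right cg.
near=> t; have t0 : 0 < t by near: t; exact: nbhs_right_gt.
have td : t < d by near: t; exact: nbhs_right_lt.
have dpow (c s : R) : is_derive s 1 (fun s : R => c * s ^+ n.+1 / n.+1%:R) (c * s ^+ n).
  by derive_tac => //=; field.
have cvgc (c : R) : c * s ^+ n.+1 / n.+1%:R @[s --> 0^'+] --> 0.
  rewrite [X in _ --> X](_ : _ = c * 0 ^+ n.+1 / n.+1%:R); last first.
    by rewrite expr0n/= mulr0 mul0r.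
  apply: (@cvg_at_right_filter _ _ (fun s : R => c * s ^+ n.+1 / n.+1%:R) 0).
  exact: is_derive_continuous (dpow c 0).
have Hle s : 0 < s -> s <= t -> g 0 - e <= g s <= g 0 + e.
  move=> s0 st; have := H s s0 (le_lt_trans st td).
  by rewrite distrC ler_distl.
have up : F t <= (g 0 + e) * t ^+ n.+1 / n.+1%:R.
  rewrite -subr_ge0.
  apply: (@derive_ge0_right (fun s => (g 0 + e) * s ^+ n.+1 / n.+1%:R - F s)
    (fun s => (g 0 + e) * s ^+ n - s ^+ n * g s)) => //.
  - by move=> s s0 _; exact: (der_add (dpow _ s) (der_opp (dF s s0))).
  - move=> s s0 st; rewrite mulrC -mulrBr mulr_ge0 ?exprn_ge0 ?(ltW s0)//.
    by rewrite subr_ge0; case/andP: (Hle s s0 st).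
  - rewrite -[X in _ --> X](subrr (0 : R)); apply: cvgB; [exact: cvgc|exact: F0].
have lo : (g 0 - e) * t ^+ n.+1 / n.+1%:R <= F t.
  rewrite -subr_ge0.
  apply: (@derive_ge0_right (fun s => F s - (g 0 - e) * s ^+ n.+1 / n.+1%:R)
    (fun s => s ^+ n * g s - (g 0 - e) * s ^+ n)) => //.
  - by move=> s s0 _; exact: (der_add (dF s s0) (der_opp (dpow _ s))).
  - move=> s s0 st; rewrite [X in _ - X]mulrC -mulrBr mulr_ge0 ?exprn_ge0 ?(ltW s0)//.
    by rewrite subr_ge0; case/andP: (Hle s s0 st).
  - rewrite -[X in _ --> X](subrr (0 : R)); apply: cvgB; [exact: F0|exact: cvgc].
rewrite qE// distrC ler_distl.
have tn : 0 < t ^+ n.+1 by rewrite exprn_gt0.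
have en : e / n.+1%:R <= e.
  by rewrite ler_pdivrMr// ler_peMr ?ler1n// ltW.
have H1 : 0 <= t ^+ n.+1 * (e - e / n.+1%:R) by rewrite mulr_ge0 ?subr_ge0// ltW.
apply/andP; split.
  rewrite ler_pdivlMr//; apply: le_trans lo; rewrite -subr_ge0.
  by rewrite [leRHS](_ : _ = t ^+ n.+1 * (e - e / n.+1%:R))//; field.
rewrite ler_pdivrMr//; apply: le_trans up _; rewrite -subr_ge0.
by rewrite [leRHS](_ : _ = t ^+ n.+1 * (e - e / n.+1%:R))//; field.
Unshelve. all: by end_near. Qed.

(* [f] is of class [C^k] as a function of [t^2], on [t >= 0]. *)
Fixpoint smooth_sqr (k : nat) f : Prop :=
  cont_abs f /\
  if k is m.+1 then exists2 g, smooth_sqr m g &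
    forall t, 0 < t -> is_derive t 1 f (t * g t)
  else True.

Lemma smooth_sqr_cont k f : smooth_sqr k f -> cont_abs f.
Proof. by case: k => [|k] []. Qed.

Lemma smooth_sqr_le k f : smooth_sqr k.+1 f -> smooth_sqr k f.
Proof.
elim: k f => [|k IH] f; first by case.
by case=> cf [g sg dg]; split=> //; exists g => //; exact: IH.
Qed.

Lemma smooth_sqr_cst k (c : R) : smooth_sqr k (fun=> c).
Proof.
elim: k c => [|k IH] c; split=> //; try by move=> t; exact: cvg_cst.
by exists (fun=> 0) => // t t0; rewrite mulr0; exact: der_cst.
Qed.

Lemma smooth_sqr_add k f g : smooth_sqr k f -> smooth_sqr k g ->
  smooth_sqr k (fun t => f t + g t).
Proof.
have cD (u v : R -> R) : cont_abs u -> cont_abs v -> cont_abs (fun t => u t + v t).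
  move=> cu cv t; have cut := cu t; have cvt := cv t.
  exact: (@cont_add _ _ t (fun t => u `|t|) (fun t => v `|t|) cut cvt).
elim: k f g => [|k IH] f g; first by move=> [cf _] [cg _]; split=> //; exact: cD.
move=> [cf [f' sf df]] [cg [g' sg dg]]; split; first exact: cD.
exists (fun t => f' t + g' t); first exact: IH.
by move=> t t0; rewrite mulrDr; apply: der_add; [exact: df|exact: dg].
Qed.

Lemma smooth_sqr_mul k f g : smooth_sqr k f -> smooth_sqr k g ->
  smooth_sqr k (fun t => f t * g t).
Proof.
have cM (u v : R -> R) : cont_abs u -> cont_abs v -> cont_abs (fun t => u t * v t).
  move=> cu cv t; have cut := cu t; have cvt := cv t.
  exact: (@cont_mul _ _ t (fun t => u `|t|) (fun t => v `|t|) cut cvt).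
elim: k f g => [|k IH] f g; first by move=> [cf _] [cg _]; split=> //; exact: cM.
move=> sf0 sg0; have [cf [f' sf df]] := sf0; have [cg [g' sg dg]] := sg0.
split; first exact: cM.
exists (fun t => f' t * g t + f t * g' t).
  by apply: smooth_sqr_add; apply: IH => //; exact: smooth_sqr_le.
move=> t t0; have dft := df t t0; have dgt := dg t t0.
by derive_tac; rewrite /=; ring.
Qed.

Lemma smooth_sqr_sqr k : smooth_sqr k (fun t => t ^+ 2).
Proof.
have c2 : cont_abs (fun t : R => t ^+ 2).
  move=> t; exact: (@cont_exp _ _ t (fun t => `|t|) 2 (@norm_continuous _ _ t)).
case: k => [|k]; split=> //.
exists (fun=> 2); first exact: smooth_sqr_cst.
by move=> t t0; derive_tac; rewrite /=; ring.
Qed.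

Lemma smooth_sqr_ext k f g : (forall t, 0 <= t -> f t = g t) ->
  smooth_sqr k f -> smooth_sqr k g.
Proof.
move=> fg; have cfg := cont_abs_ext fg.
case: k => [|k] [/cfg cg]; first by [].
move=> [h sh dh]; split=> //; exists h => // t t0.
apply: near_eq_is_derive (dh t t0); near=> s.
by apply/fg/ltW; near: s; exact: lt_nbhsr.
Unshelve. all: by end_near. Qed.

Lemma cvg_pow_right n q : cont_abs q -> (fun s => s ^+ n.+1 * q s) t @[t --> 0^'+] --> (0 : R).
Proof.
move=> cq.
rewrite [X in _ --> X](_ : _ = 0 ^+ n.+1 * q 0); last by rewrite expr0n mul0r.
apply: cvgM; last exact: cont_abs_right.
apply: (@cvg_at_right_filter _ _ (fun s : R => s ^+ n.+1) 0).
exact: exprn_continuous.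
Qed.

(** Averaging loses no regularity: if [g' = t g1], then [q' = t q1] with [q1] the mean of [g1] for
    the exponent [n + 2]. Indeed [t^(n+3) q1] and [t^(n+1) (g - (n+1) q)] have the same derivative
    and both tend to 0 at the origin. *)
Lemma smooth_sqr_average k n g q : smooth_sqr k g -> cont_abs q ->
  (forall t, 0 < t -> is_derive t 1 (fun s => s ^+ n.+1 * q s) (t ^+ n * g t)) ->
  smooth_sqr k q.
Proof.
elim: k n g q => [|k IH] n g q; first by [].
move=> [cg [g1 sg1 dg]] cq dq; split=> //.
have [q1 cq1 dq1] := @average_exists n.+2 g1 (smooth_sqr_cont sg1).
exists q1; first exact: IH sg1 cq1 dq1.
pose z s := s ^+ n.+1 * g s - n.+1%:R * (s ^+ n.+1 * q s).
have dz t : 0 < t -> is_derive t 1 z (t ^+ n.+2 * g1 t).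
  move=> t0; have dgt := dg t t0; have dqt := dq t t0.
  have dqt' := @der_mul _ (fun=> n.+1%:R) _ t _ _ (der_cst t n.+1%:R) dqt.
  have := der_opp dqt'; move: dqt' => _ dqt'.
  rewrite /z; notypeclasses refine (der_eq _ _).
    notypeclasses refine (@der_add _ _ _ _ _ _ _ dqt').
    by repeat derive_step.
  by rewrite /= !exprS; set T := t ^+ n; set N := n.+1%:R; ring.
have zE t : 0 < t -> t ^+ n.+3 * q1 t = z t.
  apply: (@derive_eq_right _ _ _ 0 dq1 dz); first exact: cvg_pow_right.
  rewrite [X in _ --> X](_ : _ = 0 - n.+1%:R * 0); last by rewrite mulr0 subrr.
  apply: cvgB; first exact: cvg_pow_right.
  by apply: cvgM; [exact: cvg_cst|exact: cvg_pow_right].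
move=> t t0; have tn0 : t != 0 by rewrite gt_eqF.
have dqt := dq t t0.
have dF : is_derive t 1 (fun s => (s ^+ n.+1 * q s) * (s ^+ n.+1)^-1) (t * q1 t).
  notypeclasses refine (der_eq _ _).
    notypeclasses refine (@der_mul _ _ _ _ _ _ dqt _); repeat derive_step.
    by rewrite expf_neq0.
  have := zE t t0; rewrite /z /= => E.
  have tn : t ^+ n != 0 by rewrite expf_neq0.
  have -> : q1 t = (t ^+ n.+1 * g t - n.+1%:R * (t ^+ n.+1 * q t)) / t ^+ n.+3.
    by rewrite -E mulrAC divff ?mul1r// expf_neq0.
  by rewrite !exprS; field; rewrite tn0 tn.
apply: near_eq_is_derive dF; near=> s.
have s0 : 0 < s by near: s; exact: lt_nbhsr.
by rewrite mulrAC divff ?mul1r// expf_neq0// gt_eqF.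
Unshelve. all: by end_near. Qed.

Lemma derive_uniq f t (x y : R) : is_derive t 1 f x -> is_derive t 1 f y -> x = y.
Proof. by move=> [_ <-] [_ <-]. Qed.

(** The derivatives supplied at the various orders [k] agree for [t > 0], hence by continuity for
    [t >= 0], so one [g] serves all of them. *)
Lemma smooth_sqr_derivative f : (forall k, smooth_sqr k f) ->
  exists2 g, (forall k, smooth_sqr k g) & forall t, 0 < t -> is_derive t 1 f (t * g t).
Proof.
move=> sf; have [_ [g cg dg]] := sf 1%N; exists g => // k.
have [_ [h sh dh]] := sf k.+1; apply: (smooth_sqr_ext _ sh).
apply: cont_abs_eq; [exact: smooth_sqr_cont sh|exact: (@smooth_sqr_cont 0 g cg)|].
move=> t t0; have := derive_uniq (dh t t0) (dg t t0).
by apply: mulfI; rewrite gt_eqF.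
Qed.

(** [F n] is [2^n] times the [n]-th derivative of [f] in the variable [t^2]. *)
Lemma smooth_sqr_tower f : (forall k, smooth_sqr k f) -> exists F : nat -> R -> R,
  [/\ F 0%N = f, forall n, cont_abs (F n) &
   forall n t, 0 < t -> is_derive t 1 (F n) (t * F n.+1 t)].
Proof.
move=> sf; pose T := {g : R -> R | forall k, smooth_sqr k g}.
have next (g : T) : {h : T | forall t, 0 < t -> is_derive t 1 (sval g) (t * sval h t)}.
  case: g => g sg; apply: cid; have [h sh dh] := smooth_sqr_derivative sg.
  by exists (exist _ h sh).
pose F := fix F n : T := if n is m.+1 then sval (next (F m)) else exist _ f sf.
exists (fun n => sval (F n)); split=> // n; last exact: (svalP (next (F n))).
exact: smooth_sqr_cont (svalP (F n) 0%N).
Qed.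

End SmoothRadial.

(** * Regularity at the origin *)

Section Profiles.
Variables (R : realType) (lambda : R).
Hypothesis lambda_gt0 : 0 < lambda.
Implicit Types (t s : R) (b : bool).
Local Notation psi := (gauss lambda).
Local Notation Q := (damping lambda).
Local Notation a := (rate lambda).

Variables v I : bool -> R -> R.
Hypothesis radial : forall b t, 0 < t ->
  [/\ lower lambda b t <= v b t <= upper lambda b t,
      0 <= I b t <= - upper_flux lambda b t,
      is_derive t 1 (v b) (- (system_weight lambda t * I b t)) &
      is_derive t 1 (I b) (system_force lambda b t (v true t) (v false t))].

Definition profile b t : R := psi t * v b t.
Local Notation pr := profile.
Definition total t : R := pr true t + pr false t.

Lemma v_ge0 b t : 0 < t -> 0 <= v b t.
Proof.
move=> t0; have [/andP[lv _] _ _ _] := radial b t0.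
by apply: le_trans lv; case/andP: (lower_bounds lambda_gt0 b t0).
Qed.

Lemma profile_ge0 b t : 0 < t -> 0 <= pr b t.
Proof. by move=> t0; rewrite mulr_ge0 ?v_ge0// ltW// gauss_gt0. Qed.

Lemma v_le_profile b t : 0 < t -> v b t <= pr b t.
Proof. by move=> t0; rewrite ler_peMl ?v_ge0// gauss_ge1. Qed.

Lemma profile_k_le t : 0 < t -> t ^+ 2 * pr true t <= 1 - expR (- t).
Proof.
move=> t0; have [/andP[_ vu] _ _ _] := radial true t0.
rewrite -(system_upper_k lambda t0) /profile mulrA ler_pM2l//.
exact: sqr_gauss_gt0.
Qed.

Lemma profile_h_le t : 0 < t -> t * pr false t <= 1.
Proof.
move=> t0; have [/andP[_ vu] _ _ _] := radial false t0.
rewrite -(system_upper_h lambda t0) /profile mulrA ler_pM2l//.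
exact: mul_gauss_gt0.
Qed.

Lemma profile_k_le1 t : 0 < t -> t ^+ 2 * pr true t <= 1.
Proof.
by move=> t0; apply: le_trans (profile_k_le t0) _; rewrite gerBl expR_ge0.
Qed.

(** For [b = true] this is [1 - exp (- t) <= t], the gain of the supersolution over [K = 0], which
    would give only [1 / t^2]. *)
Lemma profile_le b t : 0 < t -> t * pr b t <= 1.
Proof.
move=> t0; case: b; last exact: profile_h_le.
rewrite -(ler_pM2l t0) mulrA -expr2 mulr1.
apply: le_trans (profile_k_le t0) _; rewrite lerBlDr -lerBlDl.
exact: expR_ge1Dx.
Qed.

Lemma profile_lower b t : 0 < t -> psi t * lower lambda b t <= pr b t.
Proof.
move=> t0; have [/andP[lv _] _ _ _] := radial b t0.
by rewrite ler_pM2l// gauss_gt0.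
Qed.

Lemma total_ge0 t : 0 < t -> 0 <= total t.
Proof. by move=> t0; rewrite addr_ge0// profile_ge0. Qed.

Lemma gauss_le1 t : 0 < t -> t <= 1 -> psi t <= psi 1.
Proof.
move=> t0 t1; rewrite ler_expR ler_pM2l ?rate_gt0//.
by rewrite lerXn2r ?nnegrE// ltW.
Qed.

Let c0 : R := Q 1 + lambda.

Let Q1_ge1 : 1 <= Q 1.
Proof. by case: (damping_ge lambda_gt0 1). Qed.

Let c0_ge0 : 0 <= c0.
Proof. by have := Q1_ge1; have := lambda_gt0; rewrite /c0; lra. Qed.

Lemma damping_le1 t : 0 < t -> t <= 1 -> Q t <= Q 1.
Proof.
move=> t0 t1; rewrite lerD2l ler_wpM2l//.
  by rewrite mulr_ge0// sqr_ge0.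
by rewrite lerXn2r ?nnegrE// ltW.
Qed.

Lemma source_le b t : 0 < t -> t <= 1 ->
  system_force lambda b t (v true t) (v false t)
  <= psi 1 * (t ^+ 4 * (c0 * total t + 3 * total t ^+ 2)).
Proof.
move=> t0 t1; rewrite /system_force.
apply: (@le_trans _ _ (psi t * (t ^+ 4 * (c0 * total t + 3 * total t ^+ 2)))); last first.
  rewrite ler_wpM2r ?gauss_le1// mulr_ge0 ?exprn_ge0 ?(ltW t0)//.
  by rewrite addr_ge0// mulr_ge0 ?sqr_ge0 ?total_ge0.
rewrite ler_pM2l ?gauss_gt0//.
rewrite -(mulrA (t ^+ 2)) -(mulrA t) -/(pr true t) -/(pr false t).
have x0 := profile_ge0 true t0; have y0 := profile_ge0 false t0.
have kx := profile_k_le1 t0.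
have Qt := damping_le1 t0 t1; have [Qt1 _] := damping_ge lambda_gt0 t.
have l0 := lambda_gt0.
rewrite /total; set x := pr true t in x0 kx *; set y := pr false t in y0 *.
have t2 : 0 <= t ^+ 2 by rewrite sqr_ge0.
have t4 : 0 <= t ^+ 4 by rewrite exprn_ge0// ltW.
have t6 : 0 <= t ^+ 6 by rewrite exprn_ge0// ltW.
have hQ z : 0 <= z -> z <= x + y -> Q t * z + lambda * z <= c0 * (x + y).
  move=> z0 zle; rewrite /c0 -mulrDl ler_pM//; lra.
rewrite /force; case: b.
  have E1 : 0 <= t ^+ 6 * x ^+ 3 + t ^+ 6 * x * y ^+ 2.
    by apply: addr_ge0 (mulr_ge0 t6 (exprn_ge0 3 x0)) (mulr_ge0 (mulr_ge0 t6 x0) (sqr_ge0 y)).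
  have E2 : 0 <= t ^+ 4 * (c0 * (x + y) + 3 * (x + y) ^+ 2 - (Q t * x + 3 * x ^+ 2 + y ^+ 2)).
    rewrite mulr_ge0//; have lx : 0 <= lambda * x by rewrite mulr_ge0// ltW.
    by have := hQ x x0; nra.
  by nra.
have E1 : 0 <= t ^+ 6 * x ^+ 2 * y * 2 + lambda / 2 * (t ^+ 6 * y ^+ 3).
  apply: addr_ge0; first by rewrite mulr_ge0// mulr_ge0// mulr_ge0// sqr_ge0.
  by rewrite mulr_ge0 ?divr_ge0 ?(ltW l0)// mulr_ge0// exprn_ge0.
have E2 : 0 <= t ^+ 4 * (c0 * (x + y) + 3 * (x + y) ^+ 2 - (Q t * y + 4 * x * y + lambda / 2 * y)).
  rewrite mulr_ge0//; have ly : 0 <= lambda * y by rewrite mulr_ge0// ltW.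
  by have := hQ y y0; nra.
by nra.
Qed.

Lemma flux_right b : I b t @[t --> 0^'+] --> 0.
Proof.
have fl : upper_flux lambda b t @[t --> 0^'+] --> 0.
  rewrite [X in _ --> X](_ : _ = upper_flux lambda b 0); last first.
    by case: b; rewrite /upper_flux; ring.
  by apply: cvg_at_right_filter; exact: is_derive_continuous (der_upper_flux lambda b 0).
have nfl : - upper_flux lambda b t @[t --> 0^'+] --> 0.
  by rewrite -[X in _ --> X]oppr0; apply: cvgN.
apply: squeeze_cvgr nfl; last exact: cvg_cst.
near=> t; have t0 : 0 < t by near: t; exact: nbhs_right_gt.
by have [] := radial b t0.
Unshelve. all: by end_near. Qed.

(** One round of the bootstrap: integrating the source from the origin, where the flux vanishes,
    gains a power of [t]; [system_weight] then costs four in [slope_le]. *)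
Lemma flux_le (C : R) n : 0 <= C ->
  (forall t, 0 < t -> t <= 1 -> t ^+ 4 * (c0 * total t + 3 * total t ^+ 2) <= C * t ^+ n) ->
  forall b t, 0 < t -> t <= 1 -> I b t <= psi 1 * C * t ^+ n.+1.
Proof.
move=> C0 le b T T0 T1; rewrite -subr_ge0; set D := psi 1 * C.
have D0 : 0 <= D by rewrite mulr_ge0// ltW// gauss_gt0.
apply: (@derive_ge0_right _ (fun s => D * s ^+ n.+1 - I b s)
  (fun s => D * (n.+1%:R * s ^+ n) - system_force lambda b s (v true s) (v false s)) T T0).
- move=> t t0 _; have [_ _ _ dI] := radial b t0.
  notypeclasses refine (@der_add _ (fun s => D * s ^+ n.+1) (fun s => - I b s) _ _ _ _ (der_opp dI)).
  by derive_tac; rewrite /=; ring.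
- move=> t t0 tT; have t1 := le_trans tT T1.
  rewrite subr_ge0; apply: le_trans (source_le b t0 t1) _.
  apply: (@le_trans _ _ (psi 1 * (C * t ^+ n))).
    by rewrite ler_pM2l ?gauss_gt0// le.
  rewrite mulrA ler_wpM2l// ler_peMl ?exprn_ge0 ?(ltW t0)//.
  by rewrite ler1n.
- rewrite [X in _ --> X](_ : _ = D * 0 ^+ n.+1 - 0); last first.
    by rewrite expr0n/= mulr0 subrr.
  apply: cvgB; last exact: flux_right.
  apply: cvgM; first exact: cvg_cst.
  apply: (@cvg_at_right_filter _ _ (fun s : R => s ^+ n.+1) 0).
  exact: exprn_continuous.
Qed.

Lemma slope_le (C : R) n b t : 0 < t -> I b t <= C * t ^+ n.+4 ->
  system_weight lambda t * I b t <= C * t ^+ n.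
Proof.
move=> t0 le; have [_ /andP[I0 _] _ _] := radial b t0.
have t4 : 0 < t ^+ 4 by rewrite exprn_gt0.
apply: (@le_trans _ _ ((t ^+ 4)^-1 * I b t)).
  rewrite ler_wpM2r// lef_pV2 ?posrE ?mulr_gt0 ?exprn_gt0 ?gauss_gt0//.
  by rewrite ler_peMr ?(ltW t4)// exprn_ege1// gauss_ge1.
rewrite ler_pdivrMl//; apply: le_trans le _.
by rewrite [leRHS]mulrCA -exprD.
Qed.

Lemma slope_ge0 b t : 0 < t -> 0 <= system_weight lambda t * I b t.
Proof.
move=> t0; have [_ /andP[I0 _] _ _] := radial b t0.
by rewrite mulr_ge0// ltW// system_weight_gt0.
Qed.

(* First the a priori bound [total t <= 2 / t] gives a slope of order [1 / t],
   hence [total t ^+ 2 = O(1 / t)]; the next round gives a bounded slope. *)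
Lemma total_sqr_le : exists2 C : R, 0 <= C &
  forall t, 0 < t -> t <= 1 -> t * total t ^+ 2 <= C.
Proof.
pose C1 := 2 * c0 + 12; have C1_ge0 : 0 <= C1 by rewrite addr_ge0// mulr_ge0.
have tot t : 0 < t -> t * total t <= 2.
  move=> t0; have := profile_le true t0; have := profile_le false t0.
  by rewrite /total mulrDr; lra.
have IC := @flux_le C1 2 C1_ge0 _.
have {}IC b t : 0 < t -> t <= 1 -> I b t <= psi 1 * C1 * t ^+ 3.
  apply: IC => {}t t0 t1; have T0 := total_ge0 t0; have T2 := tot t t0.
  have -> : t ^+ 4 * (c0 * total t + 3 * total t ^+ 2)
      = t ^+ 2 * (c0 * (t * (t * total t)) + 3 * (t * total t) ^+ 2) by ring.
  rewrite mulrC ler_wpM2r ?sqr_ge0//.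
  have tt0 : 0 <= t * total t by rewrite mulr_ge0// ltW.
  have a1 : t * (t * total t) <= 2 by nra.
  have a2 : (t * total t) ^+ 2 <= 4 by nra.
  rewrite /C1 lerD//; last by lra.
  by rewrite mulrC ler_wpM2r.
pose D := psi 1 * C1; have D0 : 0 <= D by rewrite mulr_ge0// ltW// gauss_gt0.
(* Working with [v^2] avoids the logarithm that integrating the slope bound [D / t] would produce.
   As [v <= 1 / t], the derivative of [v^2] is at least [- 2 D / t^2], so [v^2 - C2 / t] is
   nondecreasing, and it is [- 2 D] at 1. *)
pose C2 b := v b 1 ^+ 2 + 2 * D.
have vC b t : 0 < t -> t <= 1 -> v b t ^+ 2 <= C2 b / t.
  move=> t0 t1.
  have H : v b t ^+ 2 - C2 b / t <= v b 1 ^+ 2 - C2 b / 1.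
    apply: (@derive_ge0_nd _ (fun s => v b s ^+ 2 - C2 b / s)
     (fun s => - (2 * v b s * (system_weight lambda s * I b s)) + C2 b / s ^+ 2) t 1 t0 t1).
    - move=> x x0 _; have [_ _ dv _] := radial b x0.
      derive_tac; first by rewrite gt_eqF.
      by rewrite /=; field; rewrite gt_eqF.
    - move=> x x0 x1.
      have wx : system_weight lambda x * I b x <= D / x.
        apply: (@le_trans _ _ ((x ^+ 4)^-1 * I b x)).
          have [_ /andP[I0 _] _ _] := radial b x0.
          rewrite ler_wpM2r// lef_pV2 ?posrE ?mulr_gt0 ?exprn_gt0 ?gauss_gt0//.
          by rewrite ler_peMr ?exprn_ge0 ?(ltW x0)// exprn_ege1// gauss_ge1.
        rewrite ler_pdivrMl ?exprn_gt0//; apply: le_trans (IC b x x0 x1) _.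
        by rewrite le_eqVlt; apply/orP; left; apply/eqP; rewrite /D; field; rewrite gt_eqF.
      have vx : v b x <= x^-1.
        apply: le_trans (v_le_profile b x0) _.
        by rewrite -[leRHS]mulr1 ler_pdivlMl// profile_le.
      have H1 : v b x * (system_weight lambda x * I b x) <= x^-1 * (D / x).
        by rewrite ler_pM// ?v_ge0// slope_ge0.
      have H2 : x^-1 * (D / x) = D / x ^+ 2 by field; rewrite gt_eqF.
      have H3 : 2 * (D / x ^+ 2) <= C2 b / x ^+ 2.
        by rewrite mulrA ler_wpM2r ?invr_ge0 ?sqr_ge0// /C2 lerDr sqr_ge0.
      rewrite addrC subr_ge0; apply: le_trans H3.
      by rewrite -H2 -mulrA ler_wpM2l.
  by move: H; rewrite divr1 /C2; lra.
pose M := C2 true + C2 false.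
have C20 b : 0 <= C2 b by rewrite addr_ge0 ?sqr_ge0// mulr_ge0.
exists (2 * psi 1 ^+ 2 * M).
  by apply: mulr_ge0; [rewrite mulr_ge0// sqr_ge0|exact: addr_ge0].
move=> t t0 t1.
have tv b : t * v b t ^+ 2 <= C2 b by rewrite mulrC -ler_pdivlMr// vC.
have prv b : t * pr b t ^+ 2 <= psi 1 ^+ 2 * C2 b.
  rewrite /profile exprMn mulrCA; apply: ler_pM; [exact: sqr_ge0| | |exact: tv].
    by rewrite mulr_ge0 ?sqr_ge0 ?(ltW t0).
  by rewrite lerXn2r ?nnegrE ?(ltW (gauss_gt0 _ _))// gauss_le1.
have : total t ^+ 2 <= 2 * (pr true t ^+ 2 + pr false t ^+ 2).
  by rewrite /total; have := sqr_ge0 (pr true t - pr false t); nra.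
move=> /(ler_wpM2l (ltW t0)) /le_trans; apply.
have := prv true; have := prv false; rewrite /M; set P := psi 1 ^+ 2.
by nra.
Qed.

Lemma total_le : exists2 C : R, 0 <= C & forall t, 0 < t -> t <= 1 -> total t <= C.
Proof.
have [C C0 tC] := total_sqr_le.
(* This is [c0 (1 + C) + 3 C], from [t total <= 1 + (t total)^2 <= 1 + C]. *)
pose C1 := c0 + (c0 + 3) * C; have C1_ge0 : 0 <= C1 by rewrite addr_ge0// mulr_ge0// addr_ge0.
have IC b t : 0 < t -> t <= 1 -> I b t <= psi 1 * C1 * t ^+ 4.
  apply: flux_le => // {}t t0 t1; have T0 := total_ge0 t0; have T2 := tC t t0 t1.
  have -> : t ^+ 4 * (c0 * total t + 3 * total t ^+ 2)
      = t ^+ 3 * (c0 * (t * total t) + 3 * (t * total t ^+ 2)) by ring.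
  rewrite mulrC ler_wpM2r ?exprn_ge0 ?(ltW t0)//.
  have a1 : t * total t <= 1 + C by nra.
  have := ler_wpM2l c0_ge0 a1; rewrite /C1; nra.
pose D := psi 1 * C1; have D0 : 0 <= D by rewrite mulr_ge0// ltW// gauss_gt0.
have vC b t : 0 < t -> t <= 1 -> v b t <= v b 1 + D.
  move=> t0 t1.
  have : v b t + D * t <= v b 1 + D * 1.
    apply: (@derive_ge0_nd _ (fun s => v b s + D * s)
      (fun s => - (system_weight lambda s * I b s) + D) t 1 t0 t1).
    - by move=> x x0 _; have [_ _ dv _] := radial b x0; derive_tac; rewrite /=; ring.
    - move=> x x0 x1; rewrite addrC subr_ge0 -[leRHS](mulr1 D) -(expr0 x).
      exact/slope_le/IC.
  have : 0 <= D * t by rewrite mulr_ge0// ltW.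
  by lra.
exists (psi 1 * (v true 1 + D) + psi 1 * (v false 1 + D)).
  by rewrite -mulrDr mulr_ge0 ?addr_ge0 ?v_ge0// ltW// gauss_gt0.
move=> t t0 t1; rewrite /total lerD// /profile ler_pM ?v_ge0 ?vC ?gauss_le1//;
  by rewrite ltW// gauss_gt0.
Qed.

(** [v b] is nonincreasing, so boundedness near 0 already yields a limit. *)
Lemma v_cvg0 b : exists l : R, v b t @[t --> 0^'+] --> l.
Proof.
have [C C0 tC] := total_le.
eexists; apply: (@nonincreasing_at_right_cvgr _ (v b) 0 (BRight 1)).
- by rewrite bnd_simp.
- move=> s t; rewrite !in_itv/= => /andP[s0 _] /andP[t0 _] st.
  rewrite -lerN2.
  apply: (@derive_ge0_nd _ (fun s => - v b s) (fun s => - - (system_weight lambda s * I b s)) s t s0 st).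
    by move=> x x0 _; have [_ _ dv _] := radial b x0; exact: der_opp.
  by move=> x x0 _; rewrite opprK slope_ge0.
- exists C => _ [t /=] + <-; rewrite in_itv/= => /andP[t0 t1].
  apply: le_trans (tC t t0 t1); apply: le_trans (v_le_profile b t0) _.
  by case: b; rewrite /total ?lerDl ?lerDr profile_ge0.
Qed.

Definition profile0 (l : bool -> R) b t : R := if t == 0 then l b else pr b t.

(* [coupling] is the nonlinearity of the five-dimensional radial system
   [p'' + 4 p' / t = coupling]. *)
Definition coupling b t (x y : R) : R :=
  if b then - (3 * x ^+ 2 - t ^+ 2 * x ^+ 3 + (1 - t ^+ 2 * x) * y ^+ 2)
  else - (4 * x * y - 2 * t ^+ 2 * x ^+ 2 * y + lambda / 2 * y * (1 - t ^+ 2 * y ^+ 2)).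

Lemma coupling_smooth k b (x y : R -> R) : smooth_sqr k x -> smooth_sqr k y ->
  smooth_sqr k (fun t => coupling b t (x t) (y t)).
Proof.
move=> sx sy.
have sM (f g : R -> R) := @smooth_sqr_mul R k f g.
have sD (f g : R -> R) := @smooth_sqr_add R k f g.
have sc := @smooth_sqr_cst R k; have s2 := @smooth_sqr_sqr R k.
have sN f : smooth_sqr k f -> smooth_sqr k (fun t => - f t).
  move=> sf; have := sM _ _ (sc (-1)) sf.
  by apply: smooth_sqr_ext => t _; rewrite mulN1r.
have sX n f : smooth_sqr k f -> smooth_sqr k (fun t => f t ^+ n).
  move=> sf; elim: n => [|n IH]; first exact: smooth_sqr_ext (sc 1).
  by have := sM _ _ sf IH; apply: smooth_sqr_ext => t _; rewrite exprS.
have sxn n := sX n _ sx; have syn n := sX n _ sy.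
have sB (f g : R -> R) : smooth_sqr k f -> smooth_sqr k g -> smooth_sqr k (fun t => f t - g t).
  by move=> sf sg; apply: sD => //; exact: sN.
case: b; rewrite /coupling; apply: sN.
- apply: sD.
    by apply: sB; [apply: sM|apply: (sM (fun t => t ^+ 2))].
  apply: (sM (fun t => 1 - t ^+ 2 * x t)) => //.
  by apply: sB => //; apply: (sM (fun t => t ^+ 2)).
- apply: sD.
    apply: sB; first by apply: (sM (fun t => 4 * x t)) => //; apply: sM.
    apply: (sM (fun t => 2 * t ^+ 2 * x t ^+ 2)) => //.
    by apply: (sM (fun t => 2 * t ^+ 2)) => //; apply: sM.
  apply: (sM (fun t => lambda / 2 * y t)); first exact: sM.
  by apply: sB => //; apply: (sM (fun t => t ^+ 2)).
Qed.

Lemma der_profile b t : 0 < t ->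
  is_derive t 1 (pr b) (2 * a * t * pr b t - I b t / (t ^+ 4 * psi t)).
Proof.
move=> t0; have [_ _ dv _] := radial b t0; have dg := der_gauss lambda t.
rewrite /profile; derive_tac; rewrite /system_weight.
have g0 := gauss_neq0 lambda t; have tn0 : t != 0 by rewrite gt_eqF.
by field; rewrite g0 ?tn0.
Qed.

(** The differentiated function is [t^4 p'] by [der_profile], so this is the radial equation
    [(t^4 p')' = t^4 G], from which the Gaussian has disappeared. *)
Lemma der_profile_flux b t : 0 < t ->
  is_derive t 1 (fun s => 2 * a * s ^+ 5 * pr b s - I b s / psi s)
    (t ^+ 4 * coupling b t (pr true t) (pr false t)).
Proof.
move=> t0; have [_ _ _ dI] := radial b t0; have dg := der_gauss lambda t.
have dp := der_profile b t0; have g0 := gauss_neq0 lambda t.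
have tn0 : t != 0 by rewrite gt_eqF.
derive_tac; first exact: g0.
rewrite /system_force -(mulrA (t ^+ 2)) -(mulrA t) -/(pr true t) -/(pr false t).
by case: b {dI dp}; rewrite /force /coupling /damping /=; field; rewrite tn0 g0.
Qed.

(** As [(t^5 (p' / t))' = t^4 G], the quotient [p' / t] is the weighted mean of [G]. If the profiles
    are of class [C^k] in [t^2], so are [G] and its mean, and the profiles are then of class
    [C^(k+1)]. *)
Lemma profile_smooth : exists F : bool -> R -> R,
  [/\ forall b k, smooth_sqr k (F b), forall b t, 0 < t -> F b t = pr b t &
  forall b t, 0 < t -> is_derive t 1 (fun s => 2 * a * s ^+ 5 * pr b s - I b s / psi s)
    (t ^+ 4 * coupling b t (F true t) (F false t))].
Proof.
have [l0 hl0] := v_cvg0 true; have [l1 hl1] := v_cvg0 false.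
pose l b := if b then l0 else l1.
have hl b : v b t @[t --> 0^'+] --> l b by case: b.
pose F := profile0 l.
have FE b t : 0 < t -> F b t = pr b t by move=> t0; rewrite /F /profile0 gt_eqF.
have F0 b : F b 0 = l b by rewrite /F /profile0 eqxx.
move: F FE F0 => F FE F0.
have cF b : cont_abs (F b).
  apply: cont_absP => [t t0|].
    have := is_derive_continuous (der_profile b t0).
    rewrite /prop_for/continuous_at -FE//; apply: cvg_trans; apply: near_eq_cvg.
    by near=> s; rewrite FE//; near: s; exact: lt_nbhsr.
  rewrite F0 -[l b]mul1r.
  have : pr b t @[t --> 0^'+] --> 1 * l b.
    apply: cvgM; last exact: hl.
    rewrite [X in _ --> X](_ : 1 = psi 0); last by rewrite /gauss expr0n mulr0 expR0.
    by apply: cvg_at_right_filter; exact: is_derive_continuous (der_gauss lambda 0).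
  apply: cvg_trans; apply: near_eq_cvg.
  by near=> s; rewrite FE//; near: s; exact: nbhs_right_gt.
have dy b t : 0 < t -> is_derive t 1 (fun s => 2 * a * s ^+ 5 * pr b s - I b s / psi s)
    (t ^+ 4 * coupling b t (F true t) (F false t)).
  by move=> t0; rewrite (FE true t t0) (FE false t t0); exact: der_profile_flux.
have y0 b : (fun s => 2 * a * s ^+ 5 * pr b s - I b s / psi s) t @[t --> 0^'+] --> 0.
  rewrite [X in _ --> X](_ : _ = 2 * a * 0 - 0 / psi 0); last by rewrite mulr0 mul0r subrr.
  apply: cvgB; last first.
    apply: cvgM; first exact: flux_right.
    apply: cvgV; first exact: gauss_neq0.
    by apply: cvg_at_right_filter; exact: is_derive_continuous (der_gauss lambda 0).
  have := cvg_pow_right 4 (cF b).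
  move=> /(cvgM (@cvg_cst _ (2 * a) _ _ _)); apply: cvg_trans; apply: near_eq_cvg.
  by near=> s; rewrite /= FE ?mulrA//; near: s; exact: nbhs_right_gt.
exists F; split=> // b k; elim: k b => [|k IH] b; first by split.
split; first exact: cF.
have sG := coupling_smooth b (IH true) (IH false).
have [q cq dq] := average_exists 4 (smooth_sqr_cont sG).
exists q; first exact: smooth_sqr_average sG cq dq.
move=> t t0.
have E := derive_eq_right (dy b) dq (y0 b) (cvg_pow_right 4 cq) t0.
have tn0 : t != 0 by rewrite gt_eqF.
have g0 := gauss_neq0 lambda t.
have -> : t * q t = 2 * a * t * pr b t - I b t / (t ^+ 4 * psi t).
  apply: (@mulfI _ (t ^+ 4)); first by rewrite expf_neq0.
  by rewrite mulrA -exprSr -E; field; rewrite ?g0 ?tn0.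
apply: near_eq_is_derive (der_profile b t0); near=> s.
by rewrite FE//; near: s; exact: lt_nbhsr.
Unshelve. all: by end_near. Qed.

(** With [p' = t F1] and [F1' = t F2], [p'' + 4 p' / t] becomes [5 F1 + t^2 F2], a form of the
    equation that also holds at 0. *)
Lemma profile_tower : exists F : bool -> nat -> R -> R,
  [/\ forall b n, cont_abs (F b n),
   forall b n t, 0 < t -> is_derive t 1 (F b n) (t * F b n.+1 t),
   forall b t, 0 <= t ->
     5 * F b 1%N t + t ^+ 2 * F b 2%N t = coupling b t (F true 0%N t) (F false 0%N t) &
   forall b t, 0 < t -> F b 0%N t = pr b t].
Proof.
have [f [sf fE df]] := profile_smooth.
have T b := smooth_sqr_tower (sf b).
pose F b := projT1 (cid (T b)).
have FP b : [/\ F b 0%N = f b, forall n, cont_abs (F b n) &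
   forall n t, 0 < t -> is_derive t 1 (F b n) (t * F b n.+1 t)].
  exact: projT2 (cid (T b)).
exists F; split.
- by move=> b n; have [_ + _] := FP b; apply.
- by move=> b n; have [_ _ +] := FP b; apply.
- move=> b; have [F0 cF dF] := FP b; have [F1 _ _] := FP true; have [F2 _ _] := FP false.
  apply: cont_abs_eq.
  + have s5 : cont_abs (fun=> 5 : R) by move=> t; exact: cvg_cst.
    have s2 := @smooth_sqr_cont R 0 _ (@smooth_sqr_sqr R 0).
    have g1 := @smooth_sqr_mul R 0 _ _ (conj s5 Logic.I) (conj (cF 1%N) Logic.I).
    have g2 := @smooth_sqr_mul R 0 _ _ (conj s2 Logic.I) (conj (cF 2%N) Logic.I).
    exact: smooth_sqr_cont (smooth_sqr_add g1 g2).
  + rewrite F1 F2; apply: smooth_sqr_cont (coupling_smooth b (sf true 0%N) (sf false 0%N)).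
  + move=> t t0; rewrite F1 F2.
    have tn0 : t != 0 by rewrite gt_eqF.
    have dF1 := dF 1%N t t0.
    have E1 : is_derive t 1 (fun s => s ^+ 5 * F b 1%N s)
        (t ^+ 4 * (5 * F b 1%N t + t ^+ 2 * F b 2%N t)).
      by derive_tac; rewrite /=; ring.
    have E2 := df b t t0.
    suff E3 : is_derive t 1 (fun s => s ^+ 5 * F b 1%N s)
        (t ^+ 4 * coupling b t (f true t) (f false t)).
      by have := derive_uniq E1 E3; apply: mulfI; rewrite expf_neq0.
    apply: near_eq_is_derive E2; near=> s.
    have s0 : 0 < s by near: s; exact: lt_nbhsr.
    have sn0 : s != 0 by rewrite gt_eqF.
    have d0 : is_derive s 1 (F b 0%N) (2 * a * s * pr b s - I b s / (s ^+ 4 * psi s)).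
      apply: near_eq_is_derive (der_profile b s0); near=> x.
      by rewrite F0 fE//; near: x; exact: lt_nbhsr.
    have E := derive_uniq (dF 0%N s s0) d0.
    have -> : F b 1%N s = (s * F b 1%N s) / s by rewrite mulrAC divff ?mul1r.
    by rewrite E; field; rewrite sn0 gauss_neq0.
- by move=> b t t0; have [-> _ _] := FP b; exact: fE.
Unshelve. all: by end_near. Qed.

End Profiles.

Theorem radial_profiles (R : realType) (lambda : R) : 0 < lambda ->
  exists2 B : R, 0 < B & exists F : bool -> nat -> R -> R,
  [/\ forall b n, cont_abs (F b n),
   forall b n (t : R), 0 < t -> is_derive t 1 (F b n) (t * F b n.+1 t),
   forall b (t : R), 0 <= t -> 5 * F b 1%N t + t ^+ 2 * F b 2%N t
     = coupling lambda b t (F true 0%N t) (F false 0%N t),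
   forall t : R, 0 < t -> t ^+ 4 / (B + t ^+ 2) ^+ 2 <= t ^+ 2 * F true 0%N t <= 1 &
   forall t : R, 0 < t -> t ^+ 2 / (B + t ^+ 2) <= t * F false 0%N t <= 1].
Proof.
move=> l0; have [v [I H]] := radial_solution l0.
exists (core lambda); first exact: lt_le_trans (core_ge16 l0).
have [F [cF dF odeF FE]] := profile_tower l0 H.
exists F; split=> // t t0; rewrite FE//; have g0 := gauss_neq0 lambda t;
  have D0 := core_sqr_neq0 l0 t.
- rewrite (profile_k_le1 H t0) andbT.
  have := profile_lower H true t0; rewrite -(@ler_pM2l _ (t ^+ 2)) ?exprn_gt0//.
  apply: le_trans; rewrite /lower le_eqVlt; apply/orP; left; apply/eqP.
  by field; rewrite D0 g0.
- rewrite (profile_h_le H t0) andbT.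
  have := profile_lower H false t0; rewrite -(@ler_pM2l _ t)//.
  apply: le_trans; rewrite /lower le_eqVlt; apply/orP; left; apply/eqP.
  by field; rewrite D0 g0.
Qed.

(** * Decay of the radial energy density *)

Section Decay.
Variables (R : realType) (lambda B : R) (F : bool -> nat -> R -> R).
Hypothesis lambda_gt0 : 0 < lambda.
Hypothesis B_gt0 : 0 < B.
Implicit Types (t s : R).
Hypothesis cont_F : forall b n, cont_abs (F b n).
Hypothesis der_F : forall b n t, 0 < t -> is_derive t 1 (F b n) (t * F b n.+1 t).
Hypothesis ode_F : forall b t, 0 <= t -> 5 * F b 1%N t + t ^+ 2 * F b 2%N t
     = coupling lambda b t (F true 0%N t) (F false 0%N t).
Hypothesis bound_k : forall t, 0 < t ->
  t ^+ 4 / (B + t ^+ 2) ^+ 2 <= t ^+ 2 * F true 0%N t <= 1.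
Hypothesis bound_h : forall t, 0 < t -> t ^+ 2 / (B + t ^+ 2) <= t * F false 0%N t <= 1.

(** Landau's inequality with step 1: by two mean values, [f1 t = f (t + 1) - f t - f2 y (x - t)]
    with [t < y < x < t + 1]. *)
Lemma landau_bound (f f1 f2 : R -> R) (e e2 t : R) : 0 < t ->
  (forall s, 0 < s -> is_derive s 1 f (f1 s)) ->
  (forall s, 0 < s -> is_derive s 1 f1 (f2 s)) ->
  (forall s, t <= s -> `|f s| <= e) -> (forall s, t <= s -> `|f2 s| <= e2) ->
  `|f1 t| <= 2 * e + e2.
Proof.
move=> t0 df df1 fe f2e; have gt0 s : t <= s -> 0 < s by exact: lt_le_trans.
have tt1 : t < t + 1 by rewrite ltrDl.
have [||x] := @MVT R f f1 t (t + 1) tt1.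
- by move=> s; rewrite in_itv/= => /andP[/ltW/gt0 s0 _]; exact: df.
- apply: continuous_in_subspaceT => s; rewrite inE/= in_itv/= => /andP[/gt0 s0 _].
  exact: is_derive_continuous (df s s0).
rewrite in_itv/= => /andP[tx xt1]; rewrite [t + 1 - t]addrAC subrr add0r mulr1 => E1.
have [||y] := @MVT R f1 f2 t x tx.
- by move=> s; rewrite in_itv/= => /andP[/ltW/gt0 s0 _]; exact: df1.
- apply: continuous_in_subspaceT => s; rewrite inE/= in_itv/= => /andP[/gt0 s0 _].
  exact: is_derive_continuous (df1 s s0).
rewrite in_itv/= => /andP[ty yx] E2.
have -> : f1 t = f (t + 1) - f t - f2 y * (x - t) by rewrite E1 -E2; ring.
apply: le_trans (ler_normB _ _) _; apply: lerD.
  apply: le_trans (ler_normB _ _) _.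
  by have := fe t (lexx t); have := fe (t + 1) (ltW tt1); lra.
rewrite normrM -[leRHS]mulr1 ler_pM ?normr_ge0//; first by apply: f2e; exact: ltW.
by rewrite gtr0_norm ?subr_gt0//; lra.
Qed.

Definition profileK t : R := 1 - t ^+ 2 * F true 0%N t.
Definition profileK' t : R := - (2 * t * F true 0%N t + t ^+ 3 * F true 1%N t).
(** [u = r (h - 1)]. The factor [r] removes the first-order term of the equation for [h], so that
    [u''] has an expression without derivatives, as [landau_bound] requires. *)
Definition profileu t : R := t ^+ 2 * F false 0%N t - t.
Definition profileu' t : R := 2 * t * F false 0%N t + t ^+ 3 * F false 1%N t - 1.
Definition profileK'' t : R :=
  profileK t * ((t * F false 0%N t) ^+ 2 - (1 + profileK t) * F true 0%N t).
Definition profileu'' t : R := 2 * profileK t ^+ 2 * F false 0%N t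
  - lambda / 2 * t * ((t * F false 0%N t) * (1 - (t * F false 0%N t) ^+ 2)).

Lemma der_profileK t : 0 < t -> is_derive t 1 profileK (profileK' t).
Proof.
move=> t0; have d := der_F true 0 t0.
by rewrite /profileK /profileK'; derive_tac; rewrite /=; ring.
Qed.

Lemma der_profileK' t : 0 < t -> is_derive t 1 profileK' (profileK'' t).
Proof.
move=> t0; have d := der_F true 0 t0; have d1 := der_F true 1 t0.
rewrite /profileK'; derive_tac; rewrite /= /profileK'' /profileK.
have := ode_F true (ltW t0); rewrite /coupling => E.
transitivity (- (2 * F true 0%N t + t ^+ 2 * (5 * F true 1%N t + t ^+ 2 * F true 2%N t))).
  by ring.
by rewrite E; ring.
Qed.

Lemma der_profileu t : 0 < t -> is_derive t 1 profileu (profileu' t).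
Proof.
move=> t0; have d := der_F false 0 t0.
by rewrite /profileu /profileu'; derive_tac; rewrite /=; ring.
Qed.

Lemma der_profileu' t : 0 < t -> is_derive t 1 profileu' (profileu'' t).
Proof.
move=> t0; have d := der_F false 0 t0; have d1 := der_F false 1 t0.
rewrite /profileu'; derive_tac; rewrite /= /profileu'' /profileK.
have := ode_F false (ltW t0); rewrite /coupling => E.
transitivity (2 * F false 0%N t + t ^+ 2 * (5 * F false 1%N t + t ^+ 2 * F false 2%N t)).
  by ring.
by rewrite E; field.
Qed.

Lemma profileK_bounds t : 0 < t -> 0 <= profileK t <= 2 * B / t ^+ 2.
Proof.
move=> t0; have /andP[k0 k1] := bound_k t0; rewrite /profileK subr_ge0 k1/=.
have t2 : 0 < t ^+ 2 by rewrite exprn_gt0.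
have D0 : 0 < B + t ^+ 2 by rewrite addr_gt0.
apply: (@le_trans _ _ (1 - t ^+ 4 / (B + t ^+ 2) ^+ 2)); first by rewrite lerB.
rewrite -subr_ge0 [leRHS](_ : _ = B * (2 * B ^+ 2 + 3 * B * t ^+ 2) /
    ((B + t ^+ 2) ^+ 2 * t ^+ 2)); last by field; rewrite !gt_eqF.
have b0 := ltW B_gt0; have t20 := ltW t2.
by nonneg.
Qed.

Lemma profileh_bounds t : 0 < t -> 0 <= 1 - t * F false 0%N t <= B / t ^+ 2.
Proof.
move=> t0; have /andP[k0 k1] := bound_h t0; rewrite subr_ge0 k1/=.
have t2 : 0 < t ^+ 2 by rewrite exprn_gt0.
have D0 : 0 < B + t ^+ 2 by rewrite addr_gt0.
apply: (@le_trans _ _ (1 - t ^+ 2 / (B + t ^+ 2))); first by rewrite lerB.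
rewrite -subr_ge0 [leRHS](_ : _ = B ^+ 2 / ((B + t ^+ 2) * t ^+ 2)); last first.
  by field; rewrite !gt_eqF.
by rewrite divr_ge0 ?sqr_ge0// mulr_ge0 ?(ltW t2)// ltW.
Qed.

Lemma profileh_ge0 t : 0 < t -> 0 <= t * F false 0%N t.
Proof.
move=> t0; have /andP[k0 k1] := bound_h t0; apply: le_trans k0.
by rewrite divr_ge0 ?sqr_ge0// addr_ge0 ?sqr_ge0// ltW.
Qed.

Lemma inv_le (n : nat) s t : 0 < t -> t <= s -> (s ^+ n)^-1 <= (t ^+ n)^-1.
Proof.
move=> t0 ts; have s0 := lt_le_trans t0 ts.
rewrite lef_pV2 ?posrE ?exprn_gt0//.
by rewrite lerXn2r ?nnegrE// ltW.
Qed.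

Lemma profileK'_bound t : 1 <= t -> `|profileK' t| <= 8 * B / t ^+ 2.
Proof.
move=> t1; have t0 : 0 < t by lra.
have b0 := ltW B_gt0.
have KB s : t <= s -> `|profileK s| <= 2 * B / t ^+ 2.
  move=> ts; have s0 := lt_le_trans t0 ts; have /andP[K0 K1] := profileK_bounds s0.
  rewrite ger0_norm//; apply: le_trans K1 _.
  by rewrite ler_wpM2l ?mulr_ge0//; exact: inv_le.
have -> : 8 * B / t ^+ 2 = 2 * (2 * B / t ^+ 2) + 2 * (2 * B / t ^+ 2).
  by field; rewrite gt_eqF.
apply: (landau_bound t0 der_profileK der_profileK' KB).
move=> s ts; have s0 := lt_le_trans t0 ts; have /andP[K0 K1] := profileK_bounds s0.
rewrite /profileK'' normrM mulrC ler_pM ?normr_ge0 ?KB//.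
have /andP[k0 k1] := bound_k s0; have /andP[_ h1] := bound_h s0.
have h0 := profileh_ge0 s0; have s1 := le_trans t1 ts.
have x0 : 0 <= F true 0%N s.
  rewrite -(@pmulr_rge0 _ (s ^+ 2)) ?exprn_gt0//; apply: le_trans k0.
  by rewrite divr_ge0 ?sqr_ge0 ?exprn_ge0// ltW.
have x1 : F true 0%N s <= 1.
  apply: le_trans k1; rewrite ler_peMl// exprn_ege1//.
have hh : 0 <= (s * F false 0%N s) ^+ 2 <= 1.
  by rewrite sqr_ge0 expr_le1.
rewrite ler_norml /profileK; set k := s ^+ 2 * F true 0%N s in k1 *.
have k00 : 0 <= k by rewrite mulr_ge0 ?sqr_ge0.
case/andP: hh => hh0 hh1.
have : 0 <= (1 + (1 - k)) * F true 0%N s <= 2 by apply/andP; split; nra.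
by case/andP => ? ?; apply/andP; split; lra.
Qed.

(** Both [u] and [u''] are [O(1 / t)]: [|u| <= B / t], while the two terms of [u''] contribute
    [4 B / t], by [K^2 <= K <= 2 B], and [lambda B / t], by [1 - h^2 = (1 + h) (1 - h)]. *)
Lemma profileu'_bound t : 1 <= t -> `|profileu' t| <= (6 + lambda) * B / t.
Proof.
move=> t1; have t0 : 0 < t by lra.
have b0 := ltW B_gt0; have l0 := ltW lambda_gt0.
have -> : (6 + lambda) * B / t = 2 * (B / t) + (4 + lambda) * B / t.
  by field; rewrite gt_eqF.
apply: (landau_bound t0 der_profileu der_profileu') => s ts;
  have s0 := lt_le_trans t0 ts; have s1 := le_trans t1 ts;
  have /andP[h0 h1] := profileh_bounds s0; have hp := profileh_ge0 s0;
  have sV : s^-1 <= t^-1 by have := @inv_le 1 s t t0 ts; rewrite !expr1.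
- have -> : profileu s = - (s * (1 - s * F false 0%N s)) by rewrite /profileu; ring.
  rewrite normrN ger0_norm ?mulr_ge0 ?(ltW s0)//.
  apply: (@le_trans _ _ (B / s)); last by rewrite ler_wpM2l.
  have -> : B / s = s * (B / s ^+ 2) by field; rewrite gt_eqF.
  by rewrite ler_wpM2l// ltW.
- have /andP[K0 K1] := profileK_bounds s0.
  apply: (@le_trans _ _ ((4 + lambda) * B / s)); last first.
    by rewrite ler_wpM2l// mulr_ge0// addr_ge0.
  rewrite /profileu''.
  have -> : (4 + lambda) * B / s = 4 * B / s + lambda * B / s by field; rewrite gt_eqF.
  apply: le_trans (ler_normB _ _) _; apply: lerD.
    have p0 : 0 <= F false 0%N s by rewrite -(pmulr_rge0 _ s0).
    rewrite ger0_norm ?mulr_ge0 ?sqr_ge0//.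
    rewrite ler_pdivlMr// -mulrA.
    have Kle1 : profileK s <= 1.
      have /andP[k0 _] := bound_k s0; rewrite /profileK gerBl; apply: le_trans k0.
      by rewrite divr_ge0 ?sqr_ge0 ?exprn_ge0// ltW.
    have KB : profileK s <= 2 * B.
      apply: le_trans K1 _; rewrite ler_pdivrMr ?exprn_gt0//.
      by rewrite ler_peMr ?mulr_ge0// exprn_ege1.
    have ph : F false 0%N s * s <= 1 by rewrite mulrC -subr_ge0.
    have ph0 : 0 <= F false 0%N s * s by rewrite mulr_ge0// ltW.
    by nra.
  have h2 : 0 <= (s * F false 0%N s) * (1 - (s * F false 0%N s) ^+ 2) <= 2 * (B / s ^+ 2).
    set h := s * F false 0%N s in h0 h1 hp *.
    have h3 : h <= 1 by rewrite -subr_ge0.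
    have -> : h * (1 - h ^+ 2) = (h * (1 + h)) * (1 - h) by ring.
    have a1 : 0 <= h * (1 + h) <= 2 by apply/andP; split; nra.
    case/andP: a1 => a0 a1; rewrite mulr_ge0//=.
    by rewrite ler_pM.
  case/andP: h2 => h20 h21.
  rewrite ger0_norm; last by rewrite mulr_ge0// mulr_ge0 ?(ltW s0)// divr_ge0.
  have -> : lambda * B / s = lambda / 2 * s * (2 * (B / s ^+ 2)).
    by field; rewrite gt_eqF.
  by rewrite ler_wpM2l// mulr_ge0 ?(ltW s0)// divr_ge0.
Qed.

(** In the variables [K] and [h]: [2 (K' / r)^2 + ((1 - K^2) / r^2)^2 + h'^2 + 2 (K h / r)^2 +
    lambda / 4 (1 - h^2)^2], written so as to make sense at [r = 0]. *)
Definition radial_density t : R :=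
  2 * (2 * F true 0%N t + t ^+ 2 * F true 1%N t) ^+ 2
  + (F true 0%N t * (2 - t ^+ 2 * F true 0%N t)) ^+ 2
  + (F false 0%N t + t ^+ 2 * F false 1%N t) ^+ 2
  + 2 * ((1 - t ^+ 2 * F true 0%N t) * F false 0%N t) ^+ 2
  + lambda / 4 * (1 - t ^+ 2 * F false 0%N t ^+ 2) ^+ 2.

Lemma radial_density_ge0 t : 0 <= radial_density t.
Proof.
by rewrite /radial_density; nonneg.
Qed.

Lemma radial_density_cont : cont_abs radial_density.
Proof.
move=> t; rewrite /continuous_at.
have c0 := @cont_F true 0%N t; have c1 := @cont_F true 1%N t.
have p0 := @cont_F false 0%N t; have p1 := @cont_F false 1%N t.
have cn := @norm_continuous _ _ t.
suff : {for t, continuous (fun t => radial_density `|t|)} by [].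
by rewrite /radial_density; repeat cont_step.
Qed.

Lemma radial_density_far : exists2 C : R, 0 <= C &
  forall t, 1 <= t -> radial_density t <= C / t ^+ 4.
Proof.
have b0 := ltW B_gt0; have l0 := ltW lambda_gt0.
(* For the term [h' = (u' + (1 - h)) / t]: [6 + lambda] comes from [u'] and 1 from [1 - h]. *)
pose A := (7 + lambda) * B; have A0 : 0 <= A by rewrite mulr_ge0// addr_ge0.
(* One constant for each summand of [radial_density], in the same order. *)
exists (128 * B ^+ 2 + 1 + A ^+ 2 + 8 * B ^+ 2 + lambda * B ^+ 2).
  by nonneg.
move=> t t1; have t0 : 0 < t by lra.
have tn0 : t != 0 by rewrite gt_eqF.
have t2 : 0 < t ^+ 2 by rewrite exprn_gt0.
have t21 : 1 <= t ^+ 2 by rewrite exprn_ege1.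
have /andP[K0 K1] := profileK_bounds t0; have /andP[h0 h1] := profileh_bounds t0.
have hp := profileh_ge0 t0; have /andP[_ hle] := bound_h t0.
have /andP[k0 kle] := bound_k t0.
have kge : 0 <= t ^+ 2 * F true 0%N t.
  by apply: le_trans k0; rewrite divr_ge0 ?sqr_ge0 ?exprn_ge0// ltW.
have x0 : 0 <= F true 0%N t by rewrite -(pmulr_rge0 _ t2).
have sq (x y : R) : `|x| <= y -> x ^+ 2 <= y ^+ 2.
  by move=> xy; rewrite -real_normK ?num_real// lerXn2r ?nnegrE ?(le_trans _ xy).
rewrite /radial_density 4!(mulrDl _ _ (t ^+ 4)^-1); apply: lerD;
  [apply: lerD; [apply: lerD; [apply: lerD|]|]|].
- have -> : 2 * (2 * F true 0%N t + t ^+ 2 * F true 1%N t) ^+ 2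
      = 2 * (profileK' t / t) ^+ 2 by rewrite /profileK'; field.
  have -> : 128 * B ^+ 2 / t ^+ 4 = 2 * (8 * B / t ^+ 2) ^+ 2 by field.
  rewrite ler_pM2l//; apply: sq; rewrite normrM normfV (gtr0_norm t0).
  apply: le_trans (profileK'_bound t1); rewrite ler_pdivrMr// ler_peMr//.
- have -> : 1 / t ^+ 4 = (1 / t ^+ 2) ^+ 2 by field.
  apply: sq; rewrite ger0_norm; last by rewrite mulr_ge0//; lra.
  rewrite ler_pdivlMr//.
  by set k := t ^+ 2 * _ in kge kle *; rewrite [leLHS](_ : _ = k * (2 - k)); [nra|rewrite /k; ring].
- have -> : A ^+ 2 / t ^+ 4 = (A / t ^+ 2) ^+ 2 by field.
  apply: sq.
  have -> : F false 0%N t + t ^+ 2 * F false 1%N t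
      = (profileu' t + (1 - t * F false 0%N t)) / t by rewrite /profileu'; field.
  rewrite normrM normfV (gtr0_norm t0) ler_pdivrMr//.
  apply: le_trans (ler_normD _ _) _; rewrite (ger0_norm h0).
  have -> : A / t ^+ 2 * t = (6 + lambda) * B / t + B / t by rewrite /A; field.
  apply: lerD; first exact: profileu'_bound.
  apply: le_trans h1 _; rewrite ler_wpM2l// lef_pV2 ?posrE//.
  by rewrite expr2 ler_peMr// ltW.
- have -> : 8 * B ^+ 2 / t ^+ 4 = 2 * (2 * B / t ^+ 2) ^+ 2 by field.
  rewrite ler_pM2l//; apply: sq.
  have p0 : 0 <= F false 0%N t by rewrite -(pmulr_rge0 _ t0).
  rewrite ger0_norm ?mulr_ge0//; apply: le_trans K1.
  rewrite /profileK ler_piMr//; apply: le_trans hle.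
  by rewrite ler_peMl.
- have -> : lambda * B ^+ 2 / t ^+ 4 = lambda / 4 * (2 * (B / t ^+ 2)) ^+ 2 by field.
  rewrite ler_wpM2l ?divr_ge0//; apply: sq.
  rewrite -exprMn; set h := t * _ in h0 h1 hp hle *.
  have -> : 1 - h ^+ 2 = (1 + h) * (1 - h) by ring.
  rewrite ger0_norm; last by rewrite mulr_ge0// addr_ge0.
  by rewrite ler_pM// ?addr_ge0//; lra.
Qed.

Lemma radial_density_decay : exists2 C : R, 0 <= C &
  forall t, 0 <= t -> radial_density t <= C / (1 + t ^+ 2) ^+ 2.
Proof.
have [C C0 far] := radial_density_far.
have [||x _ Hx] := @EVT_max R (fun t => radial_density `|t|) 0 1.
- by [].
- by apply: continuous_subspaceT; exact: radial_density_cont.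
pose M := radial_density `|x|; have M0 : 0 <= M by exact: radial_density_ge0.
(* [(1 + t^2)^2] is at most 4 for [t <= 1] and at most [4 t^4] for [t >= 1]. *)
exists (4 * (C + M)); first by rewrite mulr_ge0// addr_ge0.
move=> t t0; have D0 : 0 < (1 + t ^+ 2) ^+ 2.
  by rewrite exprn_gt0// ltr_wpDr// sqr_ge0.
rewrite ler_pdivlMr//; have [t1|t1] := leP t 1.
  have tM : radial_density t <= M.
    by have := Hx t; rewrite in_itv/= t0 t1 ger0_norm//; apply.
  have : (1 + t ^+ 2) ^+ 2 <= 4.
    have : t ^+ 2 <= 1 by rewrite expr_le1.
    by have := sqr_ge0 t; nra.
  have d0 := radial_density_ge0 t; nra.
have t4 : 0 < t ^+ 4 by rewrite exprn_gt0//; lra.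
have := far t (ltW t1); rewrite ler_pdivlMr// => H.
have : (1 + t ^+ 2) ^+ 2 <= 4 * t ^+ 4.
  have : 1 <= t ^+ 2 by rewrite exprn_ege1// ltW.
  by rewrite (_ : t ^+ 4 = (t ^+ 2) ^+ 2) -?exprM//; nra.
have d0 := radial_density_ge0 t.
move=> /(ler_wpM2l d0) /le_trans; apply.
by rewrite mulrCA ler_pM2l// (le_trans H)// lerDl.
Qed.

End Decay.

(** * Radial functions on R^3 *)

Section Space.
Variable R : realType.
Implicit Types (p q : R -> R) (t s : R) (x : R3 R).

Lemma is_derive_line (f : R3 R -> R) x (v : R3 R) (d : R) :
  is_derive (0 : R) 1 (fun h : R => f (h *: v + x)) d -> is_derive x v f d.
Proof.
move=> [df dE]; apply: DeriveDef; first exact: (proj2 (derivable1P f x v) df).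
rewrite -dE /derive; set g1 := fun h => h^-1 *: _; set g2 := fun h => h^-1 *: _.
suff -> : g1 = g2 by [].
by apply/funext => h; rewrite /g1 /g2 /= addr0 scale0r add0r [_%:A]mulr1.
Qed.

(** By the mean value theorem [p t - p 0 = O(t^2)], because [p' = t q] with [q] bounded near 0. *)
Lemma der_abs0 p q : cont_abs p -> cont_abs q ->
  (forall t, 0 < t -> is_derive t 1 p (t * q t)) ->
  is_derive (0 : R) 1 (fun s : R => p `|s|) 0.
Proof.
move=> cp cq dp.
have [d d0 qM] : exists2 d : R, 0 < d & forall t, 0 < t -> t < d -> `|q t| <= `|q 0| + 1.
  apply: at_right0; have /cvgrPdist_lt/(_ 1 ltr01) := cont_abs_right cq.
  apply: filterS => t H; rewrite -lerBlDl (le_trans (lerB_dist _ _))// distrC.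
  exact: ltW.
set M := `|q 0| + 1 in qM; have M0 : 0 < M by rewrite ltr_wpDl.
have est t : 0 < t -> t < d -> `|p t - p 0| <= M * t * t.
  move=> t0 td.
  have [||c] := @MVT R p (fun s => s * q s) 0 t t0.
  - by move=> s; rewrite in_itv/= => /andP[s0 _]; exact: dp.
  - apply/(continuous_within_itvP _ t0); split.
    + by move=> s; rewrite in_itv/= => /andP[s0 _]; exact: cont_abs_pos.
    + exact: cont_abs_right.
    + by apply: cvg_at_left_filter; exact: cont_abs_pos.
  rewrite in_itv/= => /andP[c0' ct] ->; rewrite subr0 normrM (gtr0_norm t0).
  rewrite ler_wpM2r ?(ltW t0)// normrM (gtr0_norm c0') mulrC.
  by apply: ler_pM; rewrite ?normr_ge0 ?(ltW c0') ?(ltW ct)// qM// (lt_trans ct).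
have lim0 : (h^-1 * (p `|h| - p 0)) @[h --> (0 : R)^'] --> (0 : R).
  apply/cvgrPdist_le => /= e e0.
  exists (Num.min d (e / M)) => /=; first by rewrite lt_min d0 divr_gt0.
  move=> h /=; rewrite sub0r normrN lt_min => /andP[hd he] hn0.
  rewrite sub0r normrN normrM normfV.
  have h0 : 0 < `|h| by rewrite normr_gt0.
  rewrite ler_pdivrMl//; apply: le_trans (est _ h0 hd) _.
  rewrite mulrC ler_pM2l// mulrC -ler_pdivlMr//; exact: ltW.
have E : (fun h : R => h^-1 *: (((fun s : R => p `|s|) \o shift 0) (h *: 1) - p `|0 : R|))
    = (fun h : R => h^-1 * (p `|h| - p 0)).
  by rewrite funeqE => h /=; rewrite addr0 [_%:A]mulr1 normr0.
apply: DeriveDef; first by rewrite /derivable E; apply/cvg_ex; exists 0.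
by rewrite /derive E; exact: cvg_lim.
Qed.

(** The restriction of a radial function to a line at squared distance [c] from the origin. The
    chain rule through the square root fails only at the origin itself, which is the case of
    [der_abs0]. *)
Lemma der_radial p q (c s : R) : 0 <= c -> cont_abs p -> cont_abs q ->
  (forall t, 0 < t -> is_derive t 1 p (t * q t)) ->
  is_derive s 1 (fun s : R => p (Num.sqrt (c + s ^+ 2))) (s * q (Num.sqrt (c + s ^+ 2))).
Proof.
move=> c0 cp cq dp; have s2 := sqr_ge0 s.
have := addr_ge0 c0 s2; rewrite le_eqVlt => /predU1P[/esym E|r0]; last first.
  have dr : is_derive s 1 (fun s : R => c + s ^+ 2) (2 * s).
    by derive_tac; rewrite /=; ring.
  have dsq := @der_comp _ (@Num.sqrt R) (fun s : R => c + s ^+ 2) s _ _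
    (is_derive1_sqrt r0) dr.
  have rt0 : 0 < Num.sqrt (c + s ^+ 2) by rewrite sqrtr_gt0.
  have := @der_comp _ p (fun s : R => Num.sqrt (c + s ^+ 2)) s _ _ (dp _ rt0) dsq.
  move=> H; apply: der_eq H _ => /=.
  by field; rewrite gt_eqF.
have /andP[/eqP cE /eqP sE] : (c == 0) && (s ^+ 2 == 0) by rewrite -paddr_eq0// E.
have s0 : s = 0 by apply/eqP; rewrite -sqrf_eq0 sE.
rewrite cE s0 mul0r.
have -> : (fun s : R => p (Num.sqrt (0 + s ^+ 2))) = (fun s => p `|s|).
  by apply/funext => r; rewrite add0r sqrtr_sqr.
exact: der_abs0 cp cq dp.
Qed.

(** Total on [nat], so that components can be chosen by numerals and expressions reduce by
    computation; every index above 1 means the third axis. *)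
Definition axis (m : nat) : 'I_3 :=
  match m with
  | 0 => @Ordinal 3 0 isT
  | 1 => @Ordinal 3 1 isT
  | _ => @Ordinal 3 2 isT
  end.

Definition coord (m : nat) x : R := x ord0 (axis m).

Definition radius x : R :=
  Num.sqrt (coord 0 x ^+ 2 + coord 1 x ^+ 2 + coord 2 x ^+ 2).

Lemma radius_ge0 x : 0 <= radius x. Proof. exact: sqrtr_ge0. Qed.

Lemma sqr_radius x : radius x ^+ 2 = coord 0 x ^+ 2 + coord 1 x ^+ 2 + coord 2 x ^+ 2.
Proof. by rewrite sqr_sqrtr// !addr_ge0 ?sqr_ge0. Qed.

Lemma coord_cont m : continuous (coord m).
Proof. exact: coord_continuous. Qed.

Lemma radius_continuous : continuous radius.
Proof.
move=> x; apply: (@continuous_comp _ _ _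
  (fun x => coord 0 x ^+ 2 + coord 1 x ^+ 2 + coord 2 x ^+ 2) Num.sqrt).
  have c0 := @coord_cont 0 x; have c1 := @coord_cont 1 x.
  have c2 := @coord_cont 2 x.
  suff : {for x, continuous (fun x => coord 0 x ^+ 2 + coord 1 x ^+ 2 + coord 2 x ^+ 2)}.
    by [].
  by repeat cont_step.
exact: sqrt_continuous.
Qed.

Lemma coord_line m (i : 'I_3) (h : R) x :
  coord m (h *: e_ R i + x) = h * (nat_of_ord i == axis m)%:R + coord m x.
Proof. by rewrite /coord /e_ !mxE eqxx/= [axis m == i]eq_sym. Qed.

(* Polynomials in the coordinates and in the radial functions [F b n]. *)
Inductive field_expr :=
  | Coord of nat
  | Radial of bool & nat
  | Const of R
  | Sum of field_expr & field_expr
  | Prod of field_expr & field_expr.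

Variable F : bool -> nat -> R -> R.
Hypothesis cont_F : forall b n, cont_abs (F b n).
Hypothesis der_F : forall b n t, 0 < t -> is_derive t 1 (F b n) (t * F b n.+1 t).

Fixpoint eval (e : field_expr) x : R :=
  match e with
  | Coord m => coord m x
  | Radial b n => F b n (radius x)
  | Const c => c
  | Sum e1 e2 => eval e1 x + eval e2 x
  | Prod e1 e2 => eval e1 x * eval e2 x
  end.

(** The expressions are closed under differentiation: in [d/dx_i F_n(|x|)] the factor [t] of
    [F_n' = t F_(n+1)] cancels the denominator of [x_i / |x|]. *)
Fixpoint diff (i : nat) (e : field_expr) : field_expr :=
  match e with
  | Coord m => Const (i == axis m)%:R
  | Radial b n => Prod (Coord i) (Radial b n.+1)
  | Const _ => Const 0
  | Sum e1 e2 => Sum (diff i e1) (diff i e2)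
  | Prod e1 e2 => Sum (Prod (diff i e1) e2) (Prod e1 (diff i e2))
  end.

Lemma eval_continuous e : continuous (eval e).
Proof.
elim: e => [m|b n|c|e1 IH1 e2 IH2|e1 IH1 e2 IH2] x.
- exact: coord_cont.
- have -> : eval (Radial b n) = (fun t => F b n `|t|) \o radius.
    by apply/funext => y /=; rewrite ger0_norm ?radius_ge0.
  apply: continuous_comp; first exact: radius_continuous.
  exact: (@cont_F b n (radius x)).
- exact: (@cont_cst _ _ x c).
- exact: (@cont_add _ _ x _ _ (IH1 x) (IH2 x)).
- exact: (@cont_mul _ _ x _ _ (IH1 x) (IH2 x)).
Qed.

Lemma is_derive_eval (i : 'I_3) e x : is_derive x (e_ R i) (eval e) (eval (diff i e) x).
Proof.
elim: e => [m|b n|c|e1 IH1 e2 IH2|e1 IH1 e2 IH2] /=.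
- apply: is_derive_line.
  have -> : (fun h : R => coord m (h *: e_ R i + x)) =
      (fun h : R => h * (nat_of_ord i == axis m)%:R + coord m x).
    by apply/funext => h; exact: coord_line.
  by derive_tac; rewrite /=; ring.
- apply: is_derive_line.
  pose c := radius x ^+ 2 - coord i x ^+ 2.
  have c0 : 0 <= c.
    rewrite /c sqr_radius {c}; case: i => [[|[|[|//]]] ?] /=.
    + by rewrite [leRHS](_ : _ = coord 1 x ^+ 2 + coord 2 x ^+ 2); [nonneg|ring].
    + by rewrite [leRHS](_ : _ = coord 0 x ^+ 2 + coord 2 x ^+ 2); [nonneg|ring].
    + by rewrite [leRHS](_ : _ = coord 0 x ^+ 2 + coord 1 x ^+ 2); [nonneg|ring].
  have rE h : radius (h *: e_ R i + x) = Num.sqrt (c + (coord i x + h) ^+ 2).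
    rewrite /c sqr_radius /radius; congr Num.sqrt; rewrite !coord_line.
    by move: {c c0} i => -[[|[|[|//]]] ?] /=; ring.
  have -> : (fun h : R => F b n (radius (h *: e_ R i + x))) =
      (fun h : R => F b n (Num.sqrt (c + (coord i x + h) ^+ 2))).
    by apply/funext => h; rewrite rE.
  have dl : is_derive (0 : R) 1 (fun h : R => coord i x + h) 1.
    by derive_tac; rewrite add0r.
  have dF := @der_radial (F b n) (F b n.+1) c (coord i x + 0) c0 (@cont_F b n)
    (@cont_F b n.+1) (@der_F b n).
  apply: der_eq (@der_comp _ (fun s : R => F b n (Num.sqrt (c + s ^+ 2)))
    (fun h : R => coord i x + h) 0 _ _ dF dl) _.
  rewrite mulr1 addr0 /c subrK; congr (_ * F b n.+1 _).
  by rewrite sqrtr_sqr ger0_norm ?radius_ge0.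
- exact: is_derive_cst.
- exact: is_deriveD.
- apply: is_derive_eq (is_deriveM IH1 IH2) _.
  by rewrite /GRing.scale/= addrC [eval (diff i e1) x * _]mulrC.
Qed.

Lemma smooth_eval e : smooth (eval e).
Proof.
move=> n; elim: n e => [|n IH] e /=; split=> //; try exact: eval_continuous.
move=> i; split=> [x|]; first by case: (is_derive_eval i e x).
have -> : (fun x => 'D_(e_ R i) (eval e) x) = eval (diff i e); last exact: IH.
by apply/funext => x; case: (is_derive_eval i e x).
Qed.

End Space.

(** * The Lie algebra su(2) *)

Section SU2.
Variable R : realType.
Implicit Types (a b c r : R).

Definition su2_re (a0 a1 a2 : R) (k l : nat) : R :=
  match k, l with
  | 0, 0 => 0
  | 0, _ => - 2^-1 * a1
  | _, 0 => 2^-1 * a1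
  | _, _ => 0
  end.

Definition su2_im (a0 a1 a2 : R) (k l : nat) : R :=
  match k, l with
  | 0, 0 => - 2^-1 * a2
  | 0, _ => - 2^-1 * a0
  | _, 0 => - 2^-1 * a0
  | _, _ => 2^-1 * a2
  end.

(* The combination [a0 T_0 + a1 T_1 + a2 T_2] of the basis [T_j = - i sigma_j / 2]
   of su(2), which is orthonormal for [inner] and satisfies [[T_0, T_1] = T_2]. *)
Definition su2_vec (a0 a1 a2 : R) : M2 R :=
  \matrix_(k, l) (su2_re a0 a1 a2 k l +i* su2_im a0 a1 a2 k l)%C.

Lemma su2_vec_add (a0 a1 a2 b0 b1 b2 : R) :
  su2_vec a0 a1 a2 + su2_vec b0 b1 b2 = su2_vec (a0 + b0) (a1 + b1) (a2 + b2).
Proof.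
apply/matrixP => k l; rewrite !mxE.
case: k => [[|[|//]] ?]; case: l => [[|[|//]] ?]; rewrite /su2_re /su2_im /=;
  by apply/eqP; rewrite eq_complex /=; apply/andP; split; apply/eqP; ring.
Qed.

Lemma su2_vec_opp (a0 a1 a2 : R) :
  - su2_vec a0 a1 a2 = su2_vec (- a0) (- a1) (- a2).
Proof.
apply/matrixP => k l; rewrite !mxE.
case: k => [[|[|//]] ?]; case: l => [[|[|//]] ?]; rewrite /su2_re /su2_im /=;
  by apply/eqP; rewrite eq_complex /=; apply/andP; split; apply/eqP; ring.
Qed.

Lemma su2_vec_scale (r a0 a1 a2 : R) :
  r%:C%C *: su2_vec a0 a1 a2 = su2_vec (r * a0) (r * a1) (r * a2).
Proof.
apply/matrixP => k l; rewrite !mxE.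
case: k => [[|[|//]] ?]; case: l => [[|[|//]] ?]; rewrite /su2_re /su2_im /=;
  by apply/eqP; rewrite eq_complex /=; apply/andP; split; apply/eqP; ring.
Qed.

Lemma su2_su2_vec (a0 a1 a2 : R) : su2 (su2_vec a0 a1 a2).
Proof.
split.
  apply/matrixP => k l; rewrite !mxE.
  case: k => [[|[|//]] ?]; case: l => [[|[|//]] ?]; rewrite /su2_re /su2_im /=;
    by apply/eqP; rewrite eq_complex /=; apply/andP; split; apply/eqP; ring.
rewrite /mxtrace !big_ord_recl big_ord0 !mxE /su2_re /su2_im /=.
by apply/eqP; rewrite eq_complex /=; apply/andP; split; apply/eqP; ring.
Qed.

Lemma lie_su2_vec (a0 a1 a2 b0 b1 b2 : R) :
  lie (su2_vec a0 a1 a2) (su2_vec b0 b1 b2)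
  = su2_vec (a1 * b2 - a2 * b1) (a2 * b0 - a0 * b2) (a0 * b1 - a1 * b0).
Proof.
apply/matrixP => k l; rewrite /lie !mxE !big_ord_recl !big_ord0 !mxE.
case: k => [[|[|//]] ?]; case: l => [[|[|//]] ?]; rewrite /su2_re /su2_im /=;
  by apply/eqP; rewrite eq_complex /=; apply/andP; split; apply/eqP; field.
Qed.

Lemma inner_su2_vec (a0 a1 a2 b0 b1 b2 : R) :
  inner (su2_vec a0 a1 a2) (su2_vec b0 b1 b2) = a0 * b0 + a1 * b1 + a2 * b2.
Proof.
rewrite innerE !big_ord_recl !big_ord0 /= !mxE /su2_re /su2_im /=; by field.
Qed.

End SU2.

(** * The hedgehog *)

Section Hedgehog.
Variables (R : realType) (lambda : R) (F : bool -> nat -> R -> R).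
Hypothesis cont_F : forall b n, cont_abs (F b n).
Hypothesis der_F : forall b n (t : R), 0 < t -> is_derive t 1 (F b n) (t * F b n.+1 t).
Hypothesis ode_F : forall b (t : R), 0 <= t -> 5 * F b 1%N t + t ^+ 2 * F b 2%N t
     = coupling lambda b t (F true 0%N t) (F false 0%N t).
Implicit Types (e : nat -> field_expr R) (i j : 'I_3) (x : R3 R).

Definition su2_section_of e : end_section R := fun x =>
  su2_vec (eval F (e 0) x) (eval F (e 1) x) (eval F (e 2) x).

(** Matrix entries are again expressions, compatibly with [diff]; this carries smoothness and
    [pderiv] over from scalars to sections. *)
Lemma re_entry_section e (k l : 'I_2) : exists2 f : field_expr R,
  re_entry (su2_section_of e) k l = eval F f &
  forall i x, eval F (diff i f) x = su2_re (eval F (diff i (e 0)) x)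
    (eval F (diff i (e 1)) x) (eval F (diff i (e 2)) x) k l.
Proof.
case: k => [[|[|//]] ?]; case: l => [[|[|//]] ?].
- exists (Const 0) => //; by apply/funext => x; rewrite /re_entry mxE.
- exists (Prod (Const (- 2^-1)) (e 1)).
    by apply/funext => x; rewrite /re_entry mxE.
  by move=> i x /=; rewrite mul0r add0r.
- exists (Prod (Const 2^-1) (e 1)).
    by apply/funext => x; rewrite /re_entry mxE.
  by move=> i x /=; rewrite mul0r add0r.
- exists (Const 0) => //; by apply/funext => x; rewrite /re_entry mxE.
Qed.

Lemma im_entry_section e (k l : 'I_2) : exists2 f : field_expr R,
  im_entry (su2_section_of e) k l = eval F f &
  forall i x, eval F (diff i f) x = su2_im (eval F (diff i (e 0)) x)
    (eval F (diff i (e 1)) x) (eval F (diff i (e 2)) x) k l.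
Proof.
case: k => [[|[|//]] ?]; case: l => [[|[|//]] ?].
- exists (Prod (Const (- 2^-1)) (e 2)).
    by apply/funext => x; rewrite /im_entry mxE.
  by move=> i x /=; rewrite mul0r add0r.
- exists (Prod (Const (- 2^-1)) (e 0)).
    by apply/funext => x; rewrite /im_entry mxE.
  by move=> i x /=; rewrite mul0r add0r.
- exists (Prod (Const (- 2^-1)) (e 0)).
    by apply/funext => x; rewrite /im_entry mxE.
  by move=> i x /=; rewrite mul0r add0r.
- exists (Prod (Const 2^-1) (e 2)).
    by apply/funext => x; rewrite /im_entry mxE.
  by move=> i x /=; rewrite mul0r add0r.
Qed.

Lemma smooth_section_of e : smooth_section (su2_section_of e).
Proof.
move=> k l; have [f -> _] := re_entry_section e k l.
by have [g -> _] := im_entry_section e k l; split; exact: smooth_eval.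
Qed.

Lemma pderiv_section i e :
  pderiv i (su2_section_of e) = su2_section_of (fun a => diff i (e a)).
Proof.
apply/funext => x; apply/matrixP => k l; rewrite !mxE.
have [f -> fE] := re_entry_section e k l; have [g -> gE] := im_entry_section e k l.
have [_ ->] := is_derive_eval cont_F der_F i f x.
have [_ ->] := is_derive_eval cont_F der_F i g x.
by rewrite fE gE.
Qed.

Definition expr_sub (f g : field_expr R) := Sum f (Prod (Const (-1)) g).

Definition expr_cross e (e' : nat -> field_expr R) (a : nat) : field_expr R :=
  match a with
  | 0 => expr_sub (Prod (e 1) (e' 2)) (Prod (e 2) (e' 1))
  | 1 => expr_sub (Prod (e 2) (e' 0)) (Prod (e 0) (e' 2))
  | _ => expr_sub (Prod (e 0) (e' 1)) (Prod (e 1) (e' 0))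
  end.

Lemma lie_section e e' x : lie (su2_section_of e x) (su2_section_of e' x)
  = su2_section_of (expr_cross e e') x.
Proof. by rewrite /su2_section_of lie_su2_vec /= !mulN1r. Qed.

(* The components of [chi (e_i x x)], where [e_i x x] is the vector product. *)
Definition hedgehog_potential (i a : nat) : field_expr R :=
  let c m := Prod (Radial R true 0) (Coord R m) in
  let c' m := Prod (Const (-1)) (c m) in
  match i, a with
  | 0, 1 => c' 2 | 0, 2 => c 1
  | 1, 0 => c 2 | 1, 2 => c' 0
  | 2, 0 => c' 1 | 2, 1 => c 0
  | _, _ => Const 0
  end.

Definition hedgehog_higgs (a : nat) : field_expr R :=
  Prod (Radial R false 0) (Coord R a).

Definition hedgehog_connection : one_form R :=
  fun i => su2_section_of (hedgehog_potential i).

Definition hedgehog_field : end_section R := su2_section_of hedgehog_higgs.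

Local Notation A := hedgehog_connection.

Definition expr_covd (i : nat) e (a : nat) : field_expr R :=
  Sum (diff i (e a)) (expr_cross (hedgehog_potential i) e a).

Definition expr_curvature (i j a : nat) : field_expr R :=
  Sum (expr_sub (diff i (hedgehog_potential j a)) (diff j (hedgehog_potential i a)))
      (expr_cross (hedgehog_potential i) (hedgehog_potential j) a).

Lemma covd_section i e : covd A i (su2_section_of e) = su2_section_of (expr_covd i e).
Proof.
apply/funext => x; rewrite /covd pderiv_section lie_section.
exact: su2_vec_add.
Qed.

Lemma curvature_section i j : curvature A i j = su2_section_of (expr_curvature i j).
Proof.
apply/funext => x; rewrite /curvature !pderiv_section lie_section.
by rewrite /su2_section_of su2_vec_opp !su2_vec_add /= !mulN1r.
Qed.

(** Reduces each component of the field equations to a polynomial identity: the two sides differ by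
    an explicit multiple [k] of the radial equation. *)
Lemma eq_scaled_ode b (t u w k : R) : 0 <= t ->
  u - w = k * (5 * F b 1%N t + t ^+ 2 * F b 2%N t
     - coupling lambda b t (F true 0%N t) (F false 0%N t)) -> u = w.
Proof.
by move=> t0; rewrite ode_F// subrr mulr0 => /eqP; rewrite subr_eq0 => /eqP.
Qed.

(** The component of index [j] holds identically; each other one is the equation for [chi]
    multiplied by the matching component of [- (e_j x x)]. *)
Lemma hedgehog_yang_mills j x :
  codiff A (curvature A) j x = lie (covd A j hedgehog_field x) (hedgehog_field x).
Proof.
have r0 := radius_ge0 x.
rewrite /codiff (eq_bigr (fun i : 'I_3 =>
  su2_section_of (expr_covd i (expr_curvature i j)) x)) => [|i _]; last first.
  by rewrite curvature_section covd_section.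
rewrite !big_ord_recl big_ord0 addr0 /hedgehog_field covd_section lie_section /su2_section_of !su2_vec_add su2_vec_opp.
case: j => [[|[|[|//]]] ?].
- congr su2_vec.
  + by rewrite /=; ring.
  + apply: (@eq_scaled_ode true _ _ _ (coord 2 x) r0).
    by rewrite /coupling sqr_radius /=; ring.
  + apply: (@eq_scaled_ode true _ _ _ (- coord 1 x) r0).
    by rewrite /coupling sqr_radius /=; ring.
- congr su2_vec.
  + apply: (@eq_scaled_ode true _ _ _ (- coord 2 x) r0).
    by rewrite /coupling sqr_radius /=; ring.
  + by rewrite /=; ring.
  + apply: (@eq_scaled_ode true _ _ _ (coord 0 x) r0).
    by rewrite /coupling sqr_radius /=; ring.
- congr su2_vec.
  + apply: (@eq_scaled_ode true _ _ _ (coord 1 x) r0).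
    by rewrite /coupling sqr_radius /=; ring.
  + apply: (@eq_scaled_ode true _ _ _ (- coord 0 x) r0).
    by rewrite /coupling sqr_radius /=; ring.
  + by rewrite /=; ring.
Qed.

Lemma normsq_hedgehog x :
  normsq (hedgehog_field x) = radius x ^+ 2 * F false 0%N (radius x) ^+ 2.
Proof.
rewrite /normsq /hedgehog_field /su2_section_of inner_su2_vec sqr_radius /=; ring.
Qed.

Lemma hedgehog_higgs_equation x : rough_laplacian A hedgehog_field x
  = (lambda / 2 * (1 - normsq (hedgehog_field x)))%:C%C *: hedgehog_field x.
Proof.
have r0 := radius_ge0 x; rewrite normsq_hedgehog.
rewrite /rough_laplacian /covd_adj (eq_bigr (fun i : 'I_3 =>
  su2_section_of (expr_covd i (expr_covd i hedgehog_higgs)) x)) => [|i _]; last first.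
  by rewrite covd_section covd_section.
rewrite !big_ord_recl big_ord0 addr0 /hedgehog_field.
rewrite /su2_section_of !su2_vec_add su2_vec_opp su2_vec_scale; congr su2_vec.
- apply: (@eq_scaled_ode false _ _ _ (- coord 0 x) r0).
  by rewrite /coupling !sqr_radius /=; ring.
- apply: (@eq_scaled_ode false _ _ _ (- coord 1 x) r0).
  by rewrite /coupling !sqr_radius /=; ring.
- apply: (@eq_scaled_ode false _ _ _ (- coord 2 x) r0).
  by rewrite /coupling !sqr_radius /=; ring.
Qed.

Lemma hedgehog_density x : energy_density lambda A hedgehog_field x
  = radial_density lambda F (radius x).
Proof.
rewrite /energy_density normsq_hedgehog.
have -> : inner2 (curvature A) (curvature A) x =
    \sum_(i < 3) \sum_(j < 3) if (i < j)%N then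
      eval F (expr_curvature i j 0) x ^+ 2 + eval F (expr_curvature i j 1) x ^+ 2
      + eval F (expr_curvature i j 2) x ^+ 2 else 0.
  apply: eq_bigr => i _; rewrite big_mkcond; apply: eq_bigr => j _; case: ifP => // _.
  by rewrite curvature_section /su2_section_of inner_su2_vec !expr2.
have -> : inner1 (fun i => covd A i hedgehog_field) (fun i => covd A i hedgehog_field) x =
    \sum_(i < 3) (eval F (expr_covd i hedgehog_higgs 0) x ^+ 2
      + eval F (expr_covd i hedgehog_higgs 1) x ^+ 2
      + eval F (expr_covd i hedgehog_higgs 2) x ^+ 2).
  by apply: eq_bigr => i _; rewrite covd_section /su2_section_of inner_su2_vec !expr2.
rewrite !big_ord_recl !big_ord0 /radial_density /= !sqr_radius; ring.
Qed.

Lemma su2_connection_hedgehog : su2_connection A.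
Proof.
by move=> i; split; [exact: smooth_section_of|move=> x; exact: su2_su2_vec].
Qed.

Lemma su2_section_hedgehog : su2_section hedgehog_field.
Proof. by split; [exact: smooth_section_of|move=> x; exact: su2_su2_vec]. Qed.

End Hedgehog.

(** * Finiteness and positivity of the energy *)

Section ProductIntegrals.
Variable R : realType.

Lemma integral_prod_mul d1 d2 (T1 : measurableType d1) (T2 : measurableType d2)
    (m1 : {sigma_finite_measure set T1 -> \bar R})
    (m2 : {sigma_finite_measure set T2 -> \bar R}) (f : T1 -> R) (h : T2 -> R) :
  measurable_fun setT f -> measurable_fun setT h ->
  (forall x, 0 <= f x) -> (forall y, 0 <= h y) ->
  (\int[m1 \x m2]_z (f z.1 * h z.2)%:E = (\int[m1]_x (f x)%:E) * \int[m2]_y (h y)%:E)%E.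
Proof.
move=> mf mh f0 h0; rewrite fubini_tonelli1; last 2 first.
- apply/measurable_EFinP; apply: measurable_funM.
    by apply: measurableT_comp mf _; exact: measurable_fst.
  by apply: measurableT_comp mh _; exact: measurable_snd.
- by move=> z; rewrite lee_fin mulr_ge0.
rewrite /fubini_F /=.
under eq_integral => x _.
  under eq_integral => y _ do rewrite EFinM.
  rewrite ge0_integralZl_EFin//; last 2 first.
  - by move=> y _; rewrite lee_fin.
  - exact/measurable_EFinP.
  over.
rewrite ge0_integralZr//.
- exact/measurable_EFinP.
- by move=> x _; rewrite lee_fin.
- by apply: integral_ge0 => y _; rewrite lee_fin.
Qed.

Local Notation mu := (@lebesgue_measure R).

(* The library registers no sigma-finite instance on general product measures. *)
Definition plane_measure : set (measurableTypeR R * measurableTypeR R) -> \bar R := (mu \x mu)%E.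
HB.instance Definition _ := Measure.copy plane_measure (mu \x mu)%E.

Lemma plane_measure_sigma_finite : sigma_finite setT plane_measure.
Proof.
exists (fun n => `[- n%:R, n%:R]%classic `*` `[- n%:R, n%:R]%classic).
  apply/esym; rewrite -subTset => -[x y] _.
  exists (Num.bound (`|x| + `|y|)) => //=.
  have H : `|x| + `|y| < (Num.bound (`|x| + `|y|))%:R.
    by apply: archi_boundP; rewrite addr_ge0.
  have x0 := normr_ge0 x; have y0 := normr_ge0 y.
  rewrite !in_itv/= -!ler_norml.
  by split; lra.
move=> n; split; first exact: measurableX.
have fin : (mu `[(- n%:R)%R, n%:R%R]%classic < +oo)%E.
  by rewrite lebesgue_measure_itv; case: ifP => _; rewrite -?EFinB ltry.
by rewrite /plane_measure product_measure1E// lte_mul_pinfty// ge0_fin_numE.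
Qed.

HB.instance Definition _ := Measure_isSigmaFinite.Build _ _ _ plane_measure
  plane_measure_sigma_finite.

Definition cbrt1 (x : R) : R := (1 + x) `^ 3^-1.

Lemma cbrt1_gt0 x : 0 <= x -> 0 < cbrt1 x.
Proof. by move=> x0; rewrite powR_gt0// ltr_wpDr. Qed.

Lemma cbrt1_cube x : 0 <= x -> cbrt1 x ^+ 3 = 1 + x.
Proof.
move=> x0; rewrite -powR_mulrn ?powR_ge0// -powRrM mulVf// powRr1//.
by rewrite addr_ge0.
Qed.

Lemma der_cbrt1 (x : R) : 0 <= x -> is_derive x 1 cbrt1 (3 * cbrt1 x ^+ 2)^-1.
Proof.
move=> x0; have p0 : 0 < 1 + x by rewrite ltr_wpDr.
have d1 : is_derive x 1 (fun x : R => 1 + x) 1 by derive_tac; rewrite add0r.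
have := @der_comp _ (fun y : R => y `^ 3^-1) (fun x : R => 1 + x) x _ _
  (is_derive1_powR _ p0) d1.
move=> H; apply: der_eq H _.
rewrite powRB; last by rewrite (gt_eqF p0) implybT.
rewrite powRr1 ?(ltW p0)// -/(cbrt1 x) -(cbrt1_cube x0).
by field; rewrite gt_eqF// cbrt1_gt0.
Qed.

(** [(1 + |x|)^(-4/3)]: integrable on the line since [4 / 3 > 1], while the product of three copies
    has total order -4, that of the energy density. This allows Tonelli to replace polar
    coordinates. *)
Definition decay1 (x : R) : R := (cbrt1 `|x| ^+ 4)^-1.

Lemma decay1_ge0 x : 0 <= decay1 x.
Proof. by rewrite invr_ge0 exprn_ge0// powR_ge0. Qed.

Lemma decay1_continuous : continuous decay1.
Proof.
move=> x; apply: (@continuous_comp _ _ _ (fun x : R => `|x|) (fun t => (cbrt1 t ^+ 4)^-1)).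
  exact: norm_continuous.
have d := der_cbrt1 (normr_ge0 x).
eapply is_derive_continuous; repeat derive_step.
by rewrite expf_neq0// gt_eqF// cbrt1_gt0.
Qed.

Lemma integral_decay1 : (\int[lebesgue_measure]_x (decay1 x)%:E < +oo)%E.
Proof.
rewrite ge0_symfun_integralT; last 3 first.
- exact: decay1_ge0.
- exact: decay1_continuous.
- by move=> x; rewrite /decay1/= normrN.
rewrite -set_itvcy.
have dF (x : R) : 0 <= x -> is_derive x 1 (fun x : R => - (3 / cbrt1 x)) (decay1 x).
  move=> x0; have d := der_cbrt1 x0; have u0 := cbrt1_gt0 x0.
  derive_tac; first by rewrite gt_eqF.
  by rewrite /decay1 ger0_norm//=; field; rewrite gt_eqF.
rewrite (@ge0_continuous_FTC2y _ decay1 (fun x : R => - (3 / cbrt1 x)) 0 0).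
- by rewrite -EFinB -EFinM ltry.
- by move=> x _; exact: decay1_ge0.
- exact/continuous_subspaceT/decay1_continuous.
- rewrite -[X in _ --> X]oppr0; apply: cvgN; rewrite -[X in _ --> X](mulr0 3).
  apply: cvgM; first exact: cvg_cst.
  apply/gtr0_cvgV0.
    near=> x; apply: cbrt1_gt0; near: x.
    by apply: nbhs_pinfty_ge; rewrite num_real.
  apply/cvgryPge => A; near=> x.
  have x0 : 0 <= x by near: x; apply: nbhs_pinfty_ge; rewrite num_real.
  have xA : A ^+ 3 <= x by near: x; apply: nbhs_pinfty_ge; rewrite num_real.
  rewrite leNgt; apply/negP => uA.
  have A0 : 0 < A by apply: lt_trans uA; exact: cbrt1_gt0.
  have : cbrt1 x ^+ 3 < A ^+ 3.
    by rewrite ltrXn2r//; exact: ltW (cbrt1_gt0 x0).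
  by rewrite cbrt1_cube//; apply/negP; rewrite -leNgt ler_wpDl.
- by move=> x x0; case: (dF x (ltW x0)).
- by apply: cvg_at_right_filter; exact: is_derive_continuous (dF 0 (lexx 0)).
- by move=> x; rewrite in_itv/= andbT => x0; apply: is_derive1E; apply/dF/ltW.
Unshelve. all: by end_near. Qed.

(** [(1 + |x|)^2 <= 2 (1 + x^2) <= 2 (1 + S)], followed by a square root and a cube root. *)
Lemma cbrt1_le (x S : R) : 0 <= S -> x ^+ 2 <= S ->
  cbrt1 `|x| <= (Num.sqrt (2 * (1 + S))) `^ 3^-1.
Proof.
move=> S0 xS; apply: ge0_ler_powR; rewrite ?nnegrE ?invr_ge0//.
have S1 : 0 <= 2 * (1 + S) by rewrite mulr_ge0// addr_ge0.
rewrite -(@ler_pXn2r _ 2) ?nnegrE ?sqrtr_ge0 ?addr_ge0// sqr_sqrtr//.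
have := real_normK (num_real x); have := sqr_ge0 (1 - `|x|); set y := `|x|.
by nra.
Qed.

(** The product of the three cube roots is at most [sqrt (2 (1 + S))], whose fourth power
    [4 (1 + S)^2] explains the factor 4. *)
Lemma decay_product (x y z : R) :
  ((1 + (x ^+ 2 + y ^+ 2 + z ^+ 2)) ^+ 2)^-1 <= 4 * (decay1 x * decay1 y * decay1 z).
Proof.
set S := x ^+ 2 + y ^+ 2 + z ^+ 2.
have x2 := sqr_ge0 x; have y2 := sqr_ge0 y; have z2 := sqr_ge0 z.
have S0 : 0 <= S by rewrite !addr_ge0.
pose n := (Num.sqrt (2 * (1 + S))) `^ 3^-1.
have xn : cbrt1 `|x| <= n by apply: cbrt1_le => //; rewrite /S; lra.
have yn : cbrt1 `|y| <= n by apply: cbrt1_le => //; rewrite /S; lra.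
have zn : cbrt1 `|z| <= n by apply: cbrt1_le => //; rewrite /S; lra.
have x0 := cbrt1_gt0 (normr_ge0 x); have y0 := cbrt1_gt0 (normr_ge0 y).
have z0 := cbrt1_gt0 (normr_ge0 z).
have n3 : n ^+ 3 = Num.sqrt (2 * (1 + S)).
  by rewrite /n -powR_mulrn ?powR_ge0// -powRrM mulVf// powRr1// sqrtr_ge0.
have prod_le : cbrt1 `|x| * cbrt1 `|y| * cbrt1 `|z| <= n ^+ 3.
  have -> : n ^+ 3 = n * n * n by ring.
  by rewrite ler_pM ?mulr_ge0 ?(ltW x0) ?(ltW y0) ?(ltW z0)// ler_pM ?(ltW x0) ?(ltW y0).
have p0 : 0 < cbrt1 `|x| * cbrt1 `|y| * cbrt1 `|z| by rewrite !mulr_gt0.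
have -> : 4 * (decay1 x * decay1 y * decay1 z)
    = 4 / (cbrt1 `|x| * cbrt1 `|y| * cbrt1 `|z|) ^+ 4.
  by rewrite /decay1; field; rewrite !gt_eqF.
rewrite ler_pdivlMr ?exprn_gt0// mulrC ler_pdivrMr ?exprn_gt0 ?ltr_wpDr//.
have S1 : 0 <= 2 * (1 + S) by rewrite mulr_ge0// addr_ge0.
apply: (@le_trans _ _ ((n ^+ 3) ^+ 4)).
  by rewrite lerXn2r ?nnegrE ?(ltW p0)// n3 sqrtr_ge0.
have -> : (n ^+ 3) ^+ 4 = (Num.sqrt (2 * (1 + S)) ^+ 2) ^+ 2 by rewrite n3 -exprM.
by rewrite sqr_sqrtr// exprMn; lra.
Qed.

Lemma radius_vec3 (z : R * R * R) :
  radius (vec3 z) = Num.sqrt (z.1.1 ^+ 2 + z.1.2 ^+ 2 + z.2 ^+ 2).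
Proof. by rewrite /radius /coord /vec3 !mxE. Qed.

Lemma measurable_radial (D : R -> R) : cont_abs D ->
  measurable_fun setT (fun z : R * R * R => D (radius (vec3 z))).
Proof.
move=> cD.
have -> : (fun z : R * R * R => D (radius (vec3 z))) = (fun t => D `|t|) \o
    (@Num.sqrt R) \o (fun z => z.1.1 ^+ 2 + z.1.2 ^+ 2 + z.2 ^+ 2).
  by apply/funext => z /=; rewrite radius_vec3 ger0_norm// sqrtr_ge0.
apply: measurableT_comp; last first.
  have m1 : measurable_fun setT (fun z : R * R * R => z.1.1).
    exact: (measurableT_comp measurable_fst measurable_fst).
  have m2 : measurable_fun setT (fun z : R * R * R => z.1.2).
    exact: (measurableT_comp measurable_snd measurable_fst).
  have m3 : measurable_fun setT (fun z : R * R * R => z.2) by exact: measurable_snd.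
  by apply: measurable_funD; first (apply: measurable_funD); exact: measurable_funX.
apply: measurableT_comp; apply: continuous_measurable_fun; first exact: cD.
exact: sqrt_continuous.
Qed.

Lemma radial_integral_lty (D : R -> R) (C : R) : cont_abs D -> 0 <= C ->
  (forall t, 0 <= D t) -> (forall t, 0 <= t -> D t <= C / (1 + t ^+ 2) ^+ 2) ->
  (\int[(mu \x mu) \x mu]_z (D (radius (vec3 z)))%:E < +oo)%E.
Proof.
move=> cD C0 D0 DC; have mdecay := continuous_measurable_fun decay1_continuous.
have mdecay2 : measurable_fun setT (fun z : R * R => C * 4 * decay1 z.1 * decay1 z.2).
  apply: measurable_funM; first apply: measurable_funM => //.
    by apply: measurableT_comp mdecay _; exact: measurable_fst.
  by apply: measurableT_comp mdecay _; exact: measurable_snd.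
apply: (@le_lt_trans _ _ (\int[(mu \x mu) \x mu]_z
    (C * 4 * decay1 z.1.1 * decay1 z.1.2 * decay1 z.2)%:E)%E).
  apply: ge0_le_integral => //.
  - by move=> z _; rewrite lee_fin.
  - apply/measurable_EFinP; exact: (measurable_radial cD).
  - apply/measurable_EFinP; apply: measurable_funM.
      exact: (measurableT_comp mdecay2 measurable_fst).
    exact: (measurableT_comp mdecay measurable_snd).
  - move=> z _; rewrite lee_fin; apply: le_trans (DC _ (radius_ge0 _)) _.
    rewrite sqr_radius /coord /vec3 !mxE/= -!mulrA ler_wpM2l//.
    by rewrite !mulrA -(mulrA 4) -(mulrA 4); exact: decay_product.
have p2 (z : R * R) : 0 <= C * 4 * decay1 z.1 * decay1 z.2.
  by rewrite !mulr_ge0 ?decay1_ge0.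
have p1 (x : R) : 0 <= C * 4 * decay1 x by rewrite !mulr_ge0 ?decay1_ge0.
have -> : (\int[(mu \x mu) \x mu]_z
    (C * 4 * decay1 z.1.1 * decay1 z.1.2 * decay1 z.2)%:E)%E =
  ((\int[mu \x mu]_z (C * 4 * decay1 z.1 * decay1 z.2)%:E)
    * \int[mu]_x (decay1 x)%:E)%E.
  exact: (integral_prod_mul plane_measure mu mdecay2 mdecay p2 decay1_ge0).
have m4 : measurable_fun setT (fun x : R => C * 4 * decay1 x) by exact: measurable_funM.
have -> : (\int[mu \x mu]_z (C * 4 * decay1 z.1 * decay1 z.2)%:E)%E =
  ((\int[mu]_x (C * 4 * decay1 x)%:E) * \int[mu]_x (decay1 x)%:E)%E.
  exact: (integral_prod_mul mu mu m4 mdecay p1 decay1_ge0).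
have I0 : (0 <= \int[mu]_x (decay1 x)%:E)%E.
  by apply: integral_ge0 => x _; rewrite lee_fin decay1_ge0.
under eq_integral do rewrite EFinM.
rewrite ge0_integralZl_EFin//; last 3 first.
- by move=> x _; rewrite lee_fin decay1_ge0.
- exact/measurable_EFinP.
- by rewrite mulr_ge0.
have fin : (\int[mu]_x (decay1 x)%:E)%E \is a fin_num.
  by rewrite ge0_fin_numE// integral_decay1.
by rewrite -(fineK fin) -!EFinM ltry.
Qed.

Lemma radial_integral_gt0 (D : R -> R) : cont_abs D ->
  (forall t, 0 <= D t) -> 0 < D 0 ->
  (0 < \int[(mu \x mu) \x mu]_z (D (radius (vec3 z)))%:E)%E.
Proof.
move=> cD D0 D00.
have e0 : 0 < D 0 / 2 by rewrite divr_gt0.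
have /cvgrPdist_lt/(_ _ e0)/at_right0[d d0 H] := cont_abs_right cD.
(* On the cube [S^3] the squared radius is below [3 d^2 / 4], hence [D > D 0 / 2] there; the open
   end at 0 keeps the radius positive, as [H] demands. *)
pose S := `]0%R, (d / 2)[%classic : set R.
have mS : measurable S by exact: measurable_itv.
have muS : (mu S = (d / 2)%:E)%E.
  by rewrite lebesgue_measure_itv/= lte_fin divr_gt0// oppr0 adde0.
have mI : measurable_fun setT (\1_S : R -> R) by exact: measurable_indic.
have I0 (x : R) : 0 <= (\1_S x : R) by rewrite indicE.
have m2 : measurable_fun setT (fun z : R * R => D 0 / 2 * \1_S z.1 * \1_S z.2).
  apply: measurable_funM; first apply: measurable_funM => //.
    by apply: measurableT_comp mI _; exact: measurable_fst.
  by apply: measurableT_comp mI _; exact: measurable_snd.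
have m1 : measurable_fun setT (fun x : R => D 0 / 2 * \1_S x) by exact: measurable_funM.
apply: (@lt_le_trans _ _ (\int[(mu \x mu) \x mu]_z
    (D 0 / 2 * \1_S z.1.1 * \1_S z.1.2 * \1_S z.2)%:E)%E).
  have p2 (z : R * R) : 0 <= D 0 / 2 * \1_S z.1 * \1_S z.2.
    by rewrite !mulr_ge0// ltW.
  have p1 (x : R) : 0 <= D 0 / 2 * \1_S x by rewrite mulr_ge0// ltW.
  have -> : (\int[(mu \x mu) \x mu]_z
      (D 0 / 2 * \1_S z.1.1 * \1_S z.1.2 * \1_S z.2)%:E)%E =
    ((\int[mu \x mu]_z (D 0 / 2 * \1_S z.1 * \1_S z.2)%:E)
      * \int[mu]_x (\1_S x)%:E)%E.
    exact: (integral_prod_mul plane_measure mu m2 mI p2 I0).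
  have -> : (\int[mu \x mu]_z (D 0 / 2 * \1_S z.1 * \1_S z.2)%:E)%E =
    ((\int[mu]_x (D 0 / 2 * \1_S x)%:E) * \int[mu]_x (\1_S x)%:E)%E.
    exact: (integral_prod_mul mu mu m1 mI p1 I0).
  under eq_integral do rewrite EFinM.
  rewrite ge0_integralZl_EFin; [|by []|by move=> x _; rewrite lee_fin|
    exact/measurable_EFinP|exact: ltW].
  have -> : (\int[mu]_x (\1_S x)%:E = (d / 2)%:E)%E.
    by rewrite integral_indic// setIT; exact: muS.
  by rewrite -!EFinM lte_fin !mulr_gt0 ?divr_gt0.
apply: ge0_le_integral => //.
- move=> z _; rewrite lee_fin mulr_ge0// mulr_ge0// mulr_ge0//; exact: ltW.
- apply/measurable_EFinP; apply: measurable_funM.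
    exact: (measurableT_comp m2 measurable_fst).
  exact: (measurableT_comp mI measurable_snd).
- apply/measurable_EFinP; exact: (measurable_radial cD).
move=> z _; rewrite lee_fin !indicE.
case: (boolP (z.1.1 \in S)) => [x1|_]; last by rewrite mulr0 !mul0r.
case: (boolP (z.1.2 \in S)) => [x2|_]; last by rewrite mulr0 !mul0r.
case: (boolP (z.2 \in S)) => [x3|_]; last by rewrite mulr0.
move: x1 x2 x3; rewrite !inE /S/= !in_itv/= => /andP[a0 a1] /andP[b0 b1] /andP[c0 c1].
rewrite !mulr1; set r := radius (vec3 z).
have r2 : r ^+ 2 = z.1.1 ^+ 2 + z.1.2 ^+ 2 + z.2 ^+ 2.
  by rewrite /r sqr_radius /coord /vec3 !mxE.
have sq (x : R) : 0 < x -> x < d / 2 -> x ^+ 2 < (d / 2) ^+ 2.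
  by move=> x0 xd; rewrite ltrXn2r//; exact: ltW.
have q1 := sq _ a0 a1; have q2 := sq _ b0 b1; have q3 := sq _ c0 c1.
have r20 : 0 < r ^+ 2 by rewrite r2 !addr_gt0 ?exprn_gt0.
have r0 : 0 < r.
  by rewrite lt_neqAle radius_ge0 andbT eq_sym; apply: contraTneq r20 => ->; rewrite expr0n ltxx.
have rd : r < d.
  rewrite -(@ltr_pXn2r _ 2) ?nnegrE ?(ltW r0) ?(ltW d0)// r2.
  have dd : (d / 2) ^+ 2 = d ^+ 2 / 4 by field.
  have d2 : 0 < d ^+ 2 by rewrite exprn_gt0.
  by rewrite dd in q1 q2 q3; lra.
have := H r r0 rd; rewrite ltr_distl => /andP[_].
by lra.
Qed.

End ProductIntegrals.

Lemma radial_density0_gt0 (R : realType) (lambda : R) F : 0 < lambda ->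
  0 < radial_density lambda F 0.
Proof.
move=> l0; rewrite /radial_density expr0n/= !mul0r !subr0 expr1n mulr1.
rewrite ltr_wpDl ?divr_gt0//; nonneg.
Qed.

Theorem proposition5p21 (R : realType) (lambda : R) (lambda_gt0 : 0 < lambda) :
  exists (A : one_form R) (Phi : end_section R),
    critical_point lambda A Phi /\ (0 < YMH_energy lambda A Phi < +oo)%E.
Proof.
have [B B0 [F [cF dF odeF bk bh]]] := radial_profiles lambda_gt0.
have cD : cont_abs (radial_density lambda F) by exact: radial_density_cont.
have D0 := radial_density_ge0 F lambda_gt0.
have [C C0 DC] := radial_density_decay lambda_gt0 B0 cF dF odeF bk bh.
have E : YMH_energy lambda (hedgehog_connection F) (hedgehog_field F) =
    (\int[(lebesgue_measure \x lebesgue_measure) \x lebesgue_measure]_z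
      (radial_density lambda F (radius (vec3 z)))%:E)%E.
  by apply: eq_integral => z _; rewrite (hedgehog_density lambda cF dF).
have fin : (YMH_energy lambda (hedgehog_connection F) (hedgehog_field F) < +oo)%E.
  by rewrite E; exact: radial_integral_lty cD C0 D0 DC.
have pos : (0 < YMH_energy lambda (hedgehog_connection F) (hedgehog_field F))%E.
  by rewrite E; apply: radial_integral_gt0 cD D0 _; exact: radial_density0_gt0.
exists (hedgehog_connection F), (hedgehog_field F); split; last by rewrite pos.
split=> //.
- exact: su2_connection_hedgehog cF dF.
- exact: su2_section_hedgehog cF dF.
- exact: hedgehog_yang_mills cF dF odeF.
- exact: hedgehog_higgs_equation cF dF odeF.
Qed.
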